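(* Let $k,n\in\mathbb N$ and $f\in L^\infty(\mathbb C,\mu)$. Then $T_{f,1}$ is compact if and only if $T_{f,n}$ is compact. In particular, if $T_{f,(1)}$ is compact, then every $T_{f,(k)}$ is compact as well.
   Context: $\mu$ is the Gaussian measure on $\mathbb C$, $\mathrm d\mu(z)=\frac1\pi e^{-|z|^2}\,\mathrm dz$ ($\mathrm dz$ = Lebesgue area measure). The polyanalytic Fock space $\mathcal F^2_n$ ($n\in\mathbb N=\{1,2,\dots\}$) is the closed subspace of $L^2(\mathbb C,\mu)$ of smooth functions $f$ with $\partial^n f/\partial\bar z^n=0$. The true polyanalytic Fock space $\mathcal F^2_{(k)}$ is the closed subspace of those $f\in L^2(\mathbb C,\mu)$ of the form $f(z)=\frac1{(k-1)!}e^{|z|^2}\frac{\partial^{k-1}}{\partial z^{k-1}}\big(e^{-|z|^2}g(z)\big)$ with $g$ entire; in particular $\mathcal F^2_{(1)}=\mathcal F^2_1$. $P_n$, $P_{(k)}$ are the orthogonal projections of $L^2(\mathbb C,\mu)$ onto $\mathcal F^2_n$, $\mathcal F^2_{(k)}$. The Toeplitz operators are $T_{f,n}:\mathcal F^2_n\to\mathcal F^2_n$, $T_{f,n}g=P_n(fg)$, and $T_{f,(k)}:\mathcal F^2_{(k)}\to\mathcal F^2_{(k)}$, $T_{f,(k)}g=P_{(k)}(fg)$. *)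

(* Defs.v *)
From HB Require Import structures.
From mathcomp Require Import all_boot all_order all_algebra.
From mathcomp Require Import all_classical all_reals all_analysis.
From mathcomp Require Import measurable_realfun.
From mathcomp Require Export complex.

Set Implicit Arguments.
Unset Strict Implicit.
Unset Printing Implicit Defensive.

Import Order.TTheory GRing.Theory Num.Theory numFieldNormedType.Exports.
Import Normc.

Local Open Scope classical_set_scope.
Local Open Scope ring_scope.
Local Open Scope complex_scope.

(* Metric topology of the modulus, with R[i] as scalar field: [derivable g z 1]
   for g : R[i] -> R[i] is complex differentiability at z. *)
HB.instance Definition _ (R : realType) := PseudoPointedMetric.copy R[i] R[i]^o.
HB.instance Definition _ (R : realType) := NormedModule.copy R[i] R[i]^o.

Section ComplexMeasure.
Context {R : realType}.

Definition cplx_of (p : measurableTypeR R * measurableTypeR R) : R[i] :=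
  p.1 +i* p.2.

(* The Borel sets, transported from the plane R * R. *)
Definition cmeasurable : set (set R[i]) :=
  [set A | measurable (cplx_of @^-1` A)].

Let cmeasurable0 : cmeasurable set0.
Proof. by rewrite /cmeasurable /= preimage_set0. Qed.

Let cmeasurableC A : cmeasurable A -> cmeasurable (~` A).
Proof. exact: measurableC. Qed.

Let cmeasurable_bigcup (F : (set R[i])^nat) :
  (forall i, cmeasurable (F i)) -> cmeasurable (\bigcup_i F i).
Proof.
move=> mF; rewrite /cmeasurable /= preimage_bigcup.
by apply: bigcup_measurable => i _; exact: mF.
Qed.

HB.instance Definition _ := @isMeasurable.Build default_measure_display R[i]
  cmeasurable cmeasurable0 cmeasurableC cmeasurable_bigcup.

Definition area (A : set R[i]) : \bar R :=
  (@lebesgue_measure R \x @lebesgue_measure R)%E (cplx_of @^-1` A).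

Let area0 : area set0 = 0%E.
Proof. by rewrite /area preimage_set0 measure0. Qed.

Let area_ge0 A : (0 <= area A)%E.
Proof. exact: measure_ge0. Qed.

Let area_sigma_additive : semi_sigma_additive area.
Proof.
move=> F mF tF mUF; rewrite /area preimage_bigcup.
apply: measure_semi_sigma_additive => //.
apply/trivIsetP => /= i j _ _ ij; rewrite -preimage_setI.
by move/trivIsetP : tF => /(_ _ _ _ _ ij) ->.
Qed.

HB.instance Definition _ := isMeasure.Build _ _ _
  area area0 area_ge0 area_sigma_additive.

Definition gauss_density (z : R[i]) : R := pi^-1 * expR (- normc z ^+ 2).

Definition mu (A : set R[i]) : \bar R :=
  (\int[area]_(z in A) (gauss_density z)%:E)%E.

Let gauss_density_ge0 z : 0 <= gauss_density z.
Proof. by rewrite mulr_ge0 ?expR_ge0 // invr_ge0 pi_ge0. Qed.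

Let measurable_cplx_of : measurable_fun setT cplx_of.
Proof. by move=> _ A mA; rewrite setTI. Qed.

Let measurable_gauss_density : measurable_fun setT gauss_density.
Proof.
have mE : measurable_fun setT (gauss_density \o cplx_of).
  rewrite (_ : _ \o _ =
      fun p : R * R => pi^-1 * expR (- (p.1 ^+ 2 + p.2 ^+ 2))); last first.
    apply/funext => -[x y]; rewrite /gauss_density /=.
    by rewrite sqr_sqrtr // addr_ge0 // sqr_ge0.
  apply: measurable_funM => //; apply: measurableT_comp => //.
  apply: measurableT_comp => //.
  by apply: measurable_funD; apply: measurable_funX.
by move=> _ A mA; rewrite setTI; have := mE measurableT _ mA; rewrite setTI.
Qed.

Let mu0 : mu set0 = 0%E.
Proof. by rewrite /mu integral_set0. Qed.

Let mu_ge0 A : (0 <= mu A)%E.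
Proof. by apply: integral_ge0 => z _; rewrite lee_fin gauss_density_ge0. Qed.

Let mu_sigma_additive : semi_sigma_additive mu.
Proof.
move=> F mF tF mUF; rewrite /mu ge0_integral_bigcup //=.
- apply: is_cvg_ereal_nneg_natsum_cond => n _ _.
  by apply: integral_ge0 => z _; rewrite lee_fin gauss_density_ge0.
- by apply/measurable_EFinP/measurable_funTS.
- by move=> z _; rewrite lee_fin gauss_density_ge0.
Qed.

HB.instance Definition _ := isMeasure.Build _ _ _
  mu mu0 mu_ge0 mu_sigma_additive.

End ComplexMeasure.

Section L2.
Context {R : realType}.
Implicit Types f g u v : R[i] -> R[i].

(* Classes modulo mu-null sets are represented by measurable functions. *)
Definition Lp (p : \bar R) : set (R[i] -> R[i]) :=
  [set f | measurable_fun setT f /\ finite_norm mu p (fun z => normc (f z))].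

Definition L2norm f : \bar R := ('N[mu]_2%:E [EFin \o (fun z => normc (f z))])%E.

Definition cintegral f : R[i] :=
  (\int[mu]_z complex.Re (f z))%R +i* (\int[mu]_z complex.Im (f z))%R.

Definition inner u v : R[i] := cintegral (fun z => u z * ((v z)^*)%C).

(* The only h in F with u - h orthogonal to F; it exists for u in L^2 because the
   spaces F used below are closed. *)
Definition orth_proj (F : set (R[i] -> R[i])) u : R[i] -> R[i] :=
  get [set h | F h /\ forall v, F v -> inner (u \- h) v = 0].

Definition toeplitz f (F : set (R[i] -> R[i])) g : R[i] -> R[i] :=
  orth_proj F (f \* g).

(* T, viewed as an operator F -> F, maps bounded sequences to sequences with a
   subsequence converging in F. *)
Definition compact_op (F : set (R[i] -> R[i]))
    (T : (R[i] -> R[i]) -> (R[i] -> R[i])) : Prop :=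
  forall g_ : nat -> R[i] -> R[i],
    (forall j, F (g_ j)) ->
    (exists M : R, forall j, (L2norm (g_ j) <= M%:E)%E) ->
    exists (s : nat -> nat) (h : R[i] -> R[i]),
      [/\ {homo s : i j / (i < j)%N}, F h &
          (fun j => L2norm (T (g_ (s j)) \- h)) @ \oo --> 0%E].

End L2.

Section Wirtinger.
Context {R : realType}.
Implicit Types f : R[i] -> R[i].

(* Real directional derivatives, taken componentwise. *)
Definition has_partial (v : R[i]) f (z : R[i]) : Prop :=
  derivable (fun t : R => complex.Re (f (z + t%:C * v))) 0 1 /\
  derivable (fun t : R => complex.Im (f (z + t%:C * v))) 0 1.

Definition partial (v : R[i]) f (z : R[i]) : R[i] :=
  derive1 (fun t : R => complex.Re (f (z + t%:C * v))) 0 +i*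
  derive1 (fun t : R => complex.Im (f (z + t%:C * v))) 0.

Definition d_z f (z : R[i]) : R[i] :=
  2^-1 * (partial 1 f z - 'i%C * partial 'i f z).

Definition d_zbar f (z : R[i]) : R[i] :=
  2^-1 * (partial 1 f z + 'i%C * partial 'i f z).

Fixpoint cont_diff (m : nat) f : Prop :=
  continuous f /\
  if m is m'.+1 then
    (forall z, has_partial 1 f z /\ has_partial 'i f z) /\
    cont_diff m' (partial 1 f) /\ cont_diff m' (partial 'i f)
  else True.

Definition smooth f : Prop := forall m, cont_diff m f.

Definition entire f : Prop := forall z, derivable f z 1.

End Wirtinger.

Section FockSpaces.
Context {R : realType}.

(* A class of L^2 has at most one continuous representative, so the Fock spaces
   are sets of genuine (smooth) functions. *)
Definition polyFock (n : nat) : set (R[i] -> R[i]) :=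
  [set f | [/\ Lp 2%:E f, smooth f & forall z, iter n d_zbar f z = 0]].

(* Meaningful for 0 < k: the index 0 gives the same space as the index 1. *)
Definition true_polyFock (k : nat) : set (R[i] -> R[i]) :=
  [set f | Lp 2%:E f /\
    exists2 g : R[i] -> R[i], entire g &
      forall z, f z =
        (k.-1`!%:R)^-1 * (expR (normc z ^+ 2))%:C *
        iter k.-1 d_z (fun w => (expR (- normc w ^+ 2))%:C * g w) z].

End FockSpaces.

(* Main.v *)
From HB Require Import structures.
From mathcomp Require Import all_boot all_order all_algebra.
From mathcomp Require Import all_classical all_reals all_analysis.
From mathcomp Require Import measurable_realfun.
From mathcomp Require Import ring lra zify.
Require Import Defs.
Set Implicit Arguments.
Unset Strict Implicit.
Unset Printing Implicit Defensive.
Import Order.TTheory GRing.Theory Num.Theory numFieldNormedType.Exports.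
Import Normc.
Local Open Scope classical_set_scope.
Local Open Scope ring_scope.
Local Open Scope complex_scope.
Local Notation "z ^*" := (conjc z) : ring_scope.

(** Below, z' is the complex conjugate of z and levels are numbered from 0, so that
    the true polyanalytic space of index k is level k-1.

    All levels are copies of the first one. Let A_j and B_j ([Aop], [Bop]) be the
    integral operators on L^2(mu) with kernels (z - w)^j e^{zw'} and
    (w' - z')^j e^{zw'}. They are bounded ([tc_L2], a Young inequality), adjoint to
    each other ([inner_AopBop]), and A_l B_j is 0 for l <> j and j! P for l = j, where
    P is the projection onto level 0 ([AopBop]). So the sum over j in J of
    B_j A_j / j! ([lproj]) is the orthogonal projection onto the sum of the levels
    in J ([levels]), and the compression of f to these levels consists of the blocks
    A_l f B_j, which act on level 0.

    Weyl translations make all blocks compact as soon as the block j = l = 0 is. On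
    level 0, the operator V_x = sum_j (x^j / j!) B_j is g |-> e^{-xz'} g(z + x), which
    is the isometric Weyl translation up to a factor of constant modulus. Hence the
    form <f V_x g, V_x h> is compact for every x if it is for x = 0
    ([cptform_qform]). It is also the sum of x^j x'^l <f B_j g, B_l h> / (j! l!), and
    coefficients of an expansion in x and x' are limits of linear combinations of its
    values at different x ([cptform_coef]); so all blocks are compact
    ([cptform_cform]). Since the levels are complete, the Toeplitz operator on any
    finite set of levels is compact ([compact_up]). The converse only uses that level
    0 is one of the levels ([compact_down]).

    It remains to recognize the spaces of the statement. A function annihilated by
    the n-th power of d/dz' is a polynomial of degree less than n in z' with entire
    coefficients ([polyanalytic_polyform]). If such a function is in L^2(mu) and A_m,
    m being the degree, annihilates it, then testing its translates against w^m on
    large discs shows that the leading coefficient is 0 ([lead_polyform_eq0]). This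
    applies to the difference of a polyanalytic function and its projection, which
    all A_j, j < n, annihilate, and gives [polyFock_levels]. For a single level
    it is combined with the differential form B_j g = e^{|z|^2} (d/dz)^j (e^{-|z|^2} g)
    ([Bop_rodr]), and gives [true_polyFock_levels].

    The input from function theory is that an entire function has the value at the
    centre as its mean against radial weights ([radial_mean]), that its derivative is
    entire ([entire_der]), and that the kernel e^{zw'} reproduces it when it is in
    L^2(mu) ([holo_F1]). As entire functions are only assumed to be differentiable,
    everything starts from Goursat's theorem ([goursat]). *)

(** * Complex numbers and the exponential function *)

Section ComplexModulus.
Context {R : realType}.
Implicit Types (z w : R[i]) (r : R).

Lemma complexP z w : complex.Re z = complex.Re w -> complex.Im z = complex.Im w ->
  z = w.
Proof. by case: z w => [a b] [c d] /= -> ->. Qed.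

Lemma cReD z w : complex.Re (z + w) = complex.Re z + complex.Re w.
Proof. by case: z w => [a b] [c d]. Qed.
Lemma cImD z w : complex.Im (z + w) = complex.Im z + complex.Im w.
Proof. by case: z w => [a b] [c d]. Qed.
Lemma cReN z : complex.Re (- z) = - complex.Re z.
Proof. by case: z. Qed.
Lemma cImN z : complex.Im (- z) = - complex.Im z.
Proof. by case: z. Qed.
Lemma cReM z w : complex.Re (z * w) =
  complex.Re z * complex.Re w - complex.Im z * complex.Im w.
Proof. by case: z w => [a b] [c d]. Qed.
Lemma cImM z w : complex.Im (z * w) =
  complex.Re z * complex.Im w + complex.Im z * complex.Re w.
Proof. by case: z w => [a b] [c d]. Qed.
Lemma cReJ z : complex.Re z^* = complex.Re z. Proof. by case: z. Qed.
Lemma cImJ z : complex.Im z^* = - complex.Im z. Proof. by case: z. Qed.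

Definition reim := (cReD, cImD, cReN, cImN, cReM, cImM, cReJ, cImJ).

Lemma normc_ge0 z : 0 <= normc z.
Proof. by case: z => a b; exact: sqrtr_ge0. Qed.

Lemma normc2 z : normc z ^+ 2 = complex.Re z ^+ 2 + complex.Im z ^+ 2.
Proof. by case: z => a b /=; rewrite sqr_sqrtr // addr_ge0 // sqr_ge0. Qed.

Lemma normcD z w : normc (z + w) <= normc z + normc w.
Proof. exact: le_normcD. Qed.

Lemma normcNE z : normc (- z) = normc z.
Proof. exact: normcN. Qed.

Lemma normcB z w : normc (z - w) <= normc z + normc w.
Proof. by rewrite (le_trans (normcD _ _)) // normcNE. Qed.

Lemma normc_distC z w : normc (z - w) = normc (w - z).
Proof. by rewrite -normcNE opprB. Qed.

Lemma normcR r : normc r%:C = `|r|.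
Proof. by rewrite /normc /= expr0n /= addr0 sqrtr_sqr. Qed.

Lemma normcJ z : normc z^* = normc z.
Proof. by case: z => a b /=; rewrite sqrrN. Qed.

Lemma normcX z n : normc (z ^+ n) = normc z ^+ n.
Proof. by elim: n => [|n IH]; rewrite ?normc1 // !exprS normcM IH. Qed.

Lemma conjD z w : (z + w)^* = z^* + w^*. Proof. exact: rmorphD. Qed.
Lemma conjM z w : (z * w)^* = z^* * w^*. Proof. exact: rmorphM. Qed.
Lemma conjN z : (- z)^* = - z^*. Proof. exact: rmorphN. Qed.
Lemma conjB z w : (z - w)^* = z^* - w^*. Proof. exact: rmorphB. Qed.
Lemma conjX z n : (z ^+ n)^* = z^* ^+ n. Proof. exact: rmorphXn. Qed.
Lemma conj_real r : (r%:C)^* = r%:C. Proof. exact: conjc_real. Qed.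
Lemma conj_sum (I : Type) (s : seq I) (F : I -> R[i]) :
  (\sum_(i <- s) F i)^* = \sum_(i <- s) (F i)^*.
Proof. exact: rmorph_sum. Qed.

Lemma normc_Re z : `|complex.Re z| <= normc z.
Proof.
by rewrite -[leLHS]sqrtr_sqr -[leRHS](ger0_norm (normc_ge0 z)) -[leRHS]sqrtr_sqr
  ler_wsqrtr // normc2 lerDl sqr_ge0.
Qed.

Lemma normc_Im z : `|complex.Im z| <= normc z.
Proof.
by rewrite -[leLHS]sqrtr_sqr -[leRHS](ger0_norm (normc_ge0 z)) -[leRHS]sqrtr_sqr
  ler_wsqrtr // normc2 lerDr sqr_ge0.
Qed.

Lemma normc_i : normc ('i%C : R[i]) = 1.
Proof. by rewrite /normc /= expr0n /= add0r expr1n sqrtr1. Qed.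

Lemma complexE' z : z = (complex.Re z)%:C + 'i%C * (complex.Im z)%:C.
Proof. by apply: complexP; rewrite !reim /=; ring. Qed.

Lemma normc_le_ReIm z : normc z <= `|complex.Re z| + `|complex.Im z|.
Proof.
rewrite [X in normc X]complexE' (le_trans (normcD _ _)) //.
by rewrite normcM normc_i mul1r !normcR.
Qed.

Lemma normc_mk (a b : R) : normc (a +i* b) <= `|a| + `|b|.
Proof. exact: (normc_le_ReIm (a +i* b)). Qed.

Lemma normcJM z : z * z^* = (normc z ^+ 2)%:C.
Proof. by rewrite normc2; apply: complexP; rewrite !reim /=; ring. Qed.

Lemma normc_eq0 z : (normc z == 0) = (z == 0).
Proof.
by apply/eqP/eqP => [/eq0_normc|->]; rewrite ?normc0.
Qed.

Lemma normc_gt0 z : (0 < normc z) = (z != 0).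
Proof. by rewrite lt_neqAle normc_ge0 andbT eq_sym normc_eq0. Qed.

Lemma normc_sum (I : Type) (s : seq I) (F : I -> R[i]) :
  normc (\sum_(i <- s) F i) <= \sum_(i <- s) normc (F i).
Proof.
elim: s => [|i s IH]; first by rewrite !big_nil normc0.
by rewrite !big_cons (le_trans (normcD _ _)) // lerD2l.
Qed.

Lemma normrcE z : `|z| = (normc z)%:C.
Proof. by case: z. Qed.

Lemma realC_lt (r s : R) : (r%:C < s%:C) = (r < s).
Proof. exact: ltcR. Qed.

Definition cexp z : R[i] :=
  (expR (complex.Re z) * cos (complex.Im z)) +i*
  (expR (complex.Re z) * sin (complex.Im z)).

Lemma cexp0 : cexp 0 = 1.
Proof. by rewrite /cexp /= expR0 cos0 sin0 mulr1 mulr0. Qed.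

Lemma cexpD z w : cexp (z + w) = cexp z * cexp w.
Proof.
by apply: complexP; rewrite !reim /cexp /= !reim expRD ?cosD ?sinD; ring.
Qed.

Lemma normc_cexp z : normc (cexp z) = expR (complex.Re z).
Proof.
rewrite /cexp /normc !exprMn -mulrDr cos2Dsin2 mulr1 sqrtr_sqr.
by rewrite ger0_norm // expR_ge0.
Qed.

Lemma cexpN z : cexp (- z) * cexp z = 1.
Proof. by rewrite -cexpD addNr cexp0. Qed.

Lemma cexp_neq0 z : cexp z != 0.
Proof. by rewrite -normc_gt0 normc_cexp expR_gt0. Qed.

Lemma cexpR r : cexp r%:C = (expR r)%:C.
Proof. by rewrite /cexp /= cos0 sin0 mulr1 mulr0. Qed.

Lemma cexpJ z : (cexp z)^* = cexp z^*.
Proof. by apply: complexP; rewrite !reim /cexp /= !reim ?cosN ?sinN; ring. Qed.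

End ComplexModulus.

(** * Complex derivatives *)

Section ComplexDerivative.
Context {R : realType}.
Implicit Types (f g : R[i] -> R[i]) (z w h l : R[i]).

(** Differentiability with real tolerances: as a normed module, [R[i]] has a norm with
   values in [R[i]] itself. *)
Definition cder f z l := forall e : R, 0 < e -> exists2 d : R, 0 < d &
  forall h, normc h < d -> normc (f (z + h) - f z - l * h) <= e * normc h.

Definition holo f := forall z, exists l, cder f z l.

Lemma cder_cst c z : cder (fun=> c) z 0.
Proof.
move=> e e0; exists 1 => // h _.
by rewrite mul0r subr0 subrr normc0 mulr_ge0 ?normc_ge0 // ltW.
Qed.

Lemma cder_id z : cder id z 1.
Proof.
move=> e e0; exists 1 => // h _.
rewrite (_ : _ - _ = 0); last by ring.
by rewrite normc0 mulr_ge0 ?normc_ge0 // ltW.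
Qed.

Lemma cderD f g z a b : cder f z a -> cder g z b ->
  cder (fun x => f x + g x) z (a + b).
Proof.
move=> Hf Hg e e0; have e20 : 0 < e / 2 by rewrite divr_gt0.
have [d1 d10 H1] := Hf _ e20; have [d2 d20 H2] := Hg _ e20.
exists (Num.min d1 d2); first by rewrite lt_min d10.
move=> h; rewrite lt_min => /andP[/H1 h1 /H2 h2].
rewrite (_ : _ - _ = (f (z + h) - f z - a * h) + (g (z + h) - g z - b * h)); last by ring.
by rewrite (le_trans (normcD _ _)) // [e]splitr mulrDl lerD.
Qed.

Lemma cder_lip f z l : cder f z l -> exists2 d : R, 0 < d &
  forall h, normc h < d -> normc (f (z + h) - f z) <= (normc l + 1) * normc h.
Proof.
move=> /(_ 1 ltr01)[d d0 H]; exists d => // h /H h1.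
rewrite -[X in normc X](subrK (l * h)) (le_trans (normcD _ _)) //.
by rewrite mulrDl normcM addrC lerD.
Qed.

Lemma cderM f g z a b : cder f z a -> cder g z b ->
  cder (fun x => f x * g x) z (a * g z + f z * b).
Proof.
move=> Hf Hg e e0.
pose M := normc (g z) + normc b + 1 + normc (f z) + (normc a + 1) + 1.
have M0 : 0 < M by have := (normc_ge0 (g z), normc_ge0 b, normc_ge0 (f z), normc_ge0 a);
  rewrite /M; case=> [[[? ?] ?] ?]; lra.
have e30 : 0 < e / M / 2 by rewrite !divr_gt0.
have [d1 d10 H1] := Hf _ e30; have [d2 d20 H2] := Hg _ e30.
have [d3 d30 H3] := cder_lip Hf; have [d4 d40 H4] := cder_lip Hg.
have Q0 : 0 < (normc a + 1) * (normc b + 1).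
  by rewrite mulr_gt0 // ltr_wpDl ?normc_ge0.
exists (Num.min (Num.min d1 d2) (Num.min (Num.min d3 d4)
  (e / 2 / ((normc a + 1) * (normc b + 1))))).
  by rewrite !lt_min d10 d20 d30 d40 /= !divr_gt0.
move=> h; rewrite !lt_min => /andP[/andP[/H1 h1 /H2 h2]] /andP[/andP[/H3 h3 /H4 h4] h5].
set A := f (z + h) - f z; set B := g (z + h) - g z.
rewrite (_ : _ - _ = (A - a * h) * g z + (f z * (B - b * h)) + A * B); last first.
  by rewrite /A /B; ring.
have hh := normc_ge0 h.
have K1 : normc ((A - a * h) * g z) <= e / M / 2 * normc h * normc (g z).
  by rewrite normcM ler_wpM2r ?normc_ge0.
have K2 : normc (f z * (B - b * h)) <= normc (f z) * (e / M / 2 * normc h).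
  by rewrite normcM ler_wpM2l ?normc_ge0.
have K3 : normc (A * B) <= e / 2 * normc h.
  rewrite normcM (le_trans (ler_pM (normc_ge0 _) (normc_ge0 _) h3 h4)) //.
  rewrite mulrACA [X in X <= _]mulrCA [leRHS]mulrC ler_wpM2l //.
  by rewrite mulrC -ler_pdivlMr // ltW.
rewrite (le_trans (normcD _ _)) // (le_trans (lerD (normcD _ _) (lexx _))) //.
apply: (le_trans (lerD (lerD K1 K2) K3)).
have -> : e / M / 2 * normc h * normc (g z) + normc (f z) * (e / M / 2 * normc h)
  = (normc (g z) + normc (f z)) / M * (e / 2 * normc h) by ring.
have le1 : (normc (g z) + normc (f z)) / M <= 1.
  rewrite ler_pdivrMr // mul1r /M.
  by have := (normc_ge0 b, normc_ge0 a); case=> ? ?; lra.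
rewrite -[X in _ + X]mul1r -mulrDl [e in leRHS]splitr mulrDl.
have E0 : 0 <= e / 2 * normc h by rewrite mulr_ge0 // ltW // divr_gt0.
nra.
Qed.

Lemma cder_comp f g z a b : cder f z a -> cder g (f z) b ->
  cder (fun x => g (f x)) z (b * a).
Proof.
move=> Hf Hg e e0.
have na := normc_ge0 a; have nb := normc_ge0 b.
have [d1 d10 H1] := cder_lip Hf.
have e1 : 0 < e / 2 / (normc a + 1) by rewrite !divr_gt0 // ltr_wpDl.
have [d2 d20 H2] := Hg _ e1.
have e2 : 0 < e / 2 / (normc b + 1) by rewrite !divr_gt0 // ltr_wpDl.
have [d3 d30 H3] := Hf _ e2.
exists (Num.min (Num.min d1 d3) (d2 / (normc a + 1))).
  by rewrite !lt_min d10 d30 divr_gt0 // ltr_wpDl.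
move=> h; rewrite !lt_min => /andP[/andP[/H1 h1 /H3 h3] h2].
set k := f (z + h) - f z.
have fzk : f (z + h) = f z + k by rewrite /k; ring.
have kd2 : normc k < d2.
  by rewrite (le_lt_trans h1) // mulrC -ltr_pdivlMr // ltr_wpDl.
have := H2 _ kd2; rewrite -fzk => h4.
rewrite (_ : _ - _ = (g (f (z + h)) - g (f z) - b * k) + b * (k - a * h)); last by ring.
rewrite (le_trans (normcD _ _)) // normcM [e]splitr mulrDl lerD //.
  rewrite (le_trans h4) // (le_trans (ler_wpM2l (ltW e1) h1)) //.
  by rewrite mulrA -[X in X * _]mulrA mulVf ?mulr1 // gt_eqF // ltr_wpDl.
rewrite (le_trans (ler_wpM2l nb h3)) // !mulrA ler_wpM2r ?normc_ge0 //.
rewrite ler_pdivrMr ?ltr_wpDl //.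
have E0 : 0 <= e / 2 by rewrite ltW // divr_gt0.
by rewrite -mulrA [leLHS]mulrC ler_wpM2l // lerDl.
Qed.

Lemma cder_eq f g z a : f =1 g -> cder f z a -> cder g z a.
Proof. by move=> /funext->. Qed.

Lemma cder_unique f z a b : cder f z a -> cder f z b -> a = b.
Proof.
move=> Ha Hb; apply/eqP; rewrite -subr_eq0 -normc_eq0; apply/eqP/le_anti.
rewrite normc_ge0 andbT; apply/ler_addgt0Pl => e e0; rewrite addr0.
have e20 : 0 < e / 2 by rewrite divr_gt0.
have [d1 d10 H1] := Ha _ e20; have [d2 d20 H2] := Hb _ e20.
pose d := Num.min d1 d2 / 2.
have d0 : 0 < d by rewrite divr_gt0 // lt_min d10.
have nd : normc (d%:C : R[i]) = d by rewrite normcR gtr0_norm.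
have dlt : d < Num.min d1 d2 by rewrite ltr_pdivrMr // ltr_pMr ?lt_min ?d10 // ltr1n.
have := dlt; rewrite lt_min => /andP[dd1 dd2].
have /H1 h1 : normc (d%:C : R[i]) < d1 by rewrite nd.
have /H2 h2 : normc (d%:C : R[i]) < d2 by rewrite nd.
rewrite -(ler_pM2r d0) -[X in _ * X <= _]nd -normcM.
rewrite (_ : _ * _ = (f (z + d%:C) - f z - b * d%:C) - (f (z + d%:C) - f z - a * d%:C));
  last by ring.
rewrite nd in h1 h2.
by rewrite (le_trans (normcB _ _)) // [e]splitr mulrDl lerD.
Qed.

Lemma cderZ f z a c : cder f z a -> cder (fun x => c * f x) z (c * a).
Proof.
by move=> H; have := cderM (cder_cst c z) H; rewrite mul0r add0r.
Qed.

Lemma cderN f z a : cder f z a -> cder (fun x => - f x) z (- a).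
Proof.
move=> H; have := cderZ (-1) H; rewrite mulN1r; apply: cder_eq => x.
by rewrite mulN1r.
Qed.

Lemma cder_shift f z c a : cder f (z + c) a -> cder (fun x => f (x + c)) z a.
Proof.
move=> H e e0; have [d d0 D] := H _ e0; exists d => // h /D.
by rewrite (addrAC z c h).
Qed.

Lemma cder_expr (c z : R[i]) n :
  cder (fun x => (x - c) ^+ n) z (n%:R * (z - c) ^+ n.-1).
Proof.
elim: n => [|n IH]; first by rewrite mul0r; exact: cder_cst.
have H1 : cder (fun x => x - c) z 1.
  by have := cderD (cder_id z) (cder_cst (- c) z); rewrite addr0.
have := cderM H1 IH; rewrite mul1r mulrCA.
case: n IH => [|n] IH.
  by rewrite /= mul0r addr0 expr0 mul1r; apply: cder_eq => x; rewrite expr1 expr0 mulr1.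
rewrite /= -exprS -{1}[(z - c) ^+ n.+1]mul1r -mulrDl -mulrS.
by apply: cder_eq => x; rewrite -exprS.
Qed.

End ComplexDerivative.

(** * The Cauchy-Riemann equation *)

Section Bridges.
Context {R : realType}.
Implicit Types (f g : R[i] -> R[i]) (z w h l : R[i]).

Definition ccont f z := forall e : R, 0 < e -> exists2 d : R, 0 < d &
  forall h, normc h < d -> normc (f (z + h) - f z) < e.

Lemma posC (e : R[i]) : 0 < e -> exists2 r : R, 0 < r & e = r%:C.
Proof.
case: e => a b; rewrite ltcE /= => /andP[/eqP b0 a0]; exists a => //.
by rewrite b0.
Qed.

Lemma ccontP f z : {for z, continuous f} <-> ccont f z.
Proof.
split.
  move=> /cvgrPdist_lt H e e0.
  have e0' : 0 < e%:C by rewrite realC_lt.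
  have /nbhs_ballP[d /= /posC[d' d0 ->] D] := H _ e0'.
  exists d' => // h hd; have /= := D (z + h).
  rewrite /ball /= opprD addrA subrr sub0r normrN normrcE realC_lt => /(_ hd).
  by rewrite normrcE realC_lt normc_distC.
move=> H; apply/(@cvgrPdist_lt _ _ _ (nbhs z)) => e /posC[e' e0 ->].
have [d d0 D] := H _ e0.
apply/nbhs_ballP; exists d%:C => /=; first by rewrite realC_lt.
move=> y; rewrite /ball /= normrcE realC_lt => yd.
have := D (y - z); rewrite normc_distC => /(_ yd).
by rewrite (_ : z + (y - z) = y) ?[normc (f y - _)]normc_distC ?normrcE ?realC_lt //; ring.
Qed.

Lemma derivable_cder f z : derivable f z 1 -> cder f z ('D_1 f z).
Proof.
move=> H e e0.
have e0' : 0 < e%:C by rewrite realC_lt.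
move/cvgrPdist_lt : H => /(_ _ e0') H.
have /nbhs_ballP[d /= /posC[d' d0 ->] D] := H.
exists d' => // h hd.
have [->|h0] := eqVneq h 0.
  by rewrite addr0 subrr mulr0 subrr normc0 mulr0.
have /= := D h; rewrite /ball /= sub0r normrN normrcE realC_lt => /(_ hd h0).
rewrite normrcE realC_lt /shift /= => /ltW K.
rewrite -(ler_pM2r (x := (normc h)^-1)) ?invr_gt0 ?normc_gt0 //.
rewrite -mulrA divff ?normc_eq0 // mulr1 -normcV -normcM.
apply: le_trans K; rewrite -normcNE /GRing.scale /= mulr1 addrC [h + z]addrC.
rewrite le_eqVlt; apply/orP; left; apply/eqP; congr normc.
rewrite /derive; set l := lim _.
by field.
Qed.

Lemma cder_derivable f z l : cder f z l -> derivable f z 1 /\ 'D_1 f z = l.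
Proof.
move=> H.
have H1 : (fun h => h^-1 *: ((f \o shift z) (h *: 1) - f z)) @ 0^' --> l.
  apply/cvgrPdist_lt => e /posC[e' e0 ->].
  have e20 : 0 < e' / 2 by rewrite divr_gt0.
  have [d d0 D] := H _ e20.
  apply/nbhs_ballP; exists d%:C => /=; first by rewrite realC_lt.
  move=> h; rewrite /ball /= sub0r normrN normrcE realC_lt => hd h0.
  rewrite normrcE realC_lt /shift /=.
  have := D _ hd; rewrite -(ler_pM2r (x := (normc h)^-1)) ?invr_gt0 ?normc_gt0 //.
  rewrite mulfK ?normc_eq0 // -normcV -normcM => K.
  apply: (@le_lt_trans _ _ (e' / 2)); last by rewrite ltr_pdivrMr // ltr_pMr // ltr1n.
  apply: le_trans K; rewrite -normcNE /GRing.scale /= mulr1 [h + z]addrC.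
  rewrite le_eqVlt; apply/orP; left; apply/eqP; congr normc.
  by field.
split; first by apply/cvg_ex; exists l.
exact: cvg_lim.
Qed.

Lemma cder_ccont f z l : cder f z l -> ccont f z.
Proof.
move=> /cder_lip[d d0 D] e e0.
have n1 : 0 < normc l + 1 by rewrite ltr_wpDl ?normc_ge0.
exists (Num.min d (e / (normc l + 1))); first by rewrite lt_min d0 divr_gt0.
move=> h; rewrite lt_min => /andP[/D h1 h2].
by rewrite (le_lt_trans h1) // mulrC -ltr_pdivlMr.
Qed.

Lemma is_derive_shift0 (p : R -> R) (t : R) :
  derivable (fun s => p (t + s)) 0 1 ->
  is_derive t 1 p (derive1 (fun s => p (t + s)) 0).
Proof.
move=> H.
have E : (fun h : R => h^-1 *: (((fun s => p (t + s)) \o shift 0) (h *: 1) - p (t + 0))) =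
  (fun h : R => h^-1 *: ((p \o shift t) (h *: 1) - p t)).
  by apply/funext => h; rewrite /shift /= !addr0 [h%:A + t]addrC.
apply: DeriveDef; first by rewrite /derivable -E.
by rewrite derive1E /derive -E.
Qed.

Lemma MVT_abs (p dp : R -> R) : (forall t : R, is_derive t 1 p (dp t)) ->
  forall r, exists2 c, `|c| <= `|r| & p r - p 0 = dp c * r.
Proof.
move=> H r.
have C (a b : R) : {within `[a, b], continuous p}.
  by apply: derivable_within_continuous => x _; case: (H x).
have [r0|r0|->] := ltgtP r 0.
- have [c /andP[c1 c2] E] := MVT_segment (ltW r0) (fun x _ => H x) (C _ _).
  exists c; last by lra.
  by rewrite (ler0_norm (ltW r0)) ler0_norm ?lerN2.
- have [c /andP[c1 c2] E] := MVT_segment (ltW r0) (fun x _ => H x) (C _ _).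
  exists c; last by lra.
  by rewrite (ger0_norm (ltW r0)) ger0_norm.
- by exists 0; rewrite ?subrr ?mulr0.
Qed.

Lemma line_partial f v z (t : R) :
  has_partial v f (z + t%:C * v) ->
  is_derive t 1 (fun t : R => complex.Re (f (z + t%:C * v))) (complex.Re (partial v f (z + t%:C * v))) /\
  is_derive t 1 (fun t : R => complex.Im (f (z + t%:C * v))) (complex.Im (partial v f (z + t%:C * v))).
Proof.
have E : (fun s : R => f (z + t%:C * v + s%:C * v)) = fun s : R => f (z + (t + s)%:C * v).
  by apply/funext => s; rewrite -addrA -mulrDl -rmorphD.
case=> /= H1 H2; split.
- have := @is_derive_shift0 (fun t : R => complex.Re (f (z + t%:C * v))) t.
  rewrite /partial /=.
  have -> : (fun s : R => complex.Re (f (z + (t + s)%:C * v))) =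
    (fun t0 : R => complex.Re (f (z + t%:C * v + t0%:C * v))).
    by apply/funext => s; rewrite -[f (_ + _ + _)]/((fun s : R => f (z + t%:C * v + s%:C * v)) s) E.
  by move/(_ H1).
- have := @is_derive_shift0 (fun t : R => complex.Im (f (z + t%:C * v))) t.
  rewrite /partial /=.
  have -> : (fun s : R => complex.Im (f (z + (t + s)%:C * v))) =
    (fun t0 : R => complex.Im (f (z + t%:C * v + t0%:C * v))).
    by apply/funext => s; rewrite -[f (_ + _ + _)]/((fun s : R => f (z + t%:C * v + s%:C * v)) s) E.
  by move/(_ H2).
Qed.

(** Real and imaginary part need their own intermediate points. *)
Lemma MVT_partial f v : (forall z, has_partial v f z) ->
  forall z (r : R), exists c1 c2 : R, [/\ `|c1| <= `|r|, `|c2| <= `|r| &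
   f (z + r%:C * v) - f z = r%:C *
     (complex.Re (partial v f (z + c1%:C * v)) +i* complex.Im (partial v f (z + c2%:C * v)))].
Proof.
move=> H z r.
have [c1 h1 E1] := MVT_abs (fun t => (line_partial (H (z + t%:C * v))).1) r.
have [c2 h2 E2] := MVT_abs (fun t => (line_partial (H (z + t%:C * v))).2) r.
exists c1, c2; split => //; move: E1 E2; rewrite !mul0r !addr0.
move: (partial v f (z + c1%:C * v)) (partial v f (z + c2%:C * v)) => p1 p2.
move: (f (z + r%:C * v)) (f z) => a b E1 E2.
by apply: complexP; rewrite !reim /= ?E1 ?E2; ring.
Qed.

Let CR_ring (a b : R) (L P1 P2 P3 P4 : R[i]) :
  b%:C * (complex.Re ('i%C * P3) +i* complex.Im ('i%C * P4)) +
  a%:C * (complex.Re P1 +i* complex.Im P2) - L * (a +i* b) =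
  a%:C * (complex.Re (P1 - L) +i* complex.Im (P2 - L)) +
  b%:C * (complex.Re ('i%C * (P3 - L)) +i* complex.Im ('i%C * (P4 - L))).
Proof.
case: L P1 P2 P3 P4 => [? ?] [? ?] [? ?] [? ?] [? ?].
by apply/eqP; rewrite eq_complex /=; apply/andP; split; apply/eqP; ring.
Qed.

(** Continuous real partial derivatives and the Cauchy-Riemann equation give
   complex differentiability, by the mean value theorem along the two axes. *)
Lemma CR_cder f z :
  (forall w, has_partial 1 f w) -> (forall w, has_partial 'i%C f w) ->
  (forall w, partial 'i%C f w = 'i%C * partial 1 f w) ->
  ccont (partial 1 f) z -> cder f z (partial 1 f z).
Proof.
move=> H1 Hi CR C e e0.
have e40 : 0 < e / 4 by rewrite divr_gt0.
have [d d0 D] := C _ e40.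
exists (d / 2); first by rewrite divr_gt0.
case=> a b hd; set h := a +i* b in hd *.
have ah : `|a| <= normc h by exact: (normc_Re h).
have bh : `|b| <= normc h by exact: (normc_Im h).
have [c1 [c2 [k1 k2 E1]]] := MVT_partial H1 z a.
have [c3 [c4 [k3 k4 E2]]] := MVT_partial Hi (z + a%:C * 1) b.
have zh : z + h = z + a%:C * 1 + b%:C * 'i%C.
  by apply: complexP; rewrite !reim /=; ring.
rewrite zh (_ : f _ - f z = (f (z + a%:C * 1 + b%:C * 'i%C) - f (z + a%:C * 1)) +
  (f (z + a%:C * 1) - f z)); last by ring.
rewrite E2 E1 !CR.
set L := partial 1 f z.
have B c : `|c| <= `|a| -> normc (partial 1 f (z + c%:C * 1) - L) <= e / 4.
  move=> ca; apply/ltW/D; rewrite mulr1 normcR; apply: le_lt_trans ca _.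
  by apply: le_lt_trans ah _; apply: lt_le_trans hd _; lra.
have B' c : `|c| <= `|b| -> normc (partial 1 f (z + a%:C * 1 + c%:C * 'i%C) - L) <= e / 4.
  move=> cb; apply/ltW; rewrite -addrA; apply: D.
  rewrite (le_lt_trans (normcD _ _)) // !normcM normc1 normc_i !mulr1 !normcR.
  lra.
have {B} [B1 B2] := (B _ k1, B _ k2); have {B'} [B3 B4] := (B' _ k3, B' _ k4).
set P1 := partial 1 f (z + c1%:C * 1) in B1 *; set P2 := partial 1 f (z + c2%:C * 1) in B2 *.
set P3 := partial 1 f (z + a%:C * 1 + c3%:C * 'i%C) in B3 *.
set P4 := partial 1 f (z + a%:C * 1 + c4%:C * 'i%C) in B4 *.
rewrite CR_ring; clearbody L P1 P2 P3 P4.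
rewrite (le_trans (normcD _ _)) // !normcM !normcR.
have X1 : normc (complex.Re (P1 - L) +i* complex.Im (P2 - L)) <= e / 2.
  rewrite (le_trans (normc_mk _ _)) // (le_trans (lerD (normc_Re _) (normc_Im _))) //.
  by clear -B1 B2; lra.
have X2 : normc (complex.Re ('i%C * (P3 - L)) +i* complex.Im ('i%C * (P4 - L))) <= e / 2.
  rewrite (le_trans (normc_mk _ _)) // (le_trans (lerD (normc_Re _) (normc_Im _))) //.
  by rewrite !normcM normc_i !mul1r; clear -B3 B4; lra.
apply: (@le_trans _ _ (normc h * (e / 2) + normc h * (e / 2))); last by clear; lra.
by rewrite lerD // ler_pM ?normc_ge0.
Qed.

Lemma partial_cder f z l v : cder f z l -> has_partial v f z /\ partial v f z = v * l.
Proof.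
move=> H.
have K (F : R[i] -> R) : (forall z w, F (z + w) = F z + F w) ->
   (forall z, F (- z) = - F z) ->
   (forall z, `|F z| <= normc z) -> (forall (r : R) z, F (r%:C * z) = r * F z) ->
   is_derive (0 : R) 1 (fun t : R => F (f (z + t%:C * v))) (F (v * l)).
  move=> FD FN Fn FZ.
  suff C : (fun h : R => h^-1 *: (((fun t : R => F (f (z + t%:C * v))) \o shift 0) (h *: 1) -
      F (f (z + 0%:C * v)))) @ 0^' --> F (v * l).
    apply: DeriveDef; first by apply/cvg_ex; eexists; exact: C.
    exact: cvg_lim.
  apply/cvgrPdist_le => e e0.
  have nv : 0 < normc v + 1 by rewrite ltr_wpDl ?normc_ge0.
  have e1 : 0 < e / (normc v + 1) by rewrite divr_gt0.
  have [d d0 D] := H _ e1.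
  apply/nbhs_ballP; exists (d / (normc v + 1)) => /=; first by rewrite divr_gt0.
  move=> h; rewrite /ball /= sub0r normrN => hd h0.
  rewrite mul0r addr0 /shift /= addr0 [h *: 1]mulr1 /GRing.scale /=.
  have hv : normc (h%:C * v) < d.
    rewrite normcM normcR; have := normc_ge0 v => v0.
    apply: (@le_lt_trans _ _ (`|h| * (normc v + 1))); last by rewrite -ltr_pdivlMr.
    by rewrite ler_wpM2l // lerDl.
  have := D _ hv => {}D.
  rewrite -FN -FD.
  have -> : F (v * l) - h^-1 * F (f (z + h%:C * v) + - f z) =
     - (h^-1 * F (f (z + h%:C * v) - f z - l * (h%:C * v))).
    rewrite [in RHS]FD FN (_ : l * (h%:C * v) = h%:C * (v * l)); last by ring.
    by rewrite FZ; field.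
  rewrite normrN normrM normfV ler_pdivrMl ?normr_gt0 //.
  apply: le_trans (Fn _) _; apply: le_trans D _.
  rewrite normcM normcR mulrCA ler_wpM2l // mulrAC ler_pdivrMr //.
  by rewrite ler_wpM2l ?lerDl // ltW.
have K1 := K (@complex.Re R) (@cReD R) (@cReN R) (@normc_Re R).
have {K1} K1 : is_derive (0 : R) 1 (fun t : R => complex.Re (f (z + t%:C * v))) (complex.Re (v * l)).
  by apply: K1 => r w; rewrite !reim /=; ring.
have {K} K2 := K (@complex.Im R) (@cImD R) (@cImN R) (@normc_Im R).
have {K2} K2 : is_derive (0 : R) 1 (fun t : R => complex.Im (f (z + t%:C * v))) (complex.Im (v * l)).
  by apply: K2 => r w; rewrite !reim /=; ring.
split; first by split; [case: K1|case: K2].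
by rewrite /partial !derive1E; apply: complexP => /=; [case: K1|case: K2].
Qed.

Lemma entire_cder f : entire f -> forall z, cder f z ('D_1 f z).
Proof. by move=> H z; exact: derivable_cder. Qed.

End Bridges.

Section ExpDerivative.
Context {R : realType}.
Implicit Types (z w : R[i]).

Lemma ccontM (f g : R[i] -> R[i]) z : ccont f z -> ccont g z -> ccont (fun x => f x * g x) z.
Proof. move=> Hf Hg e e0.
have nf : 0 < normc (f z) + 1 by rewrite ltr_wpDl ?normc_ge0.
have ng : 0 < normc (g z) + 1 by rewrite ltr_wpDl ?normc_ge0.
pose e1 := Num.min 1 (e / 2 / (normc (g z) + 1)).
have e10 : 0 < e1 by rewrite lt_min ltr01 !divr_gt0.
have e2 : 0 < e / 2 / (normc (f z) + 1) by rewrite !divr_gt0.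
have [d1 d10 H1] := Hg _ e2; have [d2 d20 H2] := Hf _ e10.
exists (Num.min d1 d2); first by rewrite lt_min d10.
move=> h; rewrite lt_min => /andP[/H1 h1 /H2]; rewrite lt_min => /andP[h2 h3].
set A := f (z + h) - f z in h2 h3; set B := g (z + h) - g z in h1.
rewrite (_ : _ - _ = A * g z + (f z + A) * B); last by rewrite /A /B; ring.
rewrite (le_lt_trans (normcD _ _)) // !normcM.
have K1 : normc A * normc (g z) <= e / 2.
  move: h3; rewrite ltr_pdivlMr // => /ltW; apply: le_trans.
  by rewrite ler_wpM2l ?normc_ge0 // lerDl.
have K2 : normc (f z + A) * normc B < e / 2.
  move: h1; rewrite ltr_pdivlMr //; apply: le_lt_trans.
  rewrite mulrC ler_wpM2l ?normc_ge0 // (le_trans (normcD _ _)) // lerD2l.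
  exact: ltW.
lra. Qed.

Lemma ccontD (f g : R[i] -> R[i]) z : ccont f z -> ccont g z -> ccont (fun x => f x + g x) z.
Proof. move=> Hf Hg e e0; have e20 : 0 < e / 2 by rewrite divr_gt0.
have [d1 d10 H1] := Hf _ e20; have [d2 d20 H2] := Hg _ e20.
exists (Num.min d1 d2); first by rewrite lt_min d10.
move=> h; rewrite lt_min => /andP[/H1 h1 /H2 h2].
rewrite (_ : _ - _ = (f (z + h) - f z) + (g (z + h) - g z)); last by ring.
by rewrite (le_lt_trans (normcD _ _)) // [e]splitr ltrD. Qed.

Lemma is_derive_affine_comp (p : R -> R) (a : R) d : is_derive a 1 p d ->
  is_derive (0 : R) 1 (fun t => p (a + t)) d.
Proof.
move=> [H <-].
have E : (fun h : R => h^-1 *: (((fun s => p (a + s)) \o shift 0) (h *: 1) - p (a + 0))) =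
  (fun h : R => h^-1 *: ((p \o shift a) (h *: 1) - p a)).
  by apply/funext => h; rewrite /shift /= !addr0 [h%:A + a]addrC.
by apply: DeriveDef; rewrite /derivable /derive E.
Qed.

Lemma partial1_cexp w : has_partial 1 cexp w /\ partial 1 cexp w = cexp w.
Proof.
have [E1 E2] : (fun t : R => complex.Re (cexp (w + t%:C * 1))) =
    (fun t => expR (complex.Re w + t) * cos (complex.Im w)) /\
   (fun t : R => complex.Im (cexp (w + t%:C * 1))) =
    (fun t => expR (complex.Re w + t) * sin (complex.Im w)).
  by split; apply/funext => t; rewrite /cexp /= !reim /= !(mulr1, mulr0, addr0, subr0, mul0r).
have X := @is_derive_affine_comp (@expR R) (complex.Re w) _ (is_derive_expR _).
have K c : is_derive (0 : R) 1 (fun t => expR (complex.Re w + t) * c) (expR (complex.Re w) * c).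
  have Y : is_derive (0 : R) (1 : R) (cst c : R -> R) 0 := is_derive_cst _ _ _.
  have := is_deriveM X Y.
  by rewrite scaler0 add0r [in X in _ -> X](mulrC _ c).
have [Kc Ks] := (K (cos (complex.Im w)), K (sin (complex.Im w))).
rewrite /has_partial /partial E1 E2 !derive1E; split.
  by split; [case: Kc|case: Ks].
by apply: complexP => /=; [case: Kc|case: Ks].
Qed.

Lemma partiali_cexp w : has_partial 'i%C cexp w /\ partial 'i%C cexp w = 'i%C * cexp w.
Proof.
have [E1 E2] : (fun t : R => complex.Re (cexp (w + t%:C * 'i%C))) =
    (fun t => expR (complex.Re w) * cos (complex.Im w + t)) /\
   (fun t : R => complex.Im (cexp (w + t%:C * 'i%C))) =
    (fun t => expR (complex.Re w) * sin (complex.Im w + t)).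
  by split; apply/funext => t; rewrite /cexp /= !reim /= !(mulr1, mulr0, addr0, subr0, mul0r).
have K p d : is_derive (complex.Im w) 1 p d ->
   is_derive (0 : R) 1 (fun t => expR (complex.Re w) * p (complex.Im w + t)) (expR (complex.Re w) * d).
  have Y : is_derive (0 : R) (1 : R) (cst (expR (complex.Re w)) : R -> R) 0 := is_derive_cst _ _ _.
  move=> X; have := is_deriveM Y (is_derive_affine_comp X).
  by rewrite scaler0 addr0 /GRing.scale /=.
have [Kc Ks] := (K _ _ (is_derive_cos _), K _ _ (is_derive_sin _)).
rewrite /has_partial /partial E1 E2 !derive1E; split.
  by split; [case: Kc|case: Ks].
case: Kc => _ ->; case: Ks => _ ->.
by apply: complexP; rewrite !reim /cexp /=; ring.
Qed.

Lemma ccont_cexp z : ccont cexp z.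
Proof.
(* real functions of one variable are continuous; transport along Re and Im *)
have C (p : R -> R) (q : R[i] -> R) : continuous p -> (forall z w, q (z + w) = q z + q w) ->
    (forall z, `|q z| <= normc z) -> forall z, ccont (fun x => (p (q x))%:C) z.
  move=> Cp qD qn w e e0.
  have /cvgrPdist_lt /(_ _ e0) /nbhs_ballP[d d0 D] := Cp (q w).
  exists d; first by [].
  move=> h hd; rewrite (_ : _ - _ = (p (q (w + h)) - p (q w))%:C); last first.
    by apply: complexP => //=; rewrite subrr.
  rewrite normcR distrC; apply: D.
  by rewrite /ball /= qD opprD addrA subrr sub0r normrN (le_lt_trans (qn _)).
have -> : @cexp R = fun z => (expR (complex.Re z))%:C *
    ((cos (complex.Im z))%:C + 'i%C * (sin (complex.Im z))%:C).
  by apply/funext => x; apply: complexP; rewrite !reim /cexp /= ?reim /=; ring.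
apply: ccontM.
  exact: (C _ _ (@continuous_expR R) (@cReD R) (@normc_Re R)).
apply: ccontD; first exact: (C _ _ (@continuous_cos R) (@cImD R) (@normc_Im R)).
apply: ccontM; first exact: cder_ccont (cder_cst _ _).
exact: (C _ _ (@continuous_sin R) (@cImD R) (@normc_Im R)).
Qed.

(** By [CR_cder], from the partial derivatives along both axes. *)
Lemma cder_cexp z : cder cexp z (cexp z).
Proof.
rewrite -[X in cder _ _ X](partial1_cexp z).2; apply: CR_cder.
- by move=> w; case: (partial1_cexp w).
- by move=> w; case: (partiali_cexp w).
- by move=> w; rewrite (partial1_cexp w).2 (partiali_cexp w).2.
- by rewrite (_ : partial 1 cexp = cexp) ?(funext (fun w => (partial1_cexp w).2)) //; exact: ccont_cexp.
Qed.

End ExpDerivative.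

(** * Complex-valued integration *)

Section ComplexMeasurability.
Context {R : realType} {d : measure_display} {T : measurableType d}.
Implicit Types (f g : T -> R[i]) (D : set T).

Lemma measurable_cplx_of : measurable_fun setT (@cplx_of R).
Proof. by move=> _ A mA; rewrite setTI. Qed.

Lemma measurable_from_plane d' (T' : measurableType d') (F : R[i] -> T') :
  measurable_fun setT (F \o @cplx_of R) -> measurable_fun setT F.
Proof. by move=> mF _ A mA; rewrite setTI; have := mF measurableT _ mA; rewrite setTI. Qed.

Lemma measurable_Re : measurable_fun setT (@complex.Re R).
Proof. exact: measurable_from_plane measurable_fst. Qed.

Lemma measurable_Im : measurable_fun setT (@complex.Im R).
Proof. exact: measurable_from_plane measurable_snd. Qed.

Lemma measurable_ReP f : measurable_fun setT f <->
  measurable_fun setT (fun x => complex.Re (f x)) /\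
  measurable_fun setT (fun x => complex.Im (f x)).
Proof.
split=> [mf|[mr mi]].
  by split; [exact: measurableT_comp measurable_Re mf|exact: measurableT_comp measurable_Im mf].
have -> : f = @cplx_of R \o (fun x => (complex.Re (f x), complex.Im (f x))).
  by apply/funext => x /=; rewrite /cplx_of /=; case: (f x).
apply: measurableT_comp measurable_cplx_of _.
exact: measurable_fun_pair.
Qed.

Lemma measC_cst (c : R[i]) : measurable_fun setT ((fun=> c) : T -> R[i]).
Proof. exact: measurable_cst. Qed.

Lemma measC_D f g : measurable_fun setT f -> measurable_fun setT g ->
  measurable_fun setT (fun x => f x + g x).
Proof.
move=> /measurable_ReP[f1 f2] /measurable_ReP[g1 g2]; apply/measurable_ReP.
split; [under eq_fun do rewrite cReD|under eq_fun do rewrite cImD];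
  exact: measurable_funD.
Qed.

Lemma measC_N f : measurable_fun setT f -> measurable_fun setT (fun x => - f x).
Proof.
move=> /measurable_ReP[f1 f2]; apply/measurable_ReP.
split; [under eq_fun do rewrite cReN|under eq_fun do rewrite cImN];
  exact: measurable_funN.
Qed.

Lemma measC_B f g : measurable_fun setT f -> measurable_fun setT g ->
  measurable_fun setT (fun x => f x - g x).
Proof. by move=> mf mg; apply: measC_D => //; exact: measC_N. Qed.

Lemma measC_J f : measurable_fun setT f -> measurable_fun setT (fun x => (f x)^*).
Proof.
move=> /measurable_ReP[f1 f2]; apply/measurable_ReP.
by split; [under eq_fun do rewrite cReJ|under eq_fun do rewrite cImJ; exact: measurable_funN].
Qed.

Lemma measC_M f g : measurable_fun setT f -> measurable_fun setT g ->
  measurable_fun setT (fun x => f x * g x).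
Proof.
move=> /measurable_ReP[f1 f2] /measurable_ReP[g1 g2]; apply/measurable_ReP.
split; [under eq_fun do rewrite cReM; apply: measurable_funB|
  under eq_fun do rewrite cImM; apply: measurable_funD];
  exact: measurable_funM.
Qed.

Lemma measC_X f n : measurable_fun setT f -> measurable_fun setT (fun x => f x ^+ n).
Proof.
move=> mf; elim: n => [|n IH]; first by under eq_fun do rewrite expr0; exact: measC_cst.
by under eq_fun do rewrite exprS; exact: measC_M.
Qed.

Lemma measC_real (r : T -> R) : measurable_fun setT r ->
  measurable_fun setT (fun x => (r x)%:C).
Proof. by move=> mr; apply/measurable_ReP; split => //=; exact: measurable_cst. Qed.

Lemma meas_normc f : measurable_fun setT f -> measurable_fun setT (fun x => normc (f x)).
Proof.
move=> /measurable_ReP[f1 f2].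
have -> : (fun x => normc (f x)) =
    (fun x => Num.sqrt (complex.Re (f x) ^+ 2 + complex.Im (f x) ^+ 2)).
  by apply/funext => x; case: (f x).
apply: (@measurableT_comp _ _ _ _ _ _ (@Num.sqrt R)).
  by apply: continuous_measurable_fun; exact: sqrt_continuous.
by apply: measurable_funD; exact: measurable_funX.
Qed.

Lemma measC_cexp f : measurable_fun setT f -> measurable_fun setT (fun x => cexp (f x)).
Proof.
move=> /measurable_ReP[f1 f2]; apply/measurable_ReP; split; rewrite /cexp /=;
  apply: measurable_funM; apply: measurableT_comp => //;
  apply: continuous_measurable_fun; [exact: continuous_cos|exact: continuous_sin].
Qed.

End ComplexMeasurability.

Section ComplexIntegral.
Context {R : realType} {d : measure_display} {T : measurableType d}.
Variable (m : {measure set T -> \bar R}).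
Implicit Types (f g : T -> R[i]) (D : set T) (c : R[i]).

(** Integration of complex functions, componentwise as in [cintegral]. *)
Definition cint D f : R[i] :=
  (\int[m]_(x in D) complex.Re (f x))%R +i* (\int[m]_(x in D) complex.Im (f x))%R.

Definition cintegrable D f :=
  m.-integrable D (fun x => (complex.Re (f x))%:E) /\
  m.-integrable D (fun x => (complex.Im (f x))%:E).

Lemma eq_cint D f g : (forall x, D x -> f x = g x) -> cint D f = cint D g.
Proof.
by move=> fg; congr (_ +i* _); apply: eq_Rintegral => x /[!inE] /fg ->.
Qed.

Lemma le_integrableE D (r s : T -> R) : measurable D -> measurable_fun setT r ->
  (forall x, D x -> `|r x| <= s x) -> m.-integrable D (EFin \o s) ->
  m.-integrable D (EFin \o r).
Proof.
move=> mD mr rs is_; apply: (le_integrable mD _ _ is_).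
  by apply/measurable_EFinP; exact: measurable_funTS.
move=> x Dx; rewrite lee_fin /=.
by rewrite (le_trans (rs x Dx)) // ler_norm.
Qed.

Lemma cintegrable_le D f (r : T -> R) : measurable D -> measurable_fun setT f ->
  (forall x, D x -> normc (f x) <= r x) -> m.-integrable D (EFin \o r) ->
  cintegrable D f.
Proof.
move=> mD /measurable_ReP[f1 f2] fr ir.
by split; apply: (le_integrableE mD _ _ ir) => // x Dx;
  rewrite (le_trans _ (fr x Dx)) ?normc_Re ?normc_Im.
Qed.

Lemma cintegrable_normc D f : measurable D -> measurable_fun setT f ->
  cintegrable D f -> m.-integrable D (fun x => (normc (f x))%:E).
Proof.
move=> mD mf [i1 i2].
apply: (@le_integrableE D (fun x => normc (f x))
  (fun x => `|complex.Re (f x)| + `|complex.Im (f x)|)) => //.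
- exact: meas_normc.
- by move=> x _; rewrite ger0_norm ?normc_ge0 // normc_le_ReIm.
- have j1 := integrable_abse i1; have j2 := integrable_abse i2.
  exact: (integrableD mD j1 j2).
Qed.

Lemma eq_cintegrable D f g : measurable D -> (forall x, D x -> f x = g x) ->
  cintegrable D f -> cintegrable D g.
Proof.
by move=> mD fg [i1 i2]; split; [apply: eq_integrable i1|apply: eq_integrable i2] => //;
  move=> x /[!inE] /fg ->.
Qed.

Section Linear.
Context {D : set T} (mD : measurable D).

Lemma cintegrableD f g : cintegrable D f -> cintegrable D g ->
  cintegrable D (fun x => f x + g x).
Proof.
move=> [f1 f2] [g1 g2]; split.
  by under [X in integrable _ _ X]eq_fun do rewrite cReD EFinD; exact: integrableD.
by under [X in integrable _ _ X]eq_fun do rewrite cImD EFinD; exact: integrableD.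
Qed.

Lemma cintegrableN f : cintegrable D f -> cintegrable D (fun x => - f x).
Proof.
move=> [f1 f2]; split.
  by under [X in integrable _ _ X]eq_fun do rewrite cReN EFinN; exact: integrableN.
by under [X in integrable _ _ X]eq_fun do rewrite cImN EFinN; exact: integrableN.
Qed.

Lemma cintegrableB f g : cintegrable D f -> cintegrable D g ->
  cintegrable D (fun x => f x - g x).
Proof. by move=> hf hg; apply: cintegrableD => //; exact: cintegrableN. Qed.

Lemma cintegrableZ c f : cintegrable D f -> cintegrable D (fun x => c * f x).
Proof.
move=> [f1 f2]; split.
  under [X in integrable _ _ X]eq_fun do rewrite cReM EFinB !EFinM.
  by apply: integrableB => //; exact: integrableZl.
under [X in integrable _ _ X]eq_fun do rewrite cImM EFinD !EFinM.
by apply: integrableD => //; exact: integrableZl.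
Qed.

Lemma cintD f g : cintegrable D f -> cintegrable D g ->
  cint D (fun x => f x + g x) = cint D f + cint D g.
Proof.
move=> [f1 f2] [g1 g2]; rewrite /cint.
under eq_Rintegral do rewrite cReD.
under [X in _ +i* X]eq_Rintegral do rewrite cImD.
by rewrite !RintegralD.
Qed.

Lemma cintZ c f : cintegrable D f -> cint D (fun x => c * f x) = c * cint D f.
Proof.
move=> [f1 f2]; rewrite /cint.
under eq_Rintegral do rewrite cReM.
under [X in _ +i* X]eq_Rintegral do rewrite cImM.
have i1 r := integrableZl mD r f1; have i2 r := integrableZl mD r f2.
have j1 r : m.-integrable D (EFin \o (fun x => r * complex.Re (f x))) := i1 r.
have j2 r : m.-integrable D (EFin \o (fun x => r * complex.Im (f x))) := i2 r.
rewrite RintegralB ?RintegralD ?RintegralZl //.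
by apply: complexP; rewrite !reim.
Qed.

Lemma cintN f : cintegrable D f -> cint D (fun x => - f x) = - cint D f.
Proof.
move=> i; rewrite -mulN1r -cintZ //; apply: eq_cint => x _.
by rewrite mulN1r.
Qed.

Lemma cintB f g : cintegrable D f -> cintegrable D g ->
  cint D (fun x => f x - g x) = cint D f - cint D g.
Proof. by move=> hf hg; rewrite cintD ?cintN //; exact: cintegrableN. Qed.

Lemma cintJ f : cintegrable D f -> cint D (fun x => (f x)^*) = (cint D f)^*.
Proof.
move=> [f1 f2]; apply: complexP; rewrite !reim /cint /=.
  by apply: eq_Rintegral => x _; rewrite cReJ.
under eq_Rintegral do rewrite cImJ -mulN1r.
by rewrite RintegralZl // mulN1r.
Qed.

Lemma cint0 : cint D (fun=> 0) = 0.
Proof.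
by apply: complexP; rewrite /= Rintegral_cst // mul0r.
Qed.

Lemma cint_sum (I : Type) (s : seq I) (F : I -> T -> R[i]) :
  (forall i, cintegrable D (F i)) ->
  cintegrable D (fun x => \sum_(i <- s) F i x) /\
  cint D (fun x => \sum_(i <- s) F i x) = \sum_(i <- s) cint D (F i).
Proof.
move=> iF; elim: s => [|i s [IH1 IH2]].
  rewrite big_nil; split; last by under eq_cint do rewrite big_nil; exact: cint0.
  by apply: (@eq_cintegrable D (fun=> 0)) => // [x _|]; [rewrite big_nil|split; exact: integrable0].
split.
  apply: (@eq_cintegrable D (fun x => F i x + \sum_(i <- s) F i x)) => // [x _|].
    by rewrite big_cons.
  exact: cintegrableD.
by under eq_cint do rewrite big_cons; rewrite cintD // IH2 big_cons.
Qed.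

Lemma cint_real (r : T -> R) : cint D (fun x => (r x)%:C) = (\int[m]_(x in D) r x)%R%:C.
Proof.
apply: complexP => //=.
by rewrite Rintegral_cst // mul0r.
Qed.

Lemma normc_cint f : measurable_fun setT f -> cintegrable D f ->
  normc (cint D f) <= (\int[m]_(x in D) normc (f x))%R.
Proof.
move=> mf i; have [->|I0] := eqVneq (cint D f) 0.
  by rewrite normc0; apply: Rintegral_ge0 => x _; exact: normc_ge0.
have n0 : 0 < normc (cint D f) by rewrite normc_gt0.
(* rotate the integral onto the positive axis *)
pose c : R[i] := (normc (cint D f))^-1%:C * (cint D f)^*.
have nc : normc c = 1.
  by rewrite normcM normcR normcJ ger0_norm ?invr_ge0 ?normc_ge0 // mulVf ?gt_eqF.
have E : c * cint D f = (normc (cint D f))%:C.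
  rewrite /c -mulrA [_^* * _]mulrC normcJM -rmorphM /= expr2 mulKf //.
  by rewrite gt_eqF.
have {}E : normc (cint D f) = complex.Re (cint D (fun x => c * f x)) by rewrite cintZ // E.
rewrite {}E /=; apply: le_Rintegral => //.
- exact: (cintegrableZ c i).1.
- exact: cintegrable_normc.
- move=> x _; rewrite (le_trans (ler_norm _)) // (le_trans (normc_Re _)) //.
  by rewrite normcM nc mul1r.
Qed.

Lemma normc_cint_le f (r : T -> R) : measurable_fun setT f ->
  (forall x, D x -> normc (f x) <= r x) -> m.-integrable D (EFin \o r) ->
  normc (cint D f) <= (\int[m]_(x in D) r x)%R.
Proof.
move=> mf fr ir; have i := cintegrable_le mD mf fr ir.
rewrite (le_trans (normc_cint mf i)) //; apply: le_Rintegral => //.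
exact: cintegrable_normc.
Qed.

End Linear.

End ComplexIntegral.

Section ComplexFubini.
Context {R : realType} {d1 d2 : measure_display}.
Context {T1 : measurableType d1} {T2 : measurableType d2}.
Variables (m1 : {sigma_finite_measure set T1 -> \bar R}).
Variables (m2 : {sigma_finite_measure set T2 -> \bar R}).

Lemma Rintegral_Fubini (F : T1 * T2 -> R) :
  (m1 \x m2)%E.-integrable setT (EFin \o F) ->
  (forall x, m2.-integrable setT (fun y => (F (x, y))%:E)) ->
  (forall y, m1.-integrable setT (fun x => (F (x, y))%:E)) ->
  (\int[m1]_x (\int[m2]_y F (x, y)))%R = (\int[m2]_y (\int[m1]_x F (x, y)))%R.
Proof.
move=> i i1 i2; rewrite /Rintegral; congr fine.
transitivity (\int[m1]_x \int[m2]_y (F (x, y))%:E)%E.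
  by apply: eq_integral => x _; rewrite fineK // integrable_fin_num.
rewrite (Fubini i); apply: eq_integral => y _.
by rewrite fineK // integrable_fin_num.
Qed.

Lemma cint_Fubini (F : T1 * T2 -> R[i]) : measurable_fun setT F ->
  (\int[m1]_x \int[m2]_y (normc (F (x, y)))%:E < +oo)%E ->
  (forall x, cintegrable m2 setT (fun y => F (x, y))) ->
  (forall y, cintegrable m1 setT (fun x => F (x, y))) ->
  cint m1 setT (fun x => cint m2 setT (fun y => F (x, y))) =
  cint m2 setT (fun y => cint m1 setT (fun x => F (x, y))).
Proof.
move=> mF fin i1 i2.
have /measurable_ReP[mr mi] := mF.
have iN : (m1 \x m2)%E.-integrable setT (fun z => (normc (F z))%:E).
  apply/integrable12ltyP; first by apply/measurable_EFinP; exact: meas_normc.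
  rewrite (eq_integral (fun x => \int[m2]_y (normc (F (x, y)))%:E)%E) // => x _.
  by apply: eq_integral => y _; rewrite abse_EFin ger0_norm // normc_ge0.
have [j1 j2] := cintegrable_le measurableT mF (fun x _ => lexx _) iN.
apply: complexP.
  by apply: (@Rintegral_Fubini (fun z => complex.Re (F z))) => // x; [case: (i1 x)|case: (i2 x)].
by apply: (@Rintegral_Fubini (fun z => complex.Im (F z))) => // x; [case: (i1 x)|case: (i2 x)].
Qed.

End ComplexFubini.

(** * Plane area *)

Section AreaMeasure.
Context {R : realType}.
Local Notation lam := (@lebesgue_measure R).
Implicit Types (f : R[i] -> \bar R) (p q : R[i] -> R[i]).

Lemma measurable_plane f : measurable_fun setT f ->
  measurable_fun setT (fun p : measurableTypeR R * measurableTypeR R => f (cplx_of p)).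
Proof. by move=> mf; exact: measurableT_comp mf measurable_cplx_of. Qed.

Lemma ge0_area_plane f : measurable_fun setT f -> (forall z, (0 <= f z)%E) ->
  (\int[area]_z f z = \int[lam \x lam]_p f (cplx_of p))%E.
Proof.
move=> mf f0.
by rewrite -[RHS](@ge0_integral_pushforward _ _ _ _ _ _ measurable_cplx_of _ setT f).
Qed.

Lemma ge0_area f : measurable_fun setT f -> (forall z, (0 <= f z)%E) ->
  (\int[area]_z f z = \int[lam]_x \int[lam]_y f (x +i* y))%E.
Proof. by move=> mf f0; rewrite ge0_area_plane // fubini_tonelli1 //; exact: measurable_plane. Qed.

Lemma ge0_area' f : measurable_fun setT f -> (forall z, (0 <= f z)%E) ->
  (\int[area]_z f z = \int[lam]_y \int[lam]_x f (x +i* y))%E.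
Proof. by move=> mf f0; rewrite ge0_area_plane // fubini_tonelli2 //; exact: measurable_plane. Qed.

Lemma area_sigma_finite : sigma_finite setT (@area R).
Proof.
pose S n : set (measurableTypeR R) := `](- n%:R : R), n%:R]%classic.
exists (fun n => [set z | S n (complex.Re z) /\ S n (complex.Im z)]).
  apply/seteqP; split=> // z _.
  have cover (x : R) : exists n, forall m, (n <= m)%N -> S m x.
    exists (Num.truncn `|x|).+1 => m nm; rewrite /S /= in_itv /=.
    have : `|x| < m%:R by rewrite (lt_le_trans (truncnS_gt _)) // ler_nat.
    by rewrite ltr_norml => /andP[-> /ltW ->].
  have [n1 h1] := cover (complex.Re z); have [n2 h2] := cover (complex.Im z).
  by exists (maxn n1 n2) => //; split; [apply: h1|apply: h2]; rewrite ?leq_maxl ?leq_maxr.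
move=> n.
have E : @cplx_of R @^-1` [set z | S n (complex.Re z) /\ S n (complex.Im z)] = S n `*` S n.
  by apply/seteqP; split => -[x y].
have mS : measurable (S n) by exact: measurable_itv.
split; first by rewrite /measurable /= /cmeasurable /= E; exact: measurableX.
have lS : lebesgue_measure (S n) \is a fin_num.
  by rewrite /S lebesgue_measure_itv; case: ifP.
by rewrite /area E product_measure1E // ltey_eq fin_numM.
Qed.

HB.instance Definition _ := @Measure_isSigmaFinite.Build _ _ _ (@area R) area_sigma_finite.

(** By uniqueness of the Lebesgue measure, compared on half-open intervals. *)
Lemma ge0_lebesgue_shift (a : R) (g : R -> \bar R) : measurable_fun setT g ->
  (forall x, (0 <= g x)%E) ->
  (\int[lam]_x g ((x : R) + a)%R = \int[lam]_x g x)%E.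
Proof.
move=> mg g0.
have ms : measurable_fun setT (fun x : measurableTypeR R => (x : R) + a : measurableTypeR R).
  exact: measurable_funD.
rewrite -[LHS](@ge0_integral_pushforward _ _ _ _ _ _ ms lam setT g) //.
apply: eq_measure_integral => A mA _; apply/esym/lebesgue_measure_unique => //= _ [[u v]] _ <-.
rewrite /pushforward /=.
have -> : (fun x : R => x + a) @^-1` `]u, v] = `]u - a, v - a]%classic.
  by apply/seteqP; split => x /=; rewrite !in_itv /= ltrBlDr lerBrDr.
rewrite !lebesgue_measure_itv /= !lte_fin ltrD2r.
by case: ifP => // _; rewrite -!EFinD; congr EFin; ring.
Qed.

(** Nonnegative functions suffice: complex integrals follow in [area_preserving_cint]. *)
Definition area_preserving p := measurable_fun setT p /\
  forall f, measurable_fun setT f -> (forall z, (0 <= f z)%E) ->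
    (\int[area]_z f (p z) = \int[area]_z f z)%E.

Lemma area_preserving_comp p q : area_preserving p -> area_preserving q ->
  area_preserving (p \o q).
Proof.
move=> [mp Hp] [mq Hq]; split; first exact: measurableT_comp.
move=> f mf f0; rewrite -(Hp f mf f0) -(Hq (f \o p)) // => [|z].
  exact: measurableT_comp.
exact: f0.
Qed.

Lemma area_preserving_integral p f : area_preserving p -> measurable_fun setT f ->
  (\int[area]_z f (p z) = \int[area]_z f z)%E.
Proof.
move=> [mp H] mf; rewrite integralE [RHS]integralE; congr (_ - _)%E.
  apply: etrans (H _ (measurable_funepos mf) (funepos_ge0 f)).
  by apply: eq_integral => z _; rewrite !funeposE.
apply: etrans (H _ (measurable_funeneg mf) (funeneg_ge0 f)).
by apply: eq_integral => z _; rewrite !funenegE.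
Qed.

Lemma area_preserving_cint p (f : R[i] -> R[i]) : area_preserving p ->
  measurable_fun setT f ->
  cint area setT (fun z => f (p z)) = cint area setT f.
Proof.
move=> Hp /measurable_ReP[f1 f2]; congr (_ +i* _); rewrite /Rintegral; congr fine.
  by rewrite (@area_preserving_integral p (fun z => (complex.Re (f z))%:E)) //; exact/measurable_EFinP.
by rewrite (@area_preserving_integral p (fun z => (complex.Im (f z))%:E)) //; exact/measurable_EFinP.
Qed.

Lemma measurable_mk (f : R[i] -> \bar R) x : measurable_fun setT f ->
  measurable_fun setT (fun y : measurableTypeR R => f (x +i* y)).
Proof.
move=> mf; apply: measurableT_comp mf _; by apply/measurable_ReP; split => //=.
Qed.

Lemma measurable_mk' (f : R[i] -> \bar R) y : measurable_fun setT f ->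
  measurable_fun setT (fun x : measurableTypeR R => f (x +i* y)).
Proof.
move=> mf; apply: measurableT_comp mf _; by apply/measurable_ReP; split => //=.
Qed.

Definition shear1 (t : R) (z : R[i]) := (complex.Re z + t * complex.Im z) +i* complex.Im z.
Definition shear2 (t : R) (z : R[i]) := complex.Re z +i* (complex.Im z + t * complex.Re z).

Lemma area_preserving_shear1 t : area_preserving (shear1 t).
Proof.
have mp : measurable_fun setT (shear1 t).
  apply/measurable_ReP; split => /=; last exact: measurable_Im.
  apply: measurable_funD; first exact: measurable_Re.
  by apply: measurable_funM; [exact: measurable_cst|exact: measurable_Im].
split => // f mf f0; rewrite [LHS](ge0_area' (f := fun z => f (shear1 t z))) //; last first.
  exact: measurableT_comp.
rewrite [RHS](ge0_area' mf f0); apply: eq_integral => y _.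
exact: (ge0_lebesgue_shift (t * y) (measurable_mk' y mf)).
Qed.

Lemma area_preserving_shear2 t : area_preserving (shear2 t).
Proof.
have mp : measurable_fun setT (shear2 t).
  apply/measurable_ReP; split => /=; first exact: measurable_Re.
  apply: measurable_funD; first exact: measurable_Im.
  by apply: measurable_funM; [exact: measurable_cst|exact: measurable_Re].
split => // f mf f0; rewrite [LHS](ge0_area (f := fun z => f (shear2 t z))) //; last first.
  exact: measurableT_comp.
rewrite [RHS](ge0_area mf f0); apply: eq_integral => x _.
exact: (ge0_lebesgue_shift (t * x) (measurable_mk x mf)).
Qed.

Lemma area_preserving_shift (a : R[i]) : area_preserving (fun z => z + a).
Proof.
pose h1 (z : R[i]) := (complex.Re z + complex.Re a) +i* complex.Im z.
pose h2 (z : R[i]) := complex.Re z +i* (complex.Im z + complex.Im a).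
have -> : (fun z => z + a) = h1 \o h2 by apply/funext => z; case: z a @h1 @h2 => x y [].
apply: area_preserving_comp.
- have mp : measurable_fun setT h1.
    apply/measurable_ReP; split => /=; last exact: measurable_Im.
    by apply: measurable_funD => //; exact: measurable_Re.
  split => // f mf f0; rewrite [LHS](ge0_area' (f := fun z => f (h1 z))) //; last first.
    exact: measurableT_comp.
  rewrite [RHS](ge0_area' mf f0); apply: eq_integral => y _.
  exact: (ge0_lebesgue_shift (complex.Re a) (measurable_mk' y mf)).
- have mp : measurable_fun setT h2.
    apply/measurable_ReP; split => /=; first exact: measurable_Re.
    by apply: measurable_funD => //; exact: measurable_Im.
  split => // f mf f0; rewrite [LHS](ge0_area (f := fun z => f (h2 z))) //; last first.
    exact: measurableT_comp.
  rewrite [RHS](ge0_area mf f0); apply: eq_integral => x _.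
  exact: (ge0_lebesgue_shift (complex.Im a) (measurable_mk x mf)).
Qed.

(** A rotation is a product of three shears. *)
Lemma area_preserving_rot (u : R[i]) : normc u = 1 -> area_preserving (fun z => u * z).
Proof.
have main (c s : R) : c ^+ 2 + s ^+ 2 = 1 -> 1 + c != 0 ->
    area_preserving (fun z => (c +i* s) * z).
  move=> cs c1; pose t := - (s / (1 + c)).
  have -> : (fun z => (c +i* s) * z) = shear1 t \o (shear2 s \o shear1 t).
    apply/funext => z; rewrite /shear1 /shear2 /=.
    have ts : 1 + t * s = c.
      rewrite /t; apply: (mulIf c1); rewrite mulrDl mul1r -mulrA.
      rewrite (_ : - _ * _ = - (s ^+ 2)); last by field.
      by rewrite (_ : s ^+ 2 = 1 - c ^+ 2); [ring|rewrite -cs; ring].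
    have tc : t * (1 + c) = - s by rewrite /t; field.
    case: z => x y; apply: complexP => /=.
      rewrite (_ : x + t * y + _ = (1 + t * s) * x + (t * (1 + (1 + t * s))) * y); last by ring.
      by rewrite ts tc; ring.
    rewrite (_ : y + s * _ = (1 + t * s) * y + s * x); last by ring.
    by rewrite ts; ring.
  apply: area_preserving_comp (area_preserving_shear1 _) _.
  exact: area_preserving_comp (area_preserving_shear2 _) (area_preserving_shear1 _).
move=> nu; have := normc2 u; rewrite nu expr1n; case: u nu => c s nu /= /esym cs.
have [c1|] := eqVneq (1 + c) 0; last exact: main.
(* The product of shears does not represent the half-turn, which is the square of the
   quarter-turn. *)
have -> : (fun z => (c +i* s) * z) = (fun z => (0 +i* 1) * z) \o (fun z => (0 +i* 1) * z).
  have cE : c = -1 by lra.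
  have : s ^+ 2 = 0 by move: cs; rewrite cE; lra.
  move/eqP; rewrite sqrf_eq0 => /eqP ->; rewrite cE.
  by apply/funext => -[x y]; apply: complexP => /=; ring.
by apply: area_preserving_comp; apply: main; rewrite ?expr0n ?expr1n ?add0r ?addr0 ?oner_neq0.
Qed.

End AreaMeasure.

(** * The Gaussian measure *)

Section RealL2.
Context {R : realType} {d : measure_display} {T : measurableType d}.
Variable (m : {measure set T -> \bar R}).
Implicit Types (r s : T -> R).

Let pow2 r : (\int[m]_x (`|(EFin \o r) x| `^ 2)%E)%E = (\int[m]_x (r x ^+ 2)%:E)%E.
Proof.
apply: eq_integral => x _ /=.
by rewrite (powR_mulrn 2) ?normr_ge0 // -normrX ger0_norm // sqr_ge0.
Qed.

Let sq_int r : measurable_fun setT r ->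
  (\int[m]_x (r x ^+ 2)%:E < +oo)%E <-> m.-integrable setT (fun x => (r x ^+ 2)%:E).
Proof.
move=> mr; have mr2 : measurable_fun setT (fun x => (r x ^+ 2)%:E).
  by apply/measurable_EFinP; exact: measurable_funX.
split=> [h|/integrableP[_]].
  apply/integrableP; split => //; apply: le_lt_trans h.
  rewrite le_eqVlt; apply/orP; left; apply/eqP/eq_integral => x _.
  by rewrite gee0_abs // lee_fin sqr_ge0.
apply: le_lt_trans.
rewrite le_eqVlt; apply/orP; left; apply/eqP/eq_integral => x _.
by rewrite gee0_abs // lee_fin sqr_ge0.
Qed.

Lemma lnorm2P r : measurable_fun setT r ->
  ('N[m]_2%:E[EFin \o r] < +oo)%E <-> m.-integrable setT (fun x => (r x ^+ 2)%:E).
Proof.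
move=> mr; rewrite -sq_int // -pow2.
have := @poweR_Lnorm _ _ _ m (EFin \o r) 2 => <- //.
have := Lnorm_ge0 m 2%:E (EFin \o r).
case: ('N[m]_2%:E[EFin \o r])%E => [x|_|] //=; first by rewrite !ltry.
by rewrite pnatr_eq0.
Qed.

Lemma lnorm2E r : measurable_fun setT r -> m.-integrable setT (fun x => (r x ^+ 2)%:E) ->
  ('N[m]_2%:E[EFin \o r] = (Num.sqrt (\int[m]_x (r x ^+ 2))%R)%:E)%E.
Proof.
move=> mr ir; have /(lnorm2P mr) := ir.
have := @poweR_Lnorm _ _ _ m (EFin \o r) 2; rewrite pow2 pnatr_eq0 => /(_ isT).
have := Lnorm_ge0 m 2%:E (EFin \o r).
case: ('N[m]_2%:E[EFin \o r])%E => [x| |] //; rewrite lee_fin => x0 E _.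
by rewrite /Rintegral -E /= (powR_mulrn 2) // sqrtr_sqr ger0_norm.
Qed.

Lemma integrable_sqM r s : measurable_fun setT r -> measurable_fun setT s ->
  m.-integrable setT (fun x => (r x ^+ 2)%:E) -> m.-integrable setT (fun x => (s x ^+ 2)%:E) ->
  m.-integrable setT (fun x => (r x * s x)%:E).
Proof.
move=> mr ms ir is_.
apply: (@le_integrableE _ _ _ m setT (fun x => r x * s x) (fun x => r x ^+ 2 + s x ^+ 2)) => //.
- exact: measurable_funM.
- move=> x _; rewrite normrM.
  rewrite -(real_normK (num_real (r x))) -(real_normK (num_real (s x))).
  by have := sqr_ge0 (`|r x| - `|s x|); have := normr_ge0 (r x); have := normr_ge0 (s x); nra.
- exact: (integrableD _ ir is_).
Qed.

Lemma Rintegral_CS r s : measurable_fun setT r -> measurable_fun setT s ->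
  m.-integrable setT (fun x => (r x ^+ 2)%:E) -> m.-integrable setT (fun x => (s x ^+ 2)%:E) ->
  \int[m]_x `|r x * s x| <=
  Num.sqrt (\int[m]_x (r x ^+ 2)) * Num.sqrt (\int[m]_x (s x ^+ 2)).
Proof.
move=> mr ms ir is_; rewrite -lee_fin EFinM -!lnorm2E //.
apply: le_trans (hoelder m mr ms _ _ _) => //; last by rewrite -[RHS](@mulVf _ 2%:R) ?mulr_natr.
rewrite Lnorm1 /Rintegral fineK //.
apply: integrable_fin_num => //.
exact: (integrable_abse (integrable_sqM mr ms ir is_)).
Qed.

Lemma Rintegral_minkowski r s : measurable_fun setT r -> measurable_fun setT s ->
  m.-integrable setT (fun x => (r x ^+ 2)%:E) -> m.-integrable setT (fun x => (s x ^+ 2)%:E) ->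
  m.-integrable setT (fun x => ((r x + s x) ^+ 2)%:E) /\
  Num.sqrt (\int[m]_x ((r x + s x) ^+ 2)) <=
  Num.sqrt (\int[m]_x (r x ^+ 2)) + Num.sqrt (\int[m]_x (s x ^+ 2)).
Proof.
move=> mr ms ir is_; have mrs := measurable_funD mr ms.
have M : ('N[m]_2%:E[EFin \o (r \+ s)%R] <= 'N[m]_2%:E[EFin \o r] + 'N[m]_2%:E[EFin \o s])%E.
  by apply: minkowski_EFin => //; rewrite ler1n.
have irs : m.-integrable setT (fun x => ((r x + s x) ^+ 2)%:E).
  apply/(lnorm2P mrs); apply: le_lt_trans M _.
  by rewrite !lnorm2E // -EFinD ltry.
by split=> //; rewrite -lee_fin EFinD -!lnorm2E //; rewrite lnorm2E // in M *.
Qed.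

End RealL2.

Section GaussianMeasure.
Context {R : realType}.
Local Notation lam := (@lebesgue_measure R).
Local Notation dens := (@gauss_density R).
Implicit Types (f : R[i] -> \bar R) (g h : R[i] -> R[i]) (r : R[i] -> R).

Lemma dens_gt0 z : 0 < dens z.
Proof. by rewrite mulr_gt0 ?expR_gt0 // invr_gt0 pi_gt0. Qed.

Lemma dens_ge0 z : 0 <= dens z. Proof. exact: ltW (dens_gt0 z). Qed.

Lemma measurable_normc2 : measurable_fun setT (fun z : R[i] => normc z ^+ 2).
Proof. by apply: measurable_funX; exact: meas_normc. Qed.

Lemma measurable_dens : measurable_fun setT dens.
Proof.
apply: measurable_funM; first exact: measurable_cst.
by apply: measurableT_comp => //; apply: measurable_funN; exact: measurable_normc2.
Qed.

Lemma measurable_Edens : measurable_fun setT (fun z => (dens z)%:E).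
Proof. by apply/measurable_EFinP; exact: measurable_dens. Qed.

Import HBNNSimple.

Let mu_indic E : measurable E ->
  (\int[mu]_z (\1_E z)%:E = \int[area]_z ((\1_E z)%:E * (dens z)%:E))%E.
Proof.
move=> mE; rewrite integral_indic //= setIT /mu [LHS]integral_mkcond.
apply: eq_integral => z _; rewrite patchE indicE.
by case: ifP => _; rewrite ?mul1e ?mul0e.
Qed.

Let mu_nnsfun (f : {nnsfun R[i] >-> R}) :
  (\int[mu]_z (f z)%:E = \int[area]_z ((f z)%:E * (dens z)%:E))%E.
Proof.
have mi x : measurable_fun setT (fun z => (\1_(f @^-1` [set x]) z)%:E : \bar R).
  exact/measurable_EFinP/measurable_indic.
under [LHS]eq_integral do rewrite fimfunE -fsumEFin//.
rewrite [LHS]ge0_integral_fsum//; last 2 first.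
  - by move=> x; exact/measurable_EFinP/measurableT_comp.
  - by move=> n x _; rewrite EFinM nnfun_muleindic_ge0.
under [RHS]eq_integral.
  move=> z _; rewrite fimfunE -fsumEFin// ge0_mule_fsuml; last first.
    by move=> x; rewrite EFinM nnfun_muleindic_ge0.
  over.
rewrite [RHS]ge0_integral_fsum//; last 2 first.
  - move=> x; apply: emeasurable_funM measurable_Edens.
    by apply/measurable_EFinP; do 2 apply/measurableT_comp => //.
  - move=> n x _; rewrite mule_ge0// ?lee_fin ?dens_ge0 // -lee_fin EFinM nnfun_muleindic_ge0 //.
apply: eq_fsbigr => x _; under [RHS]eq_integral do rewrite EFinM -muleA.
under [LHS]eq_integral do rewrite EFinM.
have [x0|x0] := leP 0 x.
  rewrite ge0_integralZl // ?mu_indic // ?ge0_integralZl //.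
  - by apply: emeasurable_funM => //; exact: measurable_Edens.
  - by move=> z _; rewrite mule_ge0 // lee_fin ?dens_ge0.
rewrite (_ : f @^-1` [set x] = set0); last first.
  by apply/seteqP; split => z //= fz; have : 0 <= f z by []; rewrite fz leNgt x0.
by rewrite !integral0_eq // => z _; rewrite indic0 /= ?mul0e ?mule0.
Qed.

(** [mu] is only given on sets, so its density is extracted by monotone approximation
   with simple functions. *)
Lemma ge0_mu f : measurable_fun setT f -> (forall z, (0 <= f z)%E) ->
  (\int[mu]_z f z = \int[area]_z (f z * (dens z)%:E))%E.
Proof.
move=> mf f0.
pose f_ := nnsfun_approx measurableT mf.
transitivity (lim (\int[mu]_x (f_ n x)%:E @[n --> \oo])%E).
  rewrite -monotone_convergence//=.
  - apply: eq_integral => ? /[!inE] xD; apply/esym/cvg_lim => //=.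
    exact: cvg_nnsfun_approx.
  - by move=> n; exact/measurable_EFinP/measurable_funTS.
  - by move=> n ? _; rewrite lee_fin.
  - by move=> ? _ ? ? mn; rewrite lee_fin; exact/lefP/nd_nnsfun_approx.
transitivity (lim (\int[area]_x ((f_ n x)%:E * (dens x)%:E) @[n --> \oo])%E).
  rewrite (_ : (fun n => \int[mu]_x (f_ n x)%:E)%E =
    (fun n => \int[area]_x ((f_ n x)%:E * (dens x)%:E))%E) //.
  by apply/funext => n; exact: mu_nnsfun.
rewrite -monotone_convergence//=.
- apply: eq_integral => z _; apply: cvg_lim => //=.
  apply: cvgeZr => //; exact: cvg_nnsfun_approx.
- move=> n; apply: emeasurable_funM measurable_Edens.
  exact/measurable_EFinP/measurable_funTS.
- by move=> n ? _; rewrite mule_ge0 // lee_fin ?dens_ge0.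
- move=> z _ a b ab; rewrite lee_wpmul2r ?lee_fin ?dens_ge0 //; exact/lefP/nd_nnsfun_approx.
Qed.

Lemma mu_integral f : measurable_fun setT f ->
  (\int[mu]_z f z = \int[area]_z (f z * (dens z)%:E))%E.
Proof.
move=> mf; rewrite integralE [RHS]integralE.
rewrite (ge0_mu (measurable_funepos mf) (funepos_ge0 f)).
rewrite (ge0_mu (measurable_funeneg mf) (funeneg_ge0 f)).
have d0 z : (0 <= (dens z)%:E)%E by rewrite lee_fin dens_ge0.
congr (_ - _)%E; apply: eq_integral => z _.
  by rewrite !funeposE maxe_pMl // mul0e.
by rewrite !funenegE -mulNe maxe_pMl // mul0e.
Qed.

Lemma mu_integrable r : measurable_fun setT r ->
  mu.-integrable setT (EFin \o r) <-> area.-integrable setT (fun z => (r z * dens z)%:E).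
Proof.
move=> mr.
have mrd : measurable_fun setT (fun z => (r z * dens z)%:E).
  by apply/measurable_EFinP; apply: measurable_funM => //; exact: measurable_dens.
have E : (\int[mu]_z `|(r z)%:E| = \int[area]_z `|(r z * dens z)%:E|)%E.
  rewrite mu_integral; last by apply: measurableT_comp => //; exact/measurable_EFinP.
  by apply: eq_integral => z _; rewrite /= normrM EFinM (ger0_norm (dens_ge0 z)).
split=> /integrableP[_ h]; apply/integrableP; split => //.
- by rewrite -E.
- exact/measurable_EFinP.
- by rewrite E.
Qed.

Lemma mu_Rintegral r : measurable_fun setT r ->
  (\int[mu]_z r z = \int[area]_z (r z * dens z))%R.
Proof.
move=> mr; rewrite /Rintegral mu_integral; last exact/measurable_EFinP.
by congr fine; apply: eq_integral => z _; rewrite EFinM.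
Qed.

Lemma mu_cint g : measurable_fun setT g ->
  cint mu setT g = cint area setT (fun z => g z * (dens z)%:C).
Proof.
move=> /measurable_ReP[g1 g2]; rewrite /cint !mu_Rintegral //.
by congr (_ +i* _); apply: eq_Rintegral => z _; rewrite !reim /=; ring.
Qed.

End GaussianMeasure.

Section GaussianGrowth.
Context {R : realType}.
Local Notation lam := (@lebesgue_measure R).
Local Notation dens := (@gauss_density R).
Implicit Types (g h : R[i] -> R[i]) (r : R[i] -> R).

Lemma gauss1_finite (c : R) : 0 < c ->
  exists K : R, (\int[lam]_x (expR (- (c * (x : R) ^+ 2)))%:E = K%:E)%E.
Proof.
move=> c0; pose s := (Num.sqrt (c *+ 2))^-1.
have c20 : 0 < c *+ 2 by rewrite mulrn_wgt0.
have s0 : s != 0 by rewrite invr_neq0 // gt_eqF // sqrtr_gt0.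
exists (normal_peak s)^-1.
transitivity (((normal_peak s)^-1)%:E * \int[lam]_x (normal_pdf 0 s x)%:E)%E; last first.
  by rewrite integral_normal_pdf mule1.
rewrite -ge0_integralZl //.
- apply: eq_integral => x _; rewrite -EFinM normal_pdfE // mulKf ?gt_eqF ?normal_peak_gt0 //.
  congr EFin; congr expR; rewrite subr0 /s exprVn sqr_sqrtr ?ltW // mulNr; congr (- _).
  by rewrite -mulr_natr; field; rewrite gt_eqF.
- by apply/measurable_EFinP; exact: measurable_normal_pdf.
- by move=> x _; rewrite lee_fin normal_pdf_ge0.
- by rewrite lee_fin invr_ge0 normal_peak_ge0.
Qed.

Lemma measurable_gaussc (c : R) : measurable_fun setT (fun z : R[i] => expR (- (c * normc z ^+ 2))).
Proof.
apply: measurableT_comp => //; apply: measurable_funN.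
by apply: measurable_funM; [exact: measurable_cst|exact: measurable_normc2].
Qed.

Lemma measurable_gauss1 (c : R) :
  measurable_fun setT (fun x : measurableTypeR R => (expR (- (c * (x : R) ^+ 2)))%:E).
Proof.
apply/measurable_EFinP/measurableT_comp => //; apply: measurable_funN.
by apply: measurable_funM => //; exact: measurable_funX.
Qed.

Lemma gauss2_finite (c : R) : 0 < c ->
  exists K : R, (\int[area]_z (expR (- (c * normc z ^+ 2)))%:E = K%:E)%E.
Proof.
move=> c0; have [K EK] := gauss1_finite c0; exists (K * K).
have K0 : (0 <= K%:E)%E by rewrite -EK; apply: integral_ge0 => x _; rewrite lee_fin expR_ge0.
rewrite ge0_area; last 2 first.
- by apply/measurable_EFinP; exact: measurable_gaussc.
- by move=> z; rewrite lee_fin expR_ge0.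
transitivity (\int[lam]_x (K%:E * (expR (- (c * (x : R) ^+ 2)))%:E))%E.
  apply: eq_integral => x _; rewrite -EK.
  rewrite -ge0_integralZr //; last exact: measurable_gauss1.
  apply: eq_integral => y _; rewrite -EFinM -expRD normc2 /=; congr (expR _)%:E; ring.
rewrite ge0_integralZl //; last exact: measurable_gauss1.
by rewrite EK EFinM.
Qed.

Lemma gauss2_integrable (c : R) : 0 < c ->
  area.-integrable setT (fun z => (expR (- (c * normc z ^+ 2)))%:E).
Proof.
move=> c0; apply/integrableP; split; first by apply/measurable_EFinP; exact: measurable_gaussc.
have [K EK] := gauss2_finite c0.
under eq_integral do rewrite gee0_abs ?lee_fin ?expR_ge0 //.
by rewrite EK ltry.
Qed.

(** The Gaussian integral over the plane is the product of two on the line. *)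
Lemma mu_setT : mu [set: R[i]] = 1%E.
Proof.
have E : (\int[area]_z (expR (- (normc z ^+ 2)))%:E = pi%:E :> \bar R)%E.
  have g1 : (\int[lam]_x (expR (- ((x : R) ^+ 2)))%:E = (Num.sqrt pi)%:E)%E by exact: integralT_gauss.
  have mg : measurable_fun setT (fun x : measurableTypeR R => (expR (- ((x : R) ^+ 2)))%:E).
    by have := measurable_gauss1 1; under eq_fun do rewrite mul1r.
  rewrite ge0_area; last 2 first.
  - by apply/measurable_EFinP; have := measurable_gaussc 1; under eq_fun do rewrite mul1r.
  - by move=> z; rewrite lee_fin expR_ge0.
  transitivity (\int[lam]_x ((Num.sqrt pi)%:E * (expR (- ((x : R) ^+ 2)))%:E))%E.
    apply: eq_integral => x _; rewrite -g1.
    rewrite -ge0_integralZr //.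
    apply: eq_integral => y _; rewrite -EFinM -expRD normc2 /=; congr (expR _)%:E; ring.
  rewrite ge0_integralZl //.
  by rewrite g1 -EFinM -expr2 sqr_sqrtr // pi_ge0.
rewrite /mu /gauss_density.
under eq_integral do rewrite EFinM.
rewrite ge0_integralZl //.
- by rewrite E -EFinM mulVf // gt_eqF // pi_gt0.
- by apply/measurable_EFinP; have := measurable_gaussc 1; under eq_fun do rewrite mul1r.
- by rewrite lee_fin invr_ge0 pi_ge0.
Qed.

Lemma mu_sigma_finite : sigma_finite setT (@mu R).
Proof.
apply: fin_num_fun_sigma_finite; first by rewrite measure0.
move=> A mA; rewrite ge0_fin_numE //.
have : (mu A <= mu [set: R[i]])%E by apply: le_measure; rewrite ?inE.
by rewrite mu_setT => /le_lt_trans; apply; rewrite ltry.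
Qed.

HB.instance Definition _ := @Measure_isSigmaFinite.Build _ _ _ (@mu R) mu_sigma_finite.

Lemma mu_integrable_cst (c : R) : mu.-integrable setT (fun _ : R[i] => c%:E).
Proof.
apply/integrableP; split; first exact: measurable_cst.
by rewrite integral_cst // [X in (_ * X)%E]mu_setT mule1 /= ltry.
Qed.

Lemma mu_integrable_growth (r : R[i] -> R) (M a : R) : a < 1 -> measurable_fun setT r ->
  (forall z, `|r z| <= M * expR (a * normc z ^+ 2)) -> mu.-integrable setT (EFin \o r).
Proof.
move=> a1 mr H; apply/mu_integrable => //.
have c0 : 0 < 1 - a by rewrite subr_gt0.
apply: (@le_integrableE _ _ _ area setT (fun z => r z * dens z)
  (fun z => (M / pi) * expR (- ((1 - a) * normc z ^+ 2)))) => //.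
- by apply: measurable_funM => //; exact: measurable_dens.
- move=> z _; rewrite normrM (ger0_norm (dens_ge0 z)).
  apply: (le_trans (ler_wpM2r (dens_ge0 z) (H z))).
  rewrite le_eqVlt; apply/orP; left; apply/eqP.
  rewrite /gauss_density mulrACA -expRD; congr (_ * expR _); ring.
- have := @integrableZl _ _ _ area setT measurableT (M / pi) _ (gauss2_integrable c0).
  exact.
Qed.

Lemma mu_cintegrable_growth g (M a : R) : a < 1 -> measurable_fun setT g ->
  (forall z, normc (g z) <= M * expR (a * normc z ^+ 2)) -> cintegrable mu setT g.
Proof.
move=> a1 mg H; apply: (@cintegrable_le _ _ _ mu setT g (fun z => normc (g z))) => //.
apply: (mu_integrable_growth a1) => //; first exact: meas_normc.
by move=> z; rewrite ger0_norm ?normc_ge0.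
Qed.

(** Completing the square: a translated Gaussian has an exponential density. *)
Lemma dens_shift (a z : R[i]) : dens (z - a) =
  dens z * expR (complex.Re (z * a^*) *+ 2 - normc a ^+ 2).
Proof.
rewrite /gauss_density -mulrA -expRD; congr (_ * expR _).
by rewrite !normc2 !reim; ring.
Qed.

Lemma measurable_shift_exponent (a : R[i]) :
  measurable_fun setT (fun z : R[i] => complex.Re (z * a^*) *+ 2 - normc a ^+ 2).
Proof.
apply: measurable_funB; last exact: measurable_cst.
under eq_fun do rewrite mulr2n; apply: measurable_funD;
  by apply: measurableT_comp measurable_Re _; apply: measC_M; [exact: measurable_id|exact: measurable_cst].
Qed.

Lemma mu_cint_shift g (a : R[i]) : measurable_fun setT g ->
  cint mu setT (fun z => g (z + a)) =
  cint mu setT (fun z => g z * (expR (complex.Re (z * a^*) *+ 2 - normc a ^+ 2))%:C).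
Proof.
move=> mg.
have mp : measurable_fun setT (fun z : R[i] => z + a) by case: (area_preserving_shift a).
have mE : measurable_fun setT (fun z : R[i] => expR (complex.Re (z * a^*) *+ 2 - normc a ^+ 2)).
  by apply: measurableT_comp => //; exact: measurable_shift_exponent.
rewrite mu_cint; last exact: measurableT_comp mg mp.
rewrite mu_cint; last by apply: measC_M => //; exact: measC_real.
rewrite -[RHS](area_preserving_cint (area_preserving_shift a)); last first.
  by apply: measC_M; [apply: measC_M => //; exact: measC_real|apply: measC_real; exact: measurable_dens].
apply: eq_cint => z _; rewrite -mulrA -rmorphM /=; congr (_ * _%:C).
by rewrite mulrC -dens_shift addrK.
Qed.

Lemma ge0_mu_shift r (a : R[i]) : measurable_fun setT r -> (forall z, 0 <= r z) ->
  (\int[mu]_z (r (z + a))%:E =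
   \int[mu]_z (r z * expR (complex.Re (z * a^*) *+ 2 - normc a ^+ 2))%:E)%E.
Proof.
move=> mr r0.
have mp : measurable_fun setT (fun z : R[i] => z + a) by case: (area_preserving_shift a).
have mE : measurable_fun setT (fun z : R[i] => expR (complex.Re (z * a^*) *+ 2 - normc a ^+ 2)).
  by apply: measurableT_comp => //; exact: measurable_shift_exponent.
have mr' : measurable_fun setT (fun z => (r z)%:E) by exact/measurable_EFinP.
have mrE : measurable_fun setT (fun z => r z * expR (complex.Re (z * a^*) *+ 2 - normc a ^+ 2)).
  exact: measurable_funM.
rewrite mu_integral; last exact: measurableT_comp mr' mp.
rewrite [RHS]mu_integral; last exact/measurable_EFinP.
rewrite -[RHS](area_preserving_integral (area_preserving_shift a)); last first.
  by apply: emeasurable_funM measurable_Edens; exact/measurable_EFinP.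
apply: eq_integral => z _; rewrite -!EFinM -mulrA; congr (_ * _)%:E.
by rewrite mulrC -dens_shift addrK.
Qed.

Lemma mu_cintegrable_shift g (a : R[i]) : measurable_fun setT g ->
  cintegrable mu setT (fun z => g z * (expR (complex.Re (z * a^*) *+ 2 - normc a ^+ 2))%:C) ->
  cintegrable mu setT (fun z => g (z + a)).
Proof.
move=> mg ig.
have mga : measurable_fun setT (fun z : R[i] => g (z + a)).
  by apply: measurableT_comp mg _; case: (area_preserving_shift a).
have mE : measurable_fun setT (fun z : R[i] => expR (complex.Re (z * a^*) *+ 2 - normc a ^+ 2)).
  by apply: measurableT_comp => //; exact: measurable_shift_exponent.
apply: (cintegrable_le measurableT mga (fun w _ => lexx _)).
apply/integrableP; split; first by apply/measurable_EFinP; exact: meas_normc.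
under eq_integral do rewrite abse_EFin ger0_norm ?normc_ge0 //.
rewrite (ge0_mu_shift a (meas_normc mg) (fun w => normc_ge0 (g w))).
have := cintegrable_normc measurableT (measC_M mg (measC_real mE)) ig.
move=> /integrableP[_]; apply: le_lt_trans.
rewrite le_eqVlt; apply/orP; left; apply/eqP; apply: eq_integral => w _.
by rewrite abse_EFin ger0_norm ?normc_ge0 // (normcM (g w)) normcR [`|expR _|]ger0_norm ?expR_ge0.
Qed.

Lemma mu_cint_rot g (u : R[i]) : normc u = 1 -> measurable_fun setT g ->
  cint mu setT (fun z => g (u * z)) = cint mu setT g.
Proof.
move=> u1 mg; have Hu := area_preserving_rot u1.
rewrite mu_cint; last by apply: measurableT_comp mg _; case: Hu.
rewrite [RHS]mu_cint // -[RHS](area_preserving_cint Hu); last first.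
  by apply: measC_M => //; apply: measC_real; exact: measurable_dens.
by apply: eq_cint => z _; rewrite /gauss_density normcM u1 mul1r.
Qed.

End GaussianGrowth.

(** * The space of square-integrable functions *)

Section ComplexL2.
Context {R : realType}.
Implicit Types (u v w f : R[i] -> R[i]) (c : R[i]).

Definition L2 u := measurable_fun setT u /\
  mu.-integrable setT (fun z => (normc (u z) ^+ 2)%:E).

Definition nrm u : R := Num.sqrt (\int[mu]_z (normc (u z) ^+ 2)).

Lemma L2P u : Lp 2%:E u <-> L2 u.
Proof.
split=> -[mu_ h]; split => //.
  by apply/(lnorm2P _ (meas_normc mu_)).
by apply/(lnorm2P _ (meas_normc mu_)).
Qed.

Lemma L2norm_nrm u : L2 u -> L2norm u = (nrm u)%:E.
Proof. by move=> [mu_ h]; rewrite /L2norm lnorm2E //; exact: meas_normc. Qed.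

Lemma nrm_ge0 u : 0 <= nrm u. Proof. exact: sqrtr_ge0. Qed.

Lemma nrm_sqr u : nrm u ^+ 2 = \int[mu]_z (normc (u z) ^+ 2).
Proof. by rewrite sqr_sqrtr //; apply: Rintegral_ge0 => z _; exact: sqr_ge0. Qed.

Lemma nrm_sqrE u : L2 u -> ((nrm u ^+ 2)%:E = \int[mu]_z (normc (u z) ^+ 2)%:E)%E.
Proof. by move=> [_ h]; rewrite nrm_sqr /Rintegral fineK // integrable_fin_num. Qed.

Lemma L2_le u v (M : R) : measurable_fun setT u -> L2 v -> 0 <= M ->
  (forall z, normc (u z) <= M * normc (v z)) -> L2 u /\ nrm u <= M * nrm v.
Proof.
move=> mu_ [mv iv] M0 H.
have H2 z : normc (u z) ^+ 2 <= M ^+ 2 * normc (v z) ^+ 2.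
  by rewrite -exprMn lerXn2r ?nnegrE ?normc_ge0 ?mulr_ge0 ?normc_ge0.
have iMv : mu.-integrable setT (fun z => (M ^+ 2 * normc (v z) ^+ 2)%:E).
  exact: (integrableZl measurableT (M ^+ 2) iv).
have iu : mu.-integrable setT (fun z => (normc (u z) ^+ 2)%:E).
  apply: (@le_integrableE _ _ _ mu setT (fun z => normc (u z) ^+ 2) _ measurableT _ _ iMv).
    by apply: measurable_funX; exact: meas_normc.
  by move=> z _; rewrite ger0_norm ?sqr_ge0.
split => //.
rewrite -[leLHS](ger0_norm (nrm_ge0 u)) -[leLHS]sqrtr_sqr -[leRHS]ger0_norm ?mulr_ge0 ?nrm_ge0 //.
rewrite -[leRHS]sqrtr_sqr ler_wsqrtr // exprMn !nrm_sqr -RintegralZl //.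
by apply: le_Rintegral.
Qed.

Lemma L2_ae_le u v (M : R) : measurable_fun setT u -> L2 v -> 0 <= M ->
  (\forall z \ae mu, normc (u z) <= M * normc (v z)) -> L2 u /\ nrm u <= M * nrm v.
Proof.
move=> mu_ [mv iv] M0 H.
have [E [mE E0 HE]] := H.
pose u' := fun z => u z * (\1_(~` E) z)%:C.
have mu' : measurable_fun setT u'.
  by apply: measC_M => //; apply: measC_real; exact: (measurable_indic (measurableC mE)).
have Eae : (\forall z \ae mu, normc (u z) ^+ 2 = normc (u' z) ^+ 2).
  exists E; split => // z /= nz; apply: contrapT => nE; apply: nz.
  by rewrite /u' indicE mem_set // mulr1.
have H' z : normc (u' z) <= M * normc (v z).
  rewrite /u' normcM normcR indicE; have [zE|zE] := boolP (z \in ~` E).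
    rewrite normr1 mulr1; apply: contrapT => nz; move: zE; rewrite inE /=; apply.
    exact: HE.
  by rewrite normr0 mulr0 mulr_ge0 ?normc_ge0.
have [[_ iu'] nu'] := L2_le mu' (conj mv iv) M0 H'.
have mn w : measurable_fun setT w -> measurable_fun setT (fun z => (normc (w z) ^+ 2)%:E).
  by move=> mw; apply/measurable_EFinP/measurable_funX; exact: meas_normc.
have Eint : (\int[mu]_z (normc (u z) ^+ 2)%:E = \int[mu]_z (normc (u' z) ^+ 2)%:E)%E.
  apply: ge0_ae_eq_integral => //; try exact: mn; try by move=> z _; rewrite lee_fin sqr_ge0.
  by apply: filterS Eae => z Ez _; rewrite Ez.
split; last by rewrite /nrm /Rintegral Eint.
split => //; apply/integrableP; split; first exact: mn.
under eq_integral do rewrite gee0_abs ?lee_fin ?sqr_ge0 //.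
rewrite Eint; have /integrableP[_] := iu'.
by under eq_integral do rewrite gee0_abs ?lee_fin ?sqr_ge0 //.
Qed.

Lemma L2D u v : L2 u -> L2 v ->
  L2 (fun z => u z + v z) /\ nrm (fun z => u z + v z) <= nrm u + nrm v.
Proof.
move=> [mu_ iu] [mv iv].
have [isum le] := Rintegral_minkowski (meas_normc mu_) (meas_normc mv) iu iv.
have H z : normc (u z + v z) ^+ 2 <= (normc (u z) + normc (v z)) ^+ 2.
  by rewrite lerXn2r ?nnegrE ?normc_ge0 ?addr_ge0 ?normc_ge0 // normcD.
have muv := measC_D mu_ mv.
have iuv : mu.-integrable setT (fun z => (normc (u z + v z) ^+ 2)%:E).
  apply: (@le_integrableE _ _ _ mu setT (fun z => normc (u z + v z) ^+ 2) _ measurableT _ _ isum).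
    by apply: measurable_funX; exact: meas_normc.
  by move=> z _; rewrite ger0_norm ?sqr_ge0.
split => //; apply: le_trans le; rewrite ler_wsqrtr //.
exact: le_Rintegral.
Qed.

Lemma L2Z c u : L2 u -> L2 (fun z => c * u z) /\ nrm (fun z => c * u z) = normc c * nrm u.
Proof.
move=> [mu_ iu]; have mcu : measurable_fun setT (fun z => c * u z).
  by apply: measC_M => //; exact: measurable_cst.
have H z : normc (c * u z) <= normc c * normc (u z) by rewrite normcM.
have [Lc _] := L2_le mcu (conj mu_ iu) (normc_ge0 c) H.
split => //; rewrite /nrm.
under eq_Rintegral do rewrite normcM exprMn.
by rewrite RintegralZl // sqrtrM ?sqr_ge0 // sqrtr_sqr ger0_norm ?normc_ge0.
Qed.

Lemma L2N u : L2 u -> L2 (fun z => - u z) /\ nrm (fun z => - u z) = nrm u.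
Proof.
move=> /(L2Z (-1)); rewrite normcNE normc1 mul1r.
by under [X in L2 X /\ _]eq_fun do rewrite mulN1r; under [X in nrm X = _]eq_fun do rewrite mulN1r.
Qed.

Lemma L2B u v : L2 u -> L2 v ->
  L2 (fun z => u z - v z) /\ nrm (fun z => u z - v z) <= nrm u + nrm v.
Proof. by move=> Lu /L2N[Lv <-]; exact: L2D. Qed.

Lemma L2_0 : L2 (fun=> 0) /\ nrm (fun=> 0 : R[i]) = 0.
Proof.
have E : (fun z : R[i] => normc (0 : R[i]) ^+ 2) = fun=> 0.
  by apply/funext => z; rewrite normc0 expr0n.
split; last by rewrite /nrm /= E Rintegral_cst // mul0r sqrtr0.
split; first exact: measurable_cst.
rewrite (_ : (fun=> _) = fun=> 0%E); first exact: integrable0.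
by apply/funext => z; rewrite normc0 expr0n.
Qed.

Lemma L2_sum (I : Type) (s : seq I) (F : I -> R[i] -> R[i]) :
  (forall i, L2 (F i)) -> L2 (fun z => \sum_(i <- s) F i z) /\
  nrm (fun z => \sum_(i <- s) F i z) <= \sum_(i <- s) nrm (F i).
Proof.
move=> H; elim: s => [|i s [IH1 IH2]].
  under [X in L2 X /\ _]eq_fun do rewrite big_nil; under [X in nrm X <= _]eq_fun do rewrite big_nil.
  by rewrite big_nil; have [? ->] := L2_0.
under [X in L2 X /\ _]eq_fun do rewrite big_cons; under [X in nrm X <= _]eq_fun do rewrite big_cons.
have [L1 n1] := L2D (H i) IH1; split => //.
by rewrite big_cons (le_trans n1) // lerD2l.
Qed.

Lemma L2M_int u v : L2 u -> L2 v -> mu.-integrable setT (fun z => (normc (u z * v z))%:E).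
Proof.
move=> [mu_ iu] [mv iv].
have := integrable_sqM (meas_normc mu_) (meas_normc mv) iu iv.
by under [X in _ -> integrable _ _ X]eq_fun do rewrite normcM.
Qed.

Lemma L2M_cint u v : L2 u -> L2 v -> cintegrable mu setT (fun z => u z * v z).
Proof.
move=> Lu Lv; apply: (cintegrable_le measurableT _ (fun z _ => lexx _) (L2M_int Lu Lv)).
by case: Lu => mu_ _; case: Lv => mv _; exact: measC_M.
Qed.

Lemma L2J u : L2 u -> L2 (fun z => (u z)^*) /\ nrm (fun z => (u z)^*) = nrm u.
Proof.
move=> [mu_ iu]; split; last by rewrite /nrm; under eq_Rintegral do rewrite normcJ.
split; first exact: measC_J.
by under [X in integrable _ _ X]eq_fun do rewrite normcJ.
Qed.

Lemma normc_int_mul u v : L2 u -> L2 v ->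
  normc (cint mu setT (fun z => u z * v z)) <= nrm u * nrm v.
Proof.
move=> Lu Lv; have [mu_ iu] := Lu; have [mv iv] := Lv.
rewrite (le_trans (normc_cint measurableT (measC_M mu_ mv) (L2M_cint Lu Lv))) //.
apply: le_trans (Rintegral_CS (meas_normc mu_) (meas_normc mv) iu iv).
apply: le_Rintegral => //; first exact: L2M_int.
  have := L2M_int Lu Lv; congr (integrable _ _ _); apply/funext => z.
  by rewrite /= normcM ger0_norm ?mulr_ge0 ?normc_ge0.
by move=> z _; rewrite normcM ler_norm.
Qed.

Lemma innerE u v : inner u v = cint mu setT (fun z => u z * (v z)^*).
Proof. by []. Qed.

Lemma inner_int u v : L2 u -> L2 v -> cintegrable mu setT (fun z => u z * (v z)^*).
Proof. by move=> Lu /L2J[Lv _]; exact: L2M_cint. Qed.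

Lemma inner_CS u v : L2 u -> L2 v -> normc (inner u v) <= nrm u * nrm v.
Proof. by move=> Lu /L2J[Lv <-]; exact: normc_int_mul. Qed.

Lemma innerDl u v w : L2 u -> L2 v -> L2 w ->
  inner (fun z => u z + v z) w = inner u w + inner v w.
Proof.
move=> Lu Lv Lw; rewrite !innerE -cintD //; try exact: inner_int.
by apply: eq_cint => z _; rewrite mulrDl.
Qed.

Lemma innerZl c u w : L2 u -> L2 w -> inner (fun z => c * u z) w = c * inner u w.
Proof.
move=> Lu Lw; rewrite !innerE -cintZ //; last exact: inner_int.
by apply: eq_cint => z _; rewrite mulrA.
Qed.

Lemma innerBl u v w : L2 u -> L2 v -> L2 w ->
  inner (fun z => u z - v z) w = inner u w - inner v w.
Proof.
move=> Lu Lv Lw; rewrite !innerE -cintB //; try exact: inner_int.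
by apply: eq_cint => z _; rewrite mulrBl.
Qed.

Lemma innerJ u v : L2 u -> L2 v -> inner v u = (inner u v)^*.
Proof.
move=> Lu Lv; rewrite !innerE -cintJ //; last exact: inner_int.
by apply: eq_cint => z _; rewrite conjM conjcK mulrC.
Qed.

Lemma innerZr c u w : L2 u -> L2 w -> inner w (fun z => c * u z) = c^* * inner w u.
Proof.
move=> Lu Lw; have [Lcu _] := L2Z c Lu.
by rewrite (innerJ Lcu Lw) innerZl // conjM -!innerJ.
Qed.

Lemma inner_suml (I : Type) (s : seq I) (F : I -> R[i] -> R[i]) w :
  (forall i, L2 (F i)) -> L2 w ->
  inner (fun z => \sum_(i <- s) F i z) w = \sum_(i <- s) inner (F i) w.
Proof.
move=> H Lw; elim: s => [|i s IH].
  rewrite big_nil innerE -[RHS](@cint0 _ _ _ mu setT measurableT).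
  by apply: eq_cint => z _; rewrite big_nil mul0r.
rewrite big_cons -IH -innerDl //; last exact: (L2_sum s H).1.
by congr inner; apply/funext => z; rewrite big_cons.
Qed.

Lemma inner_sumr (I : Type) (s : seq I) (F : I -> R[i] -> R[i]) w :
  (forall i, L2 (F i)) -> L2 w ->
  inner w (fun z => \sum_(i <- s) F i z) = \sum_(i <- s) inner w (F i).
Proof.
move=> H Lw; rewrite (innerJ (L2_sum s H).1 Lw) inner_suml // conj_sum.
by apply: eq_bigr => i _; rewrite -innerJ.
Qed.

Lemma inner_nrm u : L2 u -> inner u u = (nrm u ^+ 2)%:C.
Proof.
move=> Lu; rewrite nrm_sqr -cint_real //; apply: eq_cint => z _.
by rewrite normcJM.
Qed.

(** The symbol enters all that follows through this boundedness. *)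
Lemma Linfty_mul f : Lp +oo%E f -> exists2 M : R, 0 <= M &
  forall u, L2 u -> L2 (fun z => f z * u z) /\ nrm (fun z => f z * u z) <= M * nrm u.
Proof.
move=> [mf]; rewrite /finite_norm unlock /=.
have -> : (0%R < @mu R setT)%E by rewrite mu_setT lte_fin.
move=> fin.
have [M M0 HM] : exists2 M : R, 0 <= M & \forall z \ae mu, normc (f z) <= M.
  have := ess_sup_inf.ess_sup_ge (@mu R) (abse \o (EFin \o (fun z => normc (f z)))).
  case: (ess_sup_inf.ess_sup _ _) fin => [M _ H| |_ H] //.
    exists (Num.max 0 M); first by rewrite le_max lexx.
    apply: filterS H => z /=; rewrite lee_fin => /(le_trans (ler_norm _)) h.
    by rewrite le_max h orbT.
  exists 0 => //; apply: filterS H => z /=; rewrite leeNy_eq => /eqP.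
  by [].
exists M => // u Lu; apply: L2_ae_le => //; first by apply: measC_M => //; case: Lu.
by apply: filterS HM => z h; rewrite normcM ler_wpM2r ?normc_ge0.
Qed.

End ComplexL2.

(** * Integral operators commuting with Weyl translations *)

Section TwistedConvolution.
Context {R : realType}.
Local Notation dens := (@gauss_density R).
Implicit Types (u v : R[i] -> R[i]) (phi psi : R[i] -> R[i]) (z w : R[i]).

(** The operators used below all have kernels [phi (z - w) e^{z w'}], where w'
   is the conjugate of w: they commute with the Weyl translations. *)
Definition tck phi z w := phi (z - w) * cexp (z * w^*).
Definition tc phi u z := cint mu setT (fun w => u w * tck phi z w).

(** The modulus of [e^{z w'}] is [e^{(|z|^2 + |w|^2 - |z - w|^2) / 2}]: with this growth of
   [phi] the kernel keeps a Gaussian factor in [z - w]. *)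
Definition tame (M : R) phi := measurable_fun setT phi /\
  forall z, normc (phi z) <= M * expR (normc z ^+ 2 / 4).

(** The modulus of [e^{z w'}] times the growth that [tame] allows. *)
Definition gker z w := expR ((normc z ^+ 2 + normc w ^+ 2) / 2 - normc (z - w) ^+ 2 / 4).

Lemma tck_le M phi z w : tame M phi -> normc (tck phi z w) <= M * gker z w.
Proof.
move=> [_ H]; rewrite normcM normc_cexp.
apply: (le_trans (ler_wpM2r (expR_ge0 _) (H _))).
rewrite -mulrA -expRD le_eqVlt; apply/orP; left; apply/eqP; congr (_ * expR _).
by rewrite !normc2 !reim; field.
Qed.

Lemma tame_ge0 M phi : tame M phi -> 0 <= M.
Proof.
by move=> [_ /(_ 0)]; rewrite normc0 expr0n mul0r expR0 mulr1; apply: le_trans (normc_ge0 _).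
Qed.

Let measurable_sub2 : measurable_fun setT (fun p : R[i] * R[i] => p.1 - p.2).
Proof. by apply: measC_B; [exact: measurable_fst|exact: measurable_snd]. Qed.

Lemma measurable_tck2 phi : measurable_fun setT phi ->
  measurable_fun setT (fun p : R[i] * R[i] => tck phi p.1 p.2).
Proof.
move=> mp; apply: measC_M; first exact: measurableT_comp mp measurable_sub2.
by apply: measC_cexp; apply: measC_M; [exact: measurable_fst|apply: measC_J; exact: measurable_snd].
Qed.

Lemma measurable_gker2 : measurable_fun setT (fun p : R[i] * R[i] => gker p.1 p.2).
Proof.
have mn (f : R[i] * R[i] -> R[i]) c : measurable_fun setT f ->
    measurable_fun setT (fun p => normc (f p) ^+ 2 * c).
  move=> mf; apply: measurable_funM; last exact: measurable_cst.
  by apply: measurable_funX; exact: meas_normc.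
apply: measurableT_comp => //; apply: measurable_funB; last exact: mn.
under eq_fun do rewrite mulrDl.
by apply: measurable_funD; apply: mn; [exact: measurable_fst|exact: measurable_snd].
Qed.

Lemma measurable_tck phi z : measurable_fun setT phi -> measurable_fun setT (tck phi z).
Proof. by move=> /measurable_tck2; exact: measurable_fun_pair2. Qed.

Lemma measurable_tck' phi w : measurable_fun setT phi -> measurable_fun setT (tck phi ^~ w).
Proof. by move=> /measurable_tck2; exact: measurable_fun_pair1. Qed.

Lemma measurable_gker z : measurable_fun setT (gker z).
Proof. exact: measurable_fun_pair2 measurable_gker2. Qed.

Lemma gkerC z w : gker z w = gker w z.
Proof. by rewrite /gker normc_distC [normc z ^+ 2 + _]addrC. Qed.

Lemma gker_L2 z : mu.-integrable setT (fun w => (gker z w ^+ 2)%:E).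
Proof.
apply: (@mu_integrable_growth _ _ (expR (normc z ^+ 2 * (3 / 2))) (3 / 4)); first by lra.
  by apply: measurable_funX; exact: measurable_gker.
move=> w; rewrite ger0_norm ?sqr_ge0 // -expRD expr2 -expRD ler_expR.
have : 0 <= normc (z + z - w) ^+ 2 by exact: sqr_ge0.
by rewrite !normc2 !reim; lra.
Qed.

Lemma tck_L2 M phi z : tame M phi -> L2 (tck phi z).
Proof.
move=> H; split; first by apply: measurable_tck; case: H.
have mg := measurable_tck z H.1.
have i2 := @integrableZl _ _ _ mu setT measurableT (M ^+ 2) _ (gker_L2 z).
apply: (@le_integrableE _ _ _ mu setT (fun w => normc (tck phi z w) ^+ 2)
  (fun w => M ^+ 2 * gker z w ^+ 2) measurableT) => //.
  by apply: measurable_funX; exact: meas_normc.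
move=> w _; rewrite ger0_norm ?sqr_ge0 // -exprMn lerXn2r ?nnegrE ?normc_ge0 //; last exact: tck_le.
by rewrite mulr_ge0 ?expR_ge0 // (tame_ge0 H).
Qed.

Lemma tck_L2' M phi w : tame M phi -> L2 (tck phi ^~ w).
Proof.
move=> H; have mg := measurable_tck' w H.1; split => //.
have i2 := @integrableZl _ _ _ mu setT measurableT (M ^+ 2) _ (gker_L2 w).
apply: (@le_integrableE _ _ _ mu setT (fun z => normc (tck phi z w) ^+ 2)
  (fun z => M ^+ 2 * gker w z ^+ 2) measurableT) => //.
  by apply: measurable_funX; exact: meas_normc.
move=> z _; rewrite ger0_norm ?sqr_ge0 // -exprMn lerXn2r ?nnegrE ?normc_ge0 //.
  by rewrite mulr_ge0 ?expR_ge0 // (tame_ge0 H).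
by rewrite gkerC tck_le.
Qed.

(** The mass of the Gaussian of variance 2, which governs all the operator norms. *)
Definition gmass : R := \int[area]_z expR (- (4^-1 * normc z ^+ 2)).

Lemma gmass_ge0 : 0 <= gmass.
Proof. by apply: Rintegral_ge0 => z _; exact: expR_ge0. Qed.

Lemma gmassE : (\int[area]_z (expR (- (4^-1 * normc z ^+ 2)))%:E = gmass%:E :> \bar R)%E.
Proof.
by rewrite /gmass /Rintegral fineK // integrable_fin_num //; exact: gauss2_integrable.
Qed.

Lemma gmass_shift w : (\int[area]_z (expR (- (normc (z - w) ^+ 2 / 4)))%:E = gmass%:E :> \bar R)%E.
Proof.
rewrite -gmassE -[RHS](area_preserving_integral (area_preserving_shift (- w))) //.
  by apply: eq_integral => z _; rewrite [_ / 4]mulrC.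
by apply/measurable_EFinP; exact: measurable_gaussc.
Qed.

Section Young.
Variable u : R[i] -> R[i].
Hypothesis Lu : L2 u.

(** The integral operator with all moduli taken inside. *)
Definition absop z : \bar R := (\int[mu]_w (normc (u w) * gker z w)%:E)%E.

Let mu_ : measurable_fun setT u. Proof. by case: Lu. Qed.

Let iug z : mu.-integrable setT (fun w => (normc (u w) * gker z w)%:E).
Proof.
apply: integrable_sqM; [exact: meas_normc|exact: measurable_gker|by case: Lu|exact: gker_L2].
Qed.

Lemma absop_ge0 z : (0 <= absop z)%E.
Proof. by apply: integral_ge0 => w _; rewrite lee_fin mulr_ge0 ?normc_ge0 ?expR_ge0. Qed.

Lemma absop_fin z : absop z \is a fin_num.
Proof. exact: integrable_fin_num. Qed.

Let m2 : measurable_fun setT (fun p : R[i] * R[i] => (normc (u p.2) * gker p.1 p.2)%:E).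
Proof.
apply/measurable_EFinP/measurable_funM; last exact: measurable_gker2.
by apply: meas_normc; exact: measurableT_comp mu_ measurable_snd.
Qed.

Lemma measurable_absop : measurable_fun setT absop.
Proof.
apply: (measurable_fun_fubini_tonelli_F (m2 := @mu R) _ m2) => p; by rewrite lee_fin mulr_ge0 ?normc_ge0 ?expR_ge0.
Qed.

Let wt z w := normc (u w) ^+ 2 * expR (- (normc (z - w) ^+ 2 / 4)).

Let wt_ge0 z w : 0 <= wt z w. Proof. by rewrite mulr_ge0 ?sqr_ge0 ?expR_ge0. Qed.

Let mwt2 : measurable_fun setT (fun p : R[i] * R[i] => (wt p.1 p.2)%:E).
Proof.
apply/measurable_EFinP/measurable_funM.
  by apply: measurable_funX; apply: meas_normc; exact: measurableT_comp mu_ measurable_snd.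
apply: measurableT_comp => //; apply: measurable_funN; apply: measurable_funM; last exact: measurable_cst.
by apply: measurable_funX; exact: meas_normc.
Qed.

Let iwt z : mu.-integrable setT (fun w => (wt z w)%:E).
Proof.
apply: (@le_integrableE _ _ _ mu setT (wt z) (fun w => normc (u w) ^+ 2) measurableT) => //.
- by apply/measurable_EFinP; exact: measurable_fun_pair2 mwt2.
- move=> w _; rewrite ger0_norm // ler_piMr ?sqr_ge0 //.
  by rewrite -expR0 ler_expR oppr_le0 divr_ge0 ?sqr_ge0.
- by case: Lu.
Qed.

Let absop_sq z : ((fine (absop z)) ^+ 2 <= expR (normc z ^+ 2) * (gmass / pi) * \int[mu]_w wt z w).
Proof.
(* The Gaussian factor in [z - w] is shared equally between [r] and [s]. *)
pose r w := normc (u w) * expR (- (normc (z - w) ^+ 2 / 8)).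
pose s w := expR ((normc z ^+ 2 + normc w ^+ 2) / 2 - normc (z - w) ^+ 2 / 8).
have mzw : measurable_fun setT (fun w => normc (z - w) ^+ 2).
  apply: measurable_funX; apply: meas_normc; apply: measC_B; first exact: measurable_cst.
  exact: measurable_id.
have mr : measurable_fun setT r.
  apply: measurable_funM; first exact: meas_normc.
  apply: measurableT_comp => //; apply: measurable_funN.
  by apply: measurable_funM => //; exact: measurable_cst.
have ms : measurable_fun setT s.
  apply: measurableT_comp => //; apply: measurable_funB; last first.
    by apply: measurable_funM => //; exact: measurable_cst.
  apply: measurable_funM; last exact: measurable_cst.
  by apply: measurable_funD; [exact: measurable_cst|exact: measurable_normc2].
have r2 w : r w ^+ 2 = wt z w.
  by rewrite /r /wt exprMn; congr (_ * _); rewrite expr2 -expRD; congr expR; lra.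
have s2 w : s w ^+ 2 = expR (normc z ^+ 2) * expR (normc w ^+ 2 - normc (z - w) ^+ 2 / 4).
  by rewrite /s expr2 -!expRD; congr expR; lra.
have is2 : mu.-integrable setT (fun w => (s w ^+ 2)%:E).
  apply: (@mu_integrable_growth _ _ (expR (normc z ^+ 2 * 2)) (7 / 8)); first by lra.
    exact: measurable_funX.
  move=> w; rewrite ger0_norm ?sqr_ge0 // s2 -!expRD ler_expR.
  have : 0 <= normc (z + z - w) ^+ 2 by exact: sqr_ge0.
  by have := sqr_ge0 (normc z); rewrite !normc2 !reim; lra.
have ir2 : mu.-integrable setT (fun w => (r w ^+ 2)%:E).
  by have := iwt z; congr (integrable _ _ _); apply/funext => w; rewrite r2.
have CS := Rintegral_CS mr ms ir2 is2.
have E1 : fine (absop z) = \int[mu]_w `|r w * s w|.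
  rewrite /absop; congr fine; apply: eq_integral => w _; congr EFin.
  rewrite ger0_norm; last by rewrite !mulr_ge0 ?normc_ge0 ?expR_ge0.
  by rewrite -mulrA -expRD; congr (_ * expR _); lra.
have E2 : \int[mu]_w (s w ^+ 2) = expR (normc z ^+ 2) * (gmass / pi).
  rewrite mu_Rintegral; last exact: measurable_funX.
  rewrite /Rintegral.
  under eq_integral.
    move=> w _; rewrite s2 /gauss_density.
    rewrite (_ : _ * _ * _ = (expR (normc z ^+ 2) / pi) * expR (- (normc (z - w) ^+ 2 / 4))); last first.
      have <- : expR (normc w ^+ 2 - normc (z - w) ^+ 2 / 4) * expR (- normc w ^+ 2) =
          expR (- (normc (z - w) ^+ 2 / 4)) by rewrite -expRD; congr expR; ring.
      ring.
    rewrite EFinM normc_distC; over.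
  rewrite ge0_integralZl //=.
  - by rewrite gmass_shift /= mulrAC mulrA.
  - apply/measurable_EFinP; apply: measurableT_comp => //; apply: measurable_funN.
    under eq_fun do rewrite normc_distC.
    by apply: measurable_funM => //; exact: measurable_cst.
  - by rewrite lee_fin divr_ge0 ?expR_ge0 ?pi_ge0.
have E3 : \int[mu]_w (r w ^+ 2) = \int[mu]_w wt z w by apply: eq_Rintegral => w _; rewrite r2.
rewrite E1 -E2 -E3 mulrC.
have R0 (t : R[i] -> R) : 0 <= \int[mu]_w (t w ^+ 2) by apply: Rintegral_ge0 => w _; exact: sqr_ge0.
rewrite -[X in _ <= X * _]sqr_sqrtr // -[X in _ <= _ * X]sqr_sqrtr // -exprMn.
by rewrite lerXn2r ?nnegrE ?mulr_ge0 ?sqrtr_ge0 // Rintegral_ge0.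
Qed.

(** Young's inequality, by Cauchy-Schwarz against the Gaussian weight and
   integration of the translates of that weight. *)
Lemma absop_L2 : mu.-integrable setT (fun z => (fine (absop z) ^+ 2)%:E) /\
  \int[mu]_z (fine (absop z) ^+ 2) <= (gmass / pi) ^+ 2 * nrm u ^+ 2.
Proof.
have gp0 : 0 <= gmass / pi by rewrite divr_ge0 ?gmass_ge0 ?pi_ge0.
have mf : measurable_fun setT (fun z => fine (absop z)).
  exact: measurableT_comp measurable_absop.
have mI : measurable_fun setT (fun z => (\int[mu]_w (wt z w)%:E)%E).
  by apply: (measurable_fun_fubini_tonelli_F (m2 := @mu R) _ mwt2) => p; rewrite lee_fin.
have main : (\int[mu]_z (fine (absop z) ^+ 2)%:E <= ((gmass / pi) ^+ 2 * nrm u ^+ 2)%:E)%E.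
  rewrite ge0_mu; last 2 first.
  - by apply/measurable_EFinP; exact: measurable_funX.
  - by move=> z; rewrite lee_fin sqr_ge0.
  apply: (@le_trans _ _ (\int[area]_z ((gmass / pi ^+ 2)%:E * \int[mu]_w (wt z w)%:E))%E).
    apply: ge0_le_integral => //.
    - by move=> z _; rewrite mule_ge0 ?lee_fin ?sqr_ge0 ?dens_ge0.
    - apply: emeasurable_funM measurable_Edens; apply/measurable_EFinP; exact: measurable_funX.
    - by apply: emeasurable_funM => //; exact: measurable_cst.
    - move=> z _; have fI : (\int[mu]_w (wt z w)%:E)%E \is a fin_num by exact: integrable_fin_num.
      rewrite -(fineK fI) -EFinM -EFinM lee_fin.
      apply: (le_trans (ler_wpM2r (dens_ge0 z) (absop_sq z))).
      rewrite le_eqVlt; apply/orP; left; apply/eqP.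
      rewrite /gauss_density; have := expRxMexpNx_1 (normc z ^+ 2) => E.
      rewrite -/(Rintegral mu setT (wt z)).
      transitivity ((expR (normc z ^+ 2) * expR (- normc z ^+ 2)) *
         (gmass / pi ^+ 2 * (\int[mu]_w wt z w))); last by rewrite E mul1r.
      have pn : (pi : R) != 0 by rewrite gt_eqF // pi_gt0.
      by move: (pi : R) (\int[mu]_w wt z w) pn => p I pn; field.
  rewrite ge0_integralZl //; last 2 first.
  - by move=> z _; apply: integral_ge0 => w _; rewrite lee_fin.
  - by rewrite lee_fin divr_ge0 ?gmass_ge0 ?sqr_ge0.
  rewrite (fubini_tonelli (m1 := area) (m2 := @mu R) (fun p => (wt p.1 p.2)%:E) mwt2) /=; last first.
    by move=> p; rewrite lee_fin.
  have E : (\int[mu]_w \int[area]_z (wt z w)%:E = gmass%:E * (nrm u ^+ 2)%:E)%E.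
    rewrite (nrm_sqrE Lu) -ge0_integralZl //; last 3 first.
    - apply/measurable_EFinP; apply: measurable_funX; exact: meas_normc.
    - by move=> w _; rewrite lee_fin sqr_ge0.
    - by rewrite lee_fin gmass_ge0.
    apply: eq_integral => w _; rewrite /wt.
    under eq_integral do rewrite EFinM.
    rewrite ge0_integralZl //.
    - by rewrite gmass_shift muleC.
    - apply/measurable_EFinP; apply: measurableT_comp => //; apply: measurable_funN.
      apply: measurable_funM; last exact: measurable_cst.
      apply: measurable_funX; apply: meas_normc; apply: measC_B; last exact: measurable_cst.
      exact: measurable_id.
    - by rewrite lee_fin sqr_ge0.
  rewrite E -!EFinM lee_fin le_eqVlt; apply/orP; left; apply/eqP.
  have pn : (pi : R) != 0 by rewrite gt_eqF // pi_gt0.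
  by move: (pi : R) pn => p pn; field.
have i2 : mu.-integrable setT (fun z => (fine (absop z) ^+ 2)%:E).
  apply/integrableP; split; first by apply/measurable_EFinP; exact: measurable_funX.
  under eq_integral do rewrite gee0_abs ?lee_fin ?sqr_ge0 //.
  by apply: le_lt_trans main _; rewrite ltry.
split => //; rewrite -lee_fin; apply: le_trans main.
by rewrite /Rintegral fineK // integrable_fin_num.
Qed.

End Young.

Lemma normc_tc_kernel M phi u z w : tame M phi ->
  normc (u w * tck phi z w) <= M * (normc (u w) * gker z w).
Proof. by move=> H; rewrite normcM mulrCA ler_wpM2l ?normc_ge0 // tck_le. Qed.

Lemma tc_cintegrable M phi u z : tame M phi -> L2 u ->
  cintegrable mu setT (fun w => u w * tck phi z w).
Proof. by move=> H Lu; apply: L2M_cint => //; exact: tck_L2 H. Qed.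

Lemma normc_tc_le M phi u z : tame M phi -> L2 u -> normc (tc phi u z) <= M * fine (absop u z).
Proof.
move=> H Lu; have [mu_ _] := Lu.
have mk : measurable_fun setT (fun w => u w * tck phi z w).
  by apply: measC_M => //; apply: measurable_tck; case: H.
apply: (le_trans (normc_cint measurableT mk (tc_cintegrable z H Lu))).
have ig : mu.-integrable setT (fun w => (normc (u w) * gker z w)%:E).
  by apply: integrable_sqM; [exact: meas_normc|exact: measurable_gker|case: Lu|exact: gker_L2].
rewrite -[fine _]/(\int[mu]_w (normc (u w) * gker z w)) -RintegralZl //.
apply: le_Rintegral => //.
- exact: cintegrable_normc (tc_cintegrable z H Lu).
- exact: (integrableZl measurableT M ig).
- by move=> w _; exact: normc_tc_kernel.
Qed.

(** A pointwise bound on [tc phi u], uniform in [u]. *)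
Lemma normc_tc_pt M phi u z : tame M phi -> L2 u ->
  normc (tc phi u z) <= nrm u * nrm (tck phi z).
Proof. by move=> H Lu; apply: normc_int_mul => //; exact: tck_L2 H. Qed.

Section Operator.
Variables (M : R) (phi : R[i] -> R[i]).
Hypothesis H : tame M phi.

Let mF u : L2 u -> measurable_fun setT (fun p : R[i] * R[i] => u p.2 * tck phi p.1 p.2).
Proof.
move=> [mu_ _]; apply: measC_M; last by apply: measurable_tck2; case: H.
exact: measurableT_comp mu_ measurable_snd.
Qed.

Lemma measurable_tc u : L2 u -> measurable_fun setT (tc phi u).
Proof.
move=> Lu; have mFu := mF Lu; have [iA _] := absop_L2 Lu.
have iF : ((@mu R) \x (@mu R))%E.-integrable setT
    (fun p => (normc (u p.2 * tck phi p.1 p.2))%:E).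
  apply/integrable12ltyP; first by apply/measurable_EFinP; exact: meas_normc.
  apply: (@le_lt_trans _ _ (\int[mu]_z ((M * fine (absop u z))%:E))%E); last first.
    have iA1 : mu.-integrable setT (fun z => (fine (absop u z))%:E).
      have mA : measurable_fun setT (fun z => fine (absop u z)).
        by apply: measurableT_comp => //; exact: measurable_absop.
      have i1 : mu.-integrable setT (fun z => (1 ^+ 2)%:E) by exact: mu_integrable_cst.
      have := @integrable_sqM _ _ _ mu _ _ mA (measurable_cst (1 : R)) iA i1.
      by congr (integrable _ _ _); apply/funext => z; rewrite mulr1.
    have /integrableP[_] := integrableZl measurableT M iA1.
    apply: le_lt_trans; apply: ge0_le_integral => //.
    - move=> z _; rewrite lee_fin mulr_ge0 ?(tame_ge0 H) // fine_ge0 //; exact: absop_ge0.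
    - apply/measurable_EFinP; apply: measurable_funM; first exact: measurable_cst.
      by apply: measurableT_comp => //; exact: measurable_absop.
    - apply: measurableT_comp => //; apply/measurable_EFinP; apply: measurable_funM.
        exact: measurable_cst.
      by apply: measurableT_comp => //; exact: measurable_absop.
    - by move=> z _; rewrite -EFinM /= lee_fin ler_norm.
  apply: ge0_le_integral => //.
  - by move=> z _; apply: integral_ge0.
  - apply: (measurable_fun_fubini_tonelli_F (m2 := @mu R) (fun p => `|(normc (u p.2 * tck phi p.1 p.2))%:E|%E)) => //.
    by apply: measurableT_comp => //; apply/measurable_EFinP; exact: meas_normc.
  - apply/measurable_EFinP; apply: measurable_funM; first exact: measurable_cst.
    by apply: measurableT_comp => //; exact: measurable_absop.
  - move=> z _; rewrite EFinM fineK; last exact: absop_fin.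
    rewrite -ge0_integralZl //; last 3 first.
    + apply/measurable_EFinP; apply: measurable_funM; last exact: measurable_gker.
      by apply: meas_normc; case: Lu.
    + by move=> w _; rewrite lee_fin mulr_ge0 ?normc_ge0 ?expR_ge0.
    + by rewrite lee_fin (tame_ge0 H).
    apply: ge0_le_integral => //.
    + apply: measurableT_comp => //; apply/measurable_EFinP; apply: meas_normc.
      exact: (measurable_fun_pair2 z mFu).
    + apply: emeasurable_funM; first exact: measurable_cst.
      apply/measurable_EFinP; apply: measurable_funM; last exact: measurable_gker.
      by apply: meas_normc; case: Lu.
    + move=> w _; rewrite -EFinM /= lee_fin ger0_norm ?normc_ge0 //; exact: normc_tc_kernel.
have [i1 i2] := cintegrable_le measurableT mFu (fun x _ => lexx _) iF.
apply/measurable_ReP; split; rewrite /tc /cint /=.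
- have h := measurable_fubini_F (m1 := @mu R) (m2 := @mu R) i1.
  exact: (measurableT_comp (@fine_measurable R setT measurableT) h).
- have h := measurable_fubini_F (m1 := @mu R) (m2 := @mu R) i2.
  exact: (measurableT_comp (@fine_measurable R setT measurableT) h).
Qed.

Lemma tc_L2 u : L2 u -> L2 (tc phi u) /\ nrm (tc phi u) <= M * (gmass / pi) * nrm u.
Proof.
move=> Lu; have M0 := tame_ge0 H; have mt := measurable_tc Lu.
have [iA leA] := absop_L2 Lu.
have le z : normc (tc phi u z) ^+ 2 <= M ^+ 2 * fine (absop u z) ^+ 2.
  rewrite -exprMn lerXn2r ?nnegrE ?normc_ge0 ?mulr_ge0 ?fine_ge0 ?absop_ge0 //.
  exact: normc_tc_le.
have iMA : mu.-integrable setT (fun z => (M ^+ 2 * fine (absop u z) ^+ 2)%:E).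
  exact: (integrableZl measurableT (M ^+ 2) iA).
have it : mu.-integrable setT (fun z => (normc (tc phi u z) ^+ 2)%:E).
  apply: (@le_integrableE _ _ _ mu setT (fun z => normc (tc phi u z) ^+ 2) _ measurableT _ _ iMA).
    by apply: measurable_funX; exact: meas_normc.
  by move=> z _; rewrite ger0_norm ?sqr_ge0.
split => //.
have c0 : 0 <= M * (gmass / pi) * nrm u.
  by rewrite !mulr_ge0 ?nrm_ge0 ?gmass_ge0 ?invr_ge0 ?pi_ge0.
rewrite -(ler_pXn2r (n := 2)) ?nnegrE ?nrm_ge0 // nrm_sqr.
apply: (@le_trans _ _ (\int[mu]_z (M ^+ 2 * fine (absop u z) ^+ 2))); first exact: le_Rintegral.
rewrite RintegralZl // !exprMn -mulrA ler_wpM2l ?sqr_ge0 //.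
by move: leA; rewrite !exprMn.
Qed.

Lemma tc_lin a b u v z : L2 u -> L2 v ->
  tc phi (fun w => a * u w + b * v w) z = a * tc phi u z + b * tc phi v z.
Proof.
move=> Lu Lv; rewrite /tc -!cintZ //; try exact: (tc_cintegrable z H).
rewrite -cintD //; last 2 first.
- by apply: cintegrableZ => //; exact: (tc_cintegrable z H).
- by apply: cintegrableZ => //; exact: (tc_cintegrable z H).
by apply: eq_cint => w _; rewrite mulrDl !mulrA.
Qed.

(** Moves the operator to the other factor; adjoints and compositions of the [tc phi]
   are computed from it. *)
Lemma tc_Fubini u v : L2 u -> L2 v ->
  cint mu setT (fun z => tc phi u z * v z) =
  cint mu setT (fun w => u w * cint mu setT (fun z => tck phi z w * v z)).
Proof.
move=> Lu Lv; have [mv iv] := Lv; have mFu := mF Lu.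
have mFF : measurable_fun setT (fun p : R[i] * R[i] => u p.2 * tck phi p.1 p.2 * v p.1).
  by apply: measC_M => //; exact: measurableT_comp mv measurable_fst.
transitivity (cint mu setT (fun z => cint mu setT (fun w => u w * tck phi z w * v z))).
  apply: eq_cint => z _; rewrite mulrC /tc -cintZ //; last exact: (tc_cintegrable z H).
  by apply: eq_cint => w _; rewrite mulrC.
rewrite (@cint_Fubini _ _ _ _ _ (@mu R) (@mu R) (fun p => u p.2 * tck phi p.1 p.2 * v p.1)) //.
- apply: eq_cint => w _ /=; rewrite -cintZ //; last first.
    by apply: L2M_cint => //; exact: tck_L2' H.
  by apply: eq_cint => z _; rewrite mulrA.
- have [iA _] := absop_L2 Lu.
  have mA : measurable_fun setT (fun z => fine (absop u z)).
    by apply: measurableT_comp => //; exact: measurable_absop.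
  have iAv := integrable_sqM mA (meas_normc mv) iA iv.
  have iMAv := integrableZl measurableT M iAv.
  apply: (@le_lt_trans _ _ (\int[mu]_z (M%:E * (fine (absop u z) * normc (v z))%:E))%E); last first.
    have /integrableP[_] := iMAv.
    apply: le_lt_trans; apply: ge0_le_integral => //.
    - move=> z _; rewrite -EFinM lee_fin !mulr_ge0 ?normc_ge0 ?(tame_ge0 H) // fine_ge0 //; exact: absop_ge0.
    - by case/integrableP : iMAv.
    - by apply: measurableT_comp => //; case/integrableP : iMAv.
    - by move=> z _; rewrite -EFinM /= lee_fin ler_norm.
  apply: ge0_le_integral => //.
  - by move=> z _; apply: integral_ge0 => w _; rewrite lee_fin normc_ge0.
  - apply: (measurable_fun_fubini_tonelli_F (m2 := @mu R)
      (fun p => (normc (u p.2 * tck phi p.1 p.2 * v p.1))%:E)) => //.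
      by apply/measurable_EFinP; exact: meas_normc.
    by move=> p; rewrite lee_fin normc_ge0.
  - by case/integrableP : iMAv.
  - move=> z _; rewrite EFinM muleA -EFinM.
    rewrite [((M * _) * _)%:E]EFinM [(M * _)%:E]EFinM fineK; last exact: absop_fin.
    rewrite -ge0_integralZl //; last 3 first.
    + apply/measurable_EFinP; apply: measurable_funM; last exact: measurable_gker.
      by apply: meas_normc; case: Lu.
    + by move=> w _; rewrite lee_fin mulr_ge0 ?normc_ge0 ?expR_ge0.
    + by rewrite lee_fin (tame_ge0 H).
    have mug : measurable_fun setT (fun w => (M%:E * (normc (u w) * gker z w)%:E)%E).
      apply: emeasurable_funM; first exact: measurable_cst.
      apply/measurable_EFinP; apply: measurable_funM; last exact: measurable_gker.
      by apply: meas_normc; case: Lu.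
    rewrite -ge0_integralZr //; last 2 first.
    + by move=> w _; rewrite -EFinM lee_fin !mulr_ge0 ?normc_ge0 ?expR_ge0 ?(tame_ge0 H).
    + by rewrite lee_fin normc_ge0.
    apply: ge0_le_integral => //.
    + by move=> w _; rewrite lee_fin normc_ge0.
    + apply/measurable_EFinP; apply: meas_normc.
      exact: (measurable_fun_pair2 z mFF).
    + by apply: emeasurable_funM => //; exact: measurable_cst.
    + move=> w _; rewrite -!EFinM lee_fin normcM ler_wpM2r ?normc_ge0 //; exact: normc_tc_kernel.
- move=> z; apply: (@eq_cintegrable _ _ _ mu setT (fun w => v z * (u w * tck phi z w))) => //.
    by move=> w _ /=; rewrite mulrC.
  by apply: cintegrableZ => //; exact: (tc_cintegrable z H).
- move=> w; apply: (@eq_cintegrable _ _ _ mu setT (fun z => u w * (tck phi z w * v z))) => //.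
    by move=> z _ /=; rewrite mulrA.
  by apply: cintegrableZ => //; apply: L2M_cint => //; exact: tck_L2' H.
Qed.

End Operator.

End TwistedConvolution.

(** * Integrals of entire functions over rectangles and circles *)

Section Goursat.
Context {R : realType}.
Local Notation lam := (@lebesgue_measure R).
Implicit Types (H K : R[i] -> R[i]) (f : R -> R[i]).

Definition lcont f := continuous (fun x => complex.Re (f x)) /\ continuous (fun x => complex.Im (f x)).

(** Used for paths along which [H] is restricted to a line or a circle. *)
Lemma lcont_line H (p : R -> R[i]) : (forall z, ccont H z) ->
  (forall x y : R, normc (p x - p y) <= `|x - y|) -> lcont (fun x => H (p x)).
Proof.
move=> cH pl.
have C (q : R[i] -> R) : (forall z w, q (z - w) = q z - q w) -> (forall z, `|q z| <= normc z) ->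
    continuous (fun x => q (H (p x))).
  move=> qB qn x; apply/cvgrPdist_lt => e e0.
  have [d d0 D] := cH (p x) _ e0.
  apply/nbhs_ballP; exists d => //= y; rewrite /ball /= => xy.
  rewrite distrC -qB (le_lt_trans (qn _)) //.
  have -> : p y = p x + (p y - p x) by ring.
  by apply: D; rewrite (le_lt_trans (pl _ _)) // distrC.
split; apply: C; [|exact: normc_Re| |exact: normc_Im] => z w.
  by rewrite cReD cReN.
by rewrite cImD cImN.
Qed.

Lemma lcont_meas f : lcont f -> measurable_fun setT f.
Proof.
by move=> [f1 f2]; apply/measurable_ReP; split; exact: continuous_measurable_fun.
Qed.

Lemma lcont_int f (a b : R) : lcont f -> cintegrable lam `[a, b] f.
Proof.
by move=> [f1 f2]; split; apply: continuous_compact_integrable;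
  [exact: segment_compact|exact: continuous_subspaceT|
   exact: segment_compact|exact: continuous_subspaceT].
Qed.

Lemma cint_cst_itv (a b : R) (c : R[i]) : a <= b ->
  cint lam `[a, b] (fun=> c) = (b - a)%:C * c.
Proof.
move=> ab; have mab : measurable (`[a, b]%classic : set (measurableTypeR R)) by [].
have E : fine (lam `[a, b]%classic) = b - a.
  rewrite lebesgue_measure_itv /= lte_fin; case: ltP => // ba.
  by rewrite (@le_anti _ _ a b) ?subrr // ab.
by apply: complexP; rewrite !reim /= Rintegral_cst // E; ring.
Qed.

Lemma normc_cint_itv f (a b M : R) : a <= b -> lcont f ->
  (forall x, a <= x <= b -> normc (f x) <= M) ->
  normc (cint lam `[a, b] f) <= M * (b - a).
Proof.
move=> ab cf H.
have mab : measurable (`[a, b]%classic : set (measurableTypeR R)) by [].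
have E : fine (lam `[a, b]%classic) = b - a.
  rewrite lebesgue_measure_itv /= lte_fin; case: ltP => // ba.
  by rewrite (@le_anti _ _ a b) ?subrr // ab.
have I : lam.-integrable `[a, b] (EFin \o (fun=> M : R)).
  apply: (continuous_compact_integrable (segment_compact (a := a) (b := b))).
  by apply: continuous_subspaceT => x; exact: cvg_cst.
have B x : `[a, b]%classic x -> normc (f x) <= M.
  by rewrite /= in_itv /=; exact: H.
rewrite -E -Rintegral_cst //.
exact: (normc_cint_le mab (lcont_meas cf) B I).
Qed.

Lemma cint_itv_split f (a m b : R) : a <= m -> m <= b -> lcont f ->
  cint lam `[a, b] f = cint lam `[a, m] f + cint lam `[m, b] f.
Proof.
move=> am mb cf.
have [i1 i2] := lcont_int a b cf.
have K (g : R -> R) : lam.-integrable `[a, b] (EFin \o g) ->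
    \int[lam]_(x in `[a, b]) g x = \int[lam]_(x in `[a, m]) g x + \int[lam]_(x in `[m, b]) g x.
  move=> ig; have := @Rintegral_itvB R g (BLeft a) (BRight b) m ig.
  rewrite !bnd_simp => /(_ am mb) E.
  have E2 : \int[lam]_(x in `]m, b]) g x = \int[lam]_(x in `[m, b]) g x.
    apply: Rintegral_itv_obnd_cbnd; apply: (integrableS _ _ _ ig) => //.
    by apply: subset_itvr; rewrite bnd_simp.
  by rewrite -E2 -E addrC subrK.
by apply: complexP; rewrite reim; [exact: (K _ i1)|exact: (K _ i2)].
Qed.

Definition hint H (a b y : R) := cint lam `[a, b] (fun x => H (x +i* y)).
Definition vint H (x c d : R) := cint lam `[c, d] (fun y => H (x +i* y)).

(** The contour integral of [H] around the rectangle [a, b] x [c, d], counterclockwise. *)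
Definition rint H (a b c d : R) :=
  (hint H a b c - hint H a b d) + 'i%C * (vint H b c d - vint H a c d).

Lemma hcont H y : (forall z, ccont H z) -> lcont (fun x => H (x +i* y)).
Proof.
move=> cH; apply: lcont_line => // a b.
rewrite (_ : _ - _ = (a - b)%:C); first by rewrite normcR.
by apply: complexP => //=; rewrite subrr.
Qed.

Lemma vcont H x : (forall z, ccont H z) -> lcont (fun y => H (x +i* y)).
Proof.
move=> cH; apply: lcont_line => // a b.
rewrite (_ : _ - _ = 'i%C * (a - b)%:C); first by rewrite normcM normc_i mul1r normcR.
by apply: complexP; rewrite !reim /=; ring.
Qed.

Lemma rint_split1 H a m b c d : (forall z, ccont H z) -> a <= m -> m <= b ->
  rint H a b c d = rint H a m c d + rint H m b c d.
Proof.
move=> cH am mb; rewrite /rint /hint.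
by rewrite !(cint_itv_split am mb (hcont _ cH)); ring.
Qed.

Lemma rint_split2 H a b c m d : (forall z, ccont H z) -> c <= m -> m <= d ->
  rint H a b c d = rint H a b c m + rint H a b m d.
Proof.
move=> cH cm md; rewrite /rint /vint.
by rewrite !(cint_itv_split cm md (vcont _ cH)); ring.
Qed.

Lemma rintB H K a b c d : (forall z, ccont H z) -> (forall z, ccont K z) ->
  rint (fun z => H z - K z) a b c d = rint H a b c d - rint K a b c d.
Proof.
move=> cH cK; rewrite /rint /hint /vint.
rewrite !cintB //; try exact: lcont_int (hcont _ _); try exact: lcont_int (vcont _ _).
ring.
Qed.

Lemma rint_affine (p q : R[i]) a b c d : a <= b -> c <= d ->
  rint (fun z => p + q * z) a b c d = 0.
Proof.
move=> ab cd.
have cA z : ccont (fun z => p + q * z) z.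
  by apply: ccontD; [exact: cder_ccont (cder_cst _ _)|apply: ccontM;
    [exact: cder_ccont (cder_cst _ _)|exact: cder_ccont (cder_id _)]].
rewrite /rint /hint /vint -!cintB //; try exact: lcont_int (hcont _ cA); try exact: lcont_int (vcont _ cA).
rewrite (@eq_cint _ _ _ lam _ _ (fun=> q * ('i%C * (c - d)%:C))); last first.
  move=> x _; rewrite (_ : _ - _ = q * ((x +i* c) - (x +i* d))); last by ring.
  by congr (_ * _); apply: complexP; rewrite !reim /=; ring.
rewrite (@eq_cint _ _ _ lam `[c, d] _ (fun=> q * (b - a)%:C)); last first.
  move=> y _; rewrite (_ : _ - _ = q * ((b +i* y) - (a +i* y))); last by ring.
  by congr (_ * _); apply: complexP; rewrite !reim /=; ring.
rewrite !cint_cst_itv //.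
have -> : (c - d)%:C = - ((d - c)%:C) :> R[i] by rewrite -rmorphN opprB.
ring.
Qed.

Lemma normc_rint H a b c d M : (forall z, ccont H z) -> a <= b -> c <= d ->
  (forall x y, a <= x <= b -> c <= y <= d -> normc (H (x +i* y)) <= M) ->
  normc (rint H a b c d) <= M * (b - a) *+ 2 + M * (d - c) *+ 2.
Proof.
move=> cH ab cd HM.
have h1 y : c <= y <= d -> normc (hint H a b y) <= M * (b - a).
  by move=> yc; apply: normc_cint_itv => // [|x xa]; [exact: hcont|exact: HM].
have h2 x : a <= x <= b -> normc (vint H x c d) <= M * (d - c).
  by move=> xa; apply: normc_cint_itv => // [|y yc]; [exact: vcont|exact: HM].
rewrite (le_trans (normcD _ _)) // normcM normc_i mul1r lerD //.
  by rewrite (le_trans (normcB _ _)) // mulr2n lerD // h1 ?lexx ?cd.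
by rewrite (le_trans (normcB _ _)) // mulr2n lerD // h2 ?lexx ?ab.
Qed.

Lemma rint_quarters H x y w h : (forall z, ccont H z) -> 0 <= w -> 0 <= h ->
  rint H x (x + (w + w)) y (y + (h + h)) =
  rint H x (x + w) y (y + h) + rint H x (x + w) (y + h) (y + h + h) +
  (rint H (x + w) (x + w + w) y (y + h) + rint H (x + w) (x + w + w) (y + h) (y + h + h)).
Proof.
move=> cH w0 h0; rewrite !(addrA x) !(addrA y).
rewrite (@rint_split1 H x (x + w)) ?lerDl //.
by congr (_ + _); rewrite -rint_split2 ?lerDl.
Qed.

(** One of four numbers is at least a quarter of their sum in modulus. *)
Lemma large_quarter H x y w h : (forall z, ccont H z) -> 0 <= w -> 0 <= h ->
  exists q : R * R,
    [/\ normc (rint H x (x + (w + w)) y (y + (h + h))) / 4 <=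
          normc (rint H q.1 (q.1 + w) q.2 (q.2 + h)),
        x <= q.1, q.1 + w <= x + (w + w), y <= q.2 & q.2 + h <= y + (h + h)].
Proof.
move=> cH w0 h0; rewrite rint_quarters //.
have [q1 E1] : exists q, q = rint H x (x + w) y (y + h) by eexists.
have [q2 E2] : exists q, q = rint H x (x + w) (y + h) (y + h + h) by eexists.
have [q3 E3] : exists q, q = rint H (x + w) (x + w + w) y (y + h) by eexists.
have [q4 E4] : exists q, q = rint H (x + w) (x + w + w) (y + h) (y + h + h) by eexists.
rewrite -E1 -E2 -E3 -E4.
have N : normc (q1 + q2 + (q3 + q4)) <= normc q1 + normc q2 + (normc q3 + normc q4).
  by rewrite (le_trans (normcD _ _)) // lerD // normcD.
have [c1|c1] := leP (normc (q1 + q2 + (q3 + q4)) / 4) (normc q1).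
  by exists (x, y); split; cbn [fst snd]; [rewrite -E1|lra..].
have [c2|c2] := leP (normc (q1 + q2 + (q3 + q4)) / 4) (normc q2).
  by exists (x, y + h); split; cbn [fst snd]; [rewrite -E2|lra..].
have [c3|c3] := leP (normc (q1 + q2 + (q3 + q4)) / 4) (normc q3).
  by exists (x + w, y); split; cbn [fst snd]; [rewrite -E3|lra..].
by exists (x + w, y + h); split; cbn [fst snd]; [rewrite -E4; lra|lra..].
Qed.

(** Goursat: quadrisect, follow the largest quarter down to a point, and compare
   [H] with its affine approximation there. *)
Lemma goursat H a b c d : holo H -> a <= b -> c <= d ->
  rint H a b c d = 0.
Proof.
move=> dH ab cd.
have cH z : ccont H z by have [l /cder_ccont] := dH z.
(* At stage [n] the rectangle has sides [w n] and [h n] and lower left corner [s n]. *)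
pose w n := (b - a) / 2 ^+ n; pose h n := (d - c) / 2 ^+ n.
have w0 n : 0 <= w n by rewrite divr_ge0 ?subr_ge0 // exprn_ge0.
have h0 n : 0 <= h n by rewrite divr_ge0 ?subr_ge0 // exprn_ge0.
have wS n : w n = w n.+1 + w n.+1 by rewrite /w exprS; field; rewrite expf_neq0.
have hS n : h n = h n.+1 + h n.+1 by rewrite /h exprS; field; rewrite expf_neq0.
pose Q n (p : R * R) := rint H p.1 (p.1 + w n) p.2 (p.2 + h n).
have quarter n p : exists q : R * R, [/\ normc (Q n p) / 4 <= normc (Q n.+1 q),
    p.1 <= q.1, q.1 + w n.+1 <= p.1 + w n, p.2 <= q.2 & q.2 + h n.+1 <= p.2 + h n].
  by rewrite /Q (wS n) (hS n); exact: large_quarter.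
have [nxt Hn] := choice (fun np : nat * (R * R) => quarter np.1 np.2).
pose s := fix s n := if n is n'.+1 then nxt (n', s n') else (a, c).
have sS n := Hn (n, s n).
have sQ n : normc (rint H a b c d) / 4 ^+ n <= normc (Q n (s n)).
  elim: n => [|n IH].
    rewrite expr0 divr1 /Q /w /h !expr0 !divr1.
    change (normc (rint H a b c d) <= normc (rint H a (a + (b - a)) c (c + (d - c)))).
    by rewrite !(addrC _ (_ - _)) !subrK.
  have [+ _ _ _ _] := sS n; apply: le_trans.
  by rewrite exprSr invfM mulrA ler_wpM2r.
have mono n k : [/\ (s n).1 <= (s (n + k)%N).1, (s (n + k)%N).1 + w (n + k)%N <= (s n).1 + w n,
    (s n).2 <= (s (n + k)%N).2 & (s (n + k)%N).2 + h (n + k)%N <= (s n).2 + h n].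
  elim: k => [|k [i1 i2 i3 i4]]; first by rewrite addn0.
  rewrite addnS; have [_ j1 j2 j3 j4] := sS (n + k)%N.
  by split; [exact: le_trans i1 _|exact: le_trans j2 _|exact: le_trans i3 _|exact: le_trans j4 _].
have up1 n m : (s m).1 <= (s n).1 + w n.
  have [nm|/ltnW mn] := leqP n m.
    have [_ + _ _] := mono n (m - n)%N; rewrite subnKC //; apply: le_trans.
    by rewrite lerDl.
  have [+ _ _ _] := mono m (n - m)%N; rewrite subnKC // => /le_trans; apply.
  by rewrite lerDl.
have up2 n m : (s m).2 <= (s n).2 + h n.
  have [nm|/ltnW mn] := leqP n m.
    have [_ _ _ +] := mono n (m - n)%N; rewrite subnKC //; apply: le_trans.
    by rewrite lerDl.
  have [_ _ + _] := mono m (n - m)%N; rewrite subnKC // => /le_trans; apply.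
  by rewrite lerDl.
(* The lower left corners increase to a point common to all rectangles. *)
pose x := sup (range (fun n => (s n).1)); pose y := sup (range (fun n => (s n).2)).
have xn n : (s n).1 <= x <= (s n).1 + w n.
  apply/andP; split; last by apply: ge_sup => [|_ [m _ <-]]; [exists (s 0%N).1; exists 0%N|exact: up1].
  apply: ub_le_sup; last by exists n.
  by exists ((s 0%N).1 + w 0%N) => _ [m _ <-]; exact: up1.
have yn n : (s n).2 <= y <= (s n).2 + h n.
  apply/andP; split; last by apply: ge_sup => [|_ [m _ <-]]; [exists (s 0%N).2; exists 0%N|exact: up2].
  apply: ub_le_sup; last by exists n.
  by exists ((s 0%N).2 + h 0%N) => _ [m _ <-]; exact: up2.
have [l D] := dH (x +i* y).
pose L := (b - a) + (d - c).
have L0 : 0 <= L by rewrite addr_ge0 // subr_ge0.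
have wh n : w n + h n = L / 2 ^+ n by rewrite /w /h -mulrDl.
apply/eqP; rewrite -normc_eq0; apply/eqP/le_anti; rewrite normc_ge0 andbT.
apply/ler_addgt0Pl => e e0; rewrite addr0.
have L1 : 0 < 2 * (L ^+ 2 + 1) by rewrite mulr_gt0 // ltr_wpDl ?sqr_ge0.
have [dl dl0 Dl] := D _ (divr_gt0 e0 L1).
have [n nd] : exists n, L / 2 ^+ n < dl.
  exists (Num.truncn (L / dl)).+1; rewrite ltr_pdivrMr ?exprn_gt0 // mulrC -ltr_pdivrMr //.
  rewrite (lt_le_trans (truncnS_gt _)) //.
  by rewrite -natrX ler_nat ltnW // ltn_expl.
(* [H] differs from its affine approximation by [ee * (L / 2 ^ n)] on a rectangle of
   perimeter [2 * L / 2 ^ n]. *)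
have key : normc (Q n (s n)) <= e / 4 ^+ n.
  set ee := e / _ in Dl.
  pose A z := (H (x +i* y) - l * (x +i* y)) + l * z.
  have cA z : ccont A z.
    by apply: ccontD; [exact: cder_ccont (cder_cst _ _)|apply: ccontM;
      [exact: cder_ccont (cder_cst _ _)|exact: cder_ccont (cder_id _)]].
  have cHA z : ccont (fun z => H z - A z) z.
    by apply: ccontD => //; have := ccontM (cder_ccont (cder_cst (-1) z)) (cA z);
      rewrite (_ : (fun x => -1 * A x) = (fun x => - A x)) //; apply/funext => t; rewrite mulN1r.
  have -> : Q n (s n) = rint (fun z => H z - A z) (s n).1 ((s n).1 + w n) (s n).2 ((s n).2 + h n).
    by rewrite rintB // rint_affine ?lerDl // subr0.
  have := @normc_rint (fun z => H z - A z) (s n).1 ((s n).1 + w n) (s n).2 ((s n).2 + h n)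
    (ee * (L / 2 ^+ n)) cHA.
  rewrite !lerDl => /(_ (w0 n) (h0 n)); have ee0 : 0 <= ee by rewrite divr_ge0 // ltW.
  have nzn : (2 : R) ^+ n != 0 by rewrite expf_neq0.
  have small x' y' : (s n).1 <= x' <= (s n).1 + w n -> (s n).2 <= y' <= (s n).2 + h n ->
      normc ((x' +i* y') - (x +i* y)) <= L / 2 ^+ n.
    move=> /andP[x1 x2] /andP[y1 y2]; have /andP[x3 x4] := xn n; have /andP[y3 y4] := yn n.
    rewrite (le_trans (normc_le_ReIm _)) // !reim /= -wh.
    by rewrite lerD // ler_norml; apply/andP; split; clear -x1 x2 y1 y2 x3 x4 y3 y4; lra.
  move=> /(_ _)/le_trans; apply.
    move=> x' y' hx hy; have sm := small _ _ hx hy.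
    have := Dl ((x' +i* y') - (x +i* y)) (le_lt_trans sm nd).
    rewrite (_ : x +i* y + _ = x' +i* y'); last by ring.
    rewrite (_ : _ - _ - _ = H (x' +i* y') - A (x' +i* y')); last by rewrite /A; ring.
    by move/le_trans; apply; rewrite ler_wpM2l.
  have e1 : ee * (L ^+ 2 * 2) <= e.
    rewrite /ee mulrAC ler_pdivrMr // ler_wpM2l ?(ltW e0) //.
    by rewrite mulrC ler_wpM2l // lerDl.
  have e4 : 4 ^+ n = 2 ^+ n * 2 ^+ n :> R by rewrite -exprMn -natrM.
  have e2 (p q : R) : ee * (L / 2 ^+ n) * (p + w n - p) *+ 2 + ee * (L / 2 ^+ n) * (q + h n - q) *+ 2
     = ee * (L ^+ 2 * 2) / 4 ^+ n.
    rewrite -mulrnDl -mulrDr -(addrAC p) subrr add0r -(addrAC q) subrr add0r wh e4 -mulr_natr.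
    have F (t : R) : t != 0 -> ee * (L / t) * (L / t) *+ 2 = ee * (L ^+ 2 * 2) / (t * t).
      by move=> t0; clearbody L ee; rewrite mulr2n; field.
    by rewrite mulr_natr F.
  by rewrite e2 ler_wpM2r // invr_ge0 exprn_ge0.
have := le_trans (sQ n) key.
by rewrite ler_pM2r ?invr_gt0 ?exprn_gt0.
Qed.

End Goursat.

Section CircleAverage.
Context {R : realType}.
Local Notation lam := (@lebesgue_measure R).
Implicit Types (H K h : R[i] -> R[i]) (f : R -> R[i]).

(** Cauchy on the rectangle with vertical sides over a period: the horizontal
   sides cancel. *)
Lemma vint_period K (p a b : R) : holo K -> 0 <= p ->
  (forall z, K (z + (0 +i* p)) = K z) -> a <= b -> vint K a 0 p = vint K b 0 p.
Proof.
move=> dK p0 Kp ab; have := goursat dK ab p0; rewrite /rint.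
have -> : hint K a b 0 = hint K a b p.
  apply: eq_cint => x _; rewrite -Kp; congr K.
  by apply: complexP; rewrite !reim /= ?addr0 ?add0r.
rewrite subrr add0r => /eqP; rewrite mulf_eq0 -normc_eq0 normc_i oner_eq0 /= subr_eq0.
by move/eqP.
Qed.

(** This is [2 pi] times a Fourier coefficient of [h] on the circle through [z], the
   angle being measured from [z]. *)
Definition cavg j h z :=
  cint lam `[0, pi *+ 2] (fun y => cexp (- (j%:R * (0 +i* y))) * h (z * cexp (0 +i* y))).

Lemma lcont_circle (K : R[i] -> R[i]) s : (forall z, ccont K z) -> lcont (fun y => K (s + (0 +i* y))).
Proof.
move=> cK; apply: lcont_line => // a b.
rewrite (_ : _ - _ = 'i%C * (a - b)%:C); first by rewrite normcM normc_i mul1r normcR.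
by apply: complexP; rewrite !reim /=; ring.
Qed.

Lemma cexp_2pi : cexp (0 +i* (pi *+ 2)) = 1 :> R[i].
Proof. by rewrite /cexp /= expR0 cos2pi sin2pi mulr1 mulr0. Qed.

Lemma cexp_natmul n (z : R[i]) : cexp (n%:R * z) = cexp z ^+ n.
Proof.
elim: n => [|n IH]; first by rewrite mul0r cexp0.
by rewrite -natr1 mulrDl mul1r cexpD IH exprSr.
Qed.

Lemma cexpV (z : R[i]) : cexp (- z) = (cexp z)^-1.
Proof. by apply: (mulIf (cexp_neq0 z)); rewrite cexpN mulVf // cexp_neq0. Qed.

Lemma lcont_cavg j h (z : R[i]) : holo h ->
  lcont (fun y => cexp (- (j%:R * (0 +i* y))) * h (z * cexp (0 +i* y))).
Proof.
move=> dh.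
have d2 z1 : ccont (fun z2 => cexp (- (j%:R * z2)) * h (z * cexp z2)) z1.
  have [l dl] := dh (z * cexp z1).
  apply: cder_ccont; apply: cderM; last exact: cder_comp (cderZ _ (cder_cexp z1)) dl.
  apply: (cder_comp (f := fun z => - (j%:R * z))) (cder_cexp _).
  exact: cderN (cderZ _ (cder_id _)).
have [L1 L2] := lcont_circle 0 d2.
by split; [move: L1|move: L2]; under eq_fun do rewrite add0r.
Qed.

(** [vint_period] for the function [e^{- j s} h (z e^s)] of s, which has period [2 pi i]. *)
Lemma cavg_scale j h (t : R) z : holo h -> 0 < t ->
  cavg j h (t%:C * z) = t%:C ^+ j * cavg j h z.
Proof.
move=> dh t0; pose K w := cexp (- (j%:R * w)) * h (z * cexp w).
have dK w : exists l, cder K w l.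
  have [l dl] := dh (z * cexp w).
  eexists; apply: cderM; last exact: cder_comp (cderZ _ (cder_cexp w)) dl.
  apply: (cder_comp (f := fun z => - (j%:R * z))) (cder_cexp _).
  exact: cderN (cderZ _ (cder_id _)).
have Kp w : K (w + (0 +i* (pi *+ 2))) = K w.
  rewrite /K mulrDr opprD !cexpD cexp_2pi mulr1; congr (_ * _).
  rewrite -[RHS]mulr1; congr (_ * _).
  by rewrite cexpV cexp_natmul cexp_2pi expr1n invr1.
have p0 : 0 <= pi *+ 2 :> R by rewrite mulrn_wge0 // pi_ge0.
have vK s : vint K s 0 (pi *+ 2) = vint K 0 0 (pi *+ 2).
  have [|/ltW] := leP s 0 => s0; first exact: vint_period.
  by apply/esym; exact: vint_period.
have := vK (ln t); rewrite /vint.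
have -> : cint lam `[0, pi *+ 2] (fun y => K (0 +i* y)) = cavg j h z by [].
move=> <-; rewrite -cintZ //; last first.
  by apply: lcont_int; apply: vcont => w; have [l /cder_ccont] := dK w.
apply: eq_cint => y _; rewrite /K.
have -> : ln t +i* y = (ln t)%:C + (0 +i* y) by apply: complexP; rewrite !reim /= ?addr0 ?add0r.
rewrite cexpD mulrDr opprD cexpD [cexp (- (j%:R * (ln t)%:C))]cexpV cexp_natmul cexpR lnK ?posrE //.
have t1 : t%:C ^+ j != 0 :> R[i] by rewrite expf_neq0 // -normc_gt0 normcR normr_gt0 gt_eqF.
by rewrite !mulrA divff // mul1r [z * t%:C]mulrC.
Qed.

(** The averages over circles do not depend on the radius, which may tend to 0. *)
Lemma circle_mean h z : holo h -> cavg 0 h z = (pi *+ 2)%:C * h 0.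
Proof.
move=> dh.
have p0 : 0 < pi *+ 2 :> R by rewrite pmulrn_lgt0 // pi_gt0.
have ch w : ccont h w by have [l /cder_ccont] := dh w.
apply/eqP; rewrite -subr_eq0 -normc_eq0; apply/eqP/le_anti; rewrite normc_ge0 andbT.
apply/ler_addgt0Pl => e ep; rewrite addr0.
have [d dp D] := ch 0 _ (divr_gt0 ep p0).
have z1 : 0 < normc z + 1 by rewrite ltr_wpDl ?normc_ge0.
have t0 : 0 < d / (normc z + 1) by rewrite divr_gt0.
have := cavg_scale 0 z dh t0; rewrite expr0 mul1r => <-.
set z' := _ * z; have dz : normc z' < d.
  by rewrite normcM normcR gtr0_norm // mulrAC ltr_pdivrMr // ltr_pM2l // ltrDl.
have lc c : lcont (fun y => h (z' * cexp (0 +i* y)) - c).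
  have d2 z1' : ccont (fun z2 => h (z' * cexp z2) - c) z1'.
    have [l dl] := dh (z' * cexp z1'); apply: cder_ccont.
    exact: cderD (cder_comp (cderZ _ (cder_cexp z1')) dl) (cder_cst _ _).
  have [L1 L2] := lcont_circle 0 d2.
  by split; [move: L1|move: L2]; under eq_fun do rewrite add0r.
have -> : cavg 0 h z' = cint lam `[0, pi *+ 2] (fun y => h (z' * cexp (0 +i* y))).
  by apply: eq_cint => y _; rewrite mul0r oppr0 cexp0 mul1r.
rewrite -[X in X%:C]subr0 -cint_cst_itv; last exact: ltW.
have cst : lcont (fun=> h 0) by split => x; exact: cvg_cst.
have li := lcont_int 0 (pi *+ 2) cst.
have lc0 : lcont (fun y => h (z' * cexp (0 +i* y))).
  by have := lc 0; under eq_fun do rewrite subr0.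
rewrite -cintB //; try exact: lcont_int.
have -> : e = e / (pi *+ 2) * (pi *+ 2 - 0) by rewrite subr0 divfK // gt_eqF.
apply: normc_cint_itv; first exact: ltW.
  exact: lc.
move=> y _; apply: ltW; rewrite -{1}[_ * cexp _]add0r; apply: D.
by rewrite normcM normc_cexp /= expR0 mulr1.
Qed.
End CircleAverage.

(** * Means against radial weights *)

Section ContinuousC.
Context {R : realType}.
Local Notation lam := (@lebesgue_measure R).
Implicit Types (h : R[i] -> R[i]).

Lemma ler_dist_normc (z w : R[i]) : `|normc z - normc w| <= normc (z - w).
Proof.
rewrite ler_norml; apply/andP; split.
  by rewrite lerNl opprB lerBlDr normc_distC (le_trans _ (normcD _ _)) // subrK.
by rewrite lerBlDr (le_trans _ (normcD _ _)) // subrK.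
Qed.

(** An open set is a countable union of squares with rational data. *)
Lemma measurable_copen (U : set R[i]) :
  (forall z, U z -> exists2 d : R, 0 < d & forall w, normc (w - z) < d -> U w) ->
  measurable U.
Proof.
move=> oU.
pose B (p q r : rat) : set R[i] :=
  [set z | (ratr p - ratr r < complex.Re z < ratr p + ratr r)%R] `&`
  [set z | (ratr q - ratr r < complex.Im z < ratr q + ratr r)%R].
have mB p q r : measurable (B p q r).
  have mI (g : R[i] -> R) (a b : R) : measurable_fun setT g -> measurable [set z | a < g z < b].
    move=> mg; have := mg measurableT `]a, b[%classic (measurable_itv _); rewrite setTI.
    by congr measurable; apply/seteqP; split => z /=; rewrite in_itv.
  by apply: measurableI; apply: mI; [exact: measurable_Re|exact: measurable_Im].
pose B' p q r := if `[< B p q r `<=` U >] then B p q r else set0.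
have -> : U = \bigcup_p \bigcup_q \bigcup_r B' p q r.
  apply/seteqP; split => [z /oU[d d0 D]|z [p _ [q _ [r _]]]]; last first.
    by rewrite /B'; case: asboolP => [+ Bz|//]; apply.
  have d4 : 0 < d / 4 by rewrite divr_gt0.
  have [r] := rat_in_itvoo d4; rewrite in_itv /= => /andP[r0 r1].
  have rr x : x - ratr r < x + ratr r :> R by lra.
  have [p] := rat_in_itvoo (rr (complex.Re z)).
  rewrite in_itv /= => /andP[p0 p1].
  have [q] := rat_in_itvoo (rr (complex.Im z)).
  rewrite in_itv /= => /andP[q0 q1].
  exists p => //; exists q => //; exists r => //; rewrite /B'; case: asboolP => [_|[]].
    by split => /=; apply/andP; split; lra.
  move=> w [/= /andP[w1 w2] /andP[w3 w4]]; apply: D.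
  rewrite (le_lt_trans (normc_le_ReIm _)) // !reim.
  have : `|complex.Re w - complex.Re z| < d / 2 by rewrite ltr_norml; apply/andP; split; lra.
  have : `|complex.Im w - complex.Im z| < d / 2 by rewrite ltr_norml; apply/andP; split; lra.
  lra.
apply: bigcupT_measurable_rat => p; apply: bigcupT_measurable_rat => q.
by apply: bigcupT_measurable_rat => r; rewrite /B'; case: asboolP.
Qed.

Lemma measurable_ccont h : (forall z, ccont h z) -> measurable_fun setT h.
Proof.
move=> ch.
have K (g : R[i] -> R) : (forall z w, g (z - w) = g z - g w) -> (forall z, `|g z| <= normc z) ->
    measurable_fun setT (fun z => g (h z)).
  move=> gB gn; apply: (measurability _ (RGenOpens.measurableE R)).
  move=> _ [_ [a [b ->] <-]]; rewrite setTI; apply: measurable_copen => z /=.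
  rewrite in_itv /= => /andP[az zb].
  pose e := Num.min (g (h z) - a) (b - g (h z)).
  have e0 : 0 < e by rewrite lt_min !subr_gt0 az zb.
  have [d d0 D] := ch z e e0; exists d => // w /D.
  rewrite (addrC z) subrK => H; have := le_lt_trans (gn _) H.
  rewrite gB lt_min !ltr_norml in_itv /= => /andP[/andP[h1 h2] /andP[h3 h4]].
  by apply/andP; split; lra.
apply/measurable_ReP; split; apply: K => [z w|z]; rewrite ?reim //.
  exact: normc_Re.
exact: normc_Im.
Qed.

Lemma ccont_bounded h (S : R) : (forall z, ccont h z) ->
  exists2 M, 0 <= M & forall z, normc z <= S -> normc (h z) <= M.
Proof.
move=> ch; pose f (p : R * R) : R := normc (h (p.1 +i* p.2)).
have cf : continuous f.
  move=> [x y]; apply/cvgrPdist_lt => e e0.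
  have [d d0 D] := ch (x +i* y) e e0.
  have d2 : 0 < d / 2 by rewrite divr_gt0.
  exists (ball x (d / 2), ball y (d / 2)); first by split; exact: nbhsx_ballx.
  move=> -[x' y'] [/= b1 b2].
  rewrite /f /= distrC; have -> : x' +i* y' = x +i* y + (x' +i* y' - x +i* y) by ring.
  apply: le_lt_trans (ler_dist_normc _ _) _.
  apply: D; rewrite (le_lt_trans (normc_le_ReIm _)) // !reim /=.
  move: b1 b2; rewrite /ball /= distrC => b1; rewrite distrC => b2; lra.
have cK := compact_setX (segment_compact (a := - S) (b := S)) (segment_compact (a := - S) (b := S)).
have := @compact_bounded R _ _ (continuous_compact (continuous_subspaceT cf) cK).
move=> [M [_ HM]]; exists (`|M| + 1); first by rewrite addr_ge0.
move=> z zS; have := HM (`|M| + 1); rewrite (le_lt_trans (ler_norm M)) ?ltrDl // => /(_ erefl (normc (h z))).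
rewrite /= ger0_norm ?normc_ge0 //; apply.
exists (complex.Re z, complex.Im z); last by rewrite /f /=; case: z {zS}.
by split => /=; rewrite in_itv /= -ler_norml (le_trans _ zS) // ?normc_Re ?normc_Im.
Qed.

End ContinuousC.

Section RadialMoments.
Context {R : realType}.

Lemma mu_cintegrable_bounded (g : R[i] -> R[i]) B : measurable_fun setT g ->
  (forall z, normc (g z) <= B) -> cintegrable mu setT g.
Proof.
move=> mg gB; apply: (@mu_cintegrable_growth _ g B 0) => // z.
by rewrite mul0r expR0 mulr1.
Qed.

Lemma cint_indic d (T : measurableType d) (m : {measure set T -> \bar R}) (D : set T)
    (f : T -> R[i]) : measurable D ->
  cint m D f = cint m setT (fun x => (\1_D x)%:C * f x).
Proof.
move=> mD.
have K (g : T -> R) : (\int[m]_(x in D) g x = \int[m]_x (\1_D x * g x))%R.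
  congr fine; rewrite integral_mkcond; apply: eq_integral => x _.
  by rewrite patchE indicE; case: (_ \in _); rewrite ?mul1r ?mul0r.
apply: complexP; rewrite /cint /= K; apply: eq_Rintegral => x _;
  by rewrite !reim /= mul0r ?subr0 ?addr0.
Qed.
Local Notation lam := (@lebesgue_measure R).
Implicit Types (h r : R[i] -> R[i]).

(** Averaging over rotations first replaces [h] by its circle averages. *)
Lemma radial_mean h r (S M : R) : holo h -> measurable_fun setT r ->
  (forall z, normc (r z) <= M) -> (forall z, S < normc z -> r z = 0) ->
  (forall u z, normc u = 1 -> r (u * z) = r z) ->
  cint mu setT (fun z => h z * r z) = h 0 * cint mu setT r.
Proof.
move=> dh mr rM rS rot.
have ch z : ccont h z by have [l /cder_ccont] := dh z.
have mh := measurable_ccont ch.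
have [H H0 HH] := ccont_bounded S ch.
have p0 : 0 < pi *+ 2 :> R by rewrite pmulrn_lgt0 // pi_gt0.
have pc : (pi *+ 2)%:C != 0 :> R[i] by rewrite -normc_gt0 normcR gtr0_norm.
have M0 : 0 <= M by rewrite (le_trans _ (rM 0)) // normc_ge0.
pose G z := h z * r z.
have mG : measurable_fun setT G by exact: measC_M.
pose B := H * M.
have B0 : 0 <= B by rewrite !mulr_ge0.
have GB z : normc (G z) <= B.
  have [zS|Sz] := leP (normc z) S; last by rewrite /G rS // mulr0 normc0.
  by rewrite /G normcM ler_pM ?normc_ge0 ?HH.
(* The indicator of the range of angles makes the double integral one over the full
   product, for Fubini. *)
pose I : R -> R[i] := fun y => (\1_(`[0, pi *+ 2] : set R) y)%:C.
have mI : measurable_fun setT (I : measurableTypeR R -> R[i]).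
  by apply: measC_real; exact: measurable_indic.
pose e y : R[i] := cexp (0 +i* y).
have me : measurable_fun setT (e : measurableTypeR R -> R[i]).
  by apply: measC_cexp; apply/measurable_ReP; split => /=; [exact: measurable_cst|exact: measurable_id].
have e1 y : normc (e y) = 1 by rewrite normc_cexp expR0.
pose F (p : R[i] * measurableTypeR R) : R[i] := I p.2 * G (e p.2 * p.1).
have mF : measurable_fun setT F.
  apply: measC_M; first exact: measurableT_comp mI measurable_snd.
  apply: measurableT_comp mG _; apply: measC_M; last exact: measurable_fst.
  exact: measurableT_comp me measurable_snd.
have I01 y : normc (I y) <= \1_(`[0, pi *+ 2] : set R) y.
  by rewrite normcR ger0_norm // indicE; case: (_ \in _).
have FB p : normc (F p) <= B * \1_(`[0, pi *+ 2] : set R) p.2.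
  by rewrite normcM mulrC ler_pM ?normc_ge0.
have iI : lam.-integrable setT (EFin \o (fun y => B * \1_(`[0, pi *+ 2] : set R) y)).
  have : lam.-integrable setT (EFin \o \1_(`[0, pi *+ 2] : set R)).
    exact: integrable_indic_itv.
  by move=> /(integrableZl measurableT B); apply: eq_integrable => // x _; rewrite /= EFinM.
have i1 z : cintegrable lam setT (fun y => F (z, y)).
  apply: (cintegrable_le measurableT _ _ iI) => [|y _]; last exact: FB.
  by apply: measurableT_comp mF _; exact: measurable_pair1.
have i2 y : cintegrable mu setT (fun z => F (z, y)).
  apply: (@mu_cintegrable_bounded (fun z => F (z, y)) B) => // [|z]; last first.
    by rewrite (le_trans (FB _)) // ler_piMr // indicE; case: (_ \in _).
  by apply: measurableT_comp mF _; exact: measurable_pair2.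
have iG : cintegrable mu setT G by exact: mu_cintegrable_bounded GB.
have rotG y : cint mu setT (fun z => G (e y * z)) = cint mu setT G by exact: mu_cint_rot.
have key : cint lam setT (fun y => cint mu setT (fun z => F (z, y))) = (pi *+ 2)%:C * cint mu setT G.
  have := cint_cst_itv (cint mu setT G) (ltW p0); rewrite subr0; apply: etrans.
  apply: etrans (esym (@cint_indic _ _ lam _ (fun=> cint mu setT G) (measurable_itv `[0, pi *+ 2]))).
  clear -rotG mG GB me e1.
  apply: eq_cint => y _; rewrite /F /= -(rotG y); rewrite -cintZ //.
  apply: (@mu_cintegrable_bounded _ B) => //.
  by apply: measurableT_comp mG _; exact: measC_M.
have key2 z : cint lam setT (fun y => F (z, y)) = (pi *+ 2)%:C * h 0 * r z.
  have -> : cint lam setT (fun y => F (z, y)) = cint lam `[0, pi *+ 2] (fun y => G (e y * z)).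
    exact/esym/(@cint_indic _ _ lam _ (fun y => G (e y * z)) (measurable_itv `[0, pi *+ 2])).
  rewrite (@eq_cint _ _ _ lam _ _ (fun y => r z *
      (cexp (- (0%:R * (0 +i* y))) * h (z * cexp (0 +i* y))))); last first.
    by move=> y _; rewrite /G rot // mul0r oppr0 cexp0 mul1r mulrC [e y * z]mulrC.
  rewrite cintZ //; last exact/lcont_int/lcont_cavg.
  by rewrite -/(cavg 0 h z) circle_mean // mulrC.
apply: (mulfI pc); rewrite -/G -key -(@cint_Fubini _ _ _ _ _ (@mu R) lam F) //.
  under eq_cint do rewrite key2.
  by rewrite cintZ ?mulrA //; exact: (@mu_cintegrable_bounded _ M).
have /integrableP[_] := iI; set c := (\int[lam]_x _)%E => coo.
apply: (@le_lt_trans _ _ (\int[@mu R]_z c)%E); last first.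
  by rewrite integral_cst // [X in (_ * X)%E]mu_setT mule1.
have mn : measurable_fun setT (fun p => (normc (F p))%:E).
  by apply/measurable_EFinP; exact: meas_normc.
apply: ge0_le_integral => //.
- by move=> z _; apply: integral_ge0 => y _; rewrite lee_fin normc_ge0.
- apply: (measurable_fun_fubini_tonelli_F (m2 := lam) (fun p => (normc (F p))%:E)) => // p.
  by rewrite lee_fin normc_ge0.
move=> z _; apply: ge0_le_integral => //.
- by move=> y _; rewrite lee_fin normc_ge0.
- by apply: measurableT_comp mn _; exact: measurable_pair1.
- by have /integrableP[mm _] := iI; exact: measurableT_comp mm.
by move=> y _; rewrite /= lee_fin (le_trans (FB (z, y))) // ler_norm.
Qed.
End RadialMoments.

Section MeanValue.
Context {R : realType}.
Implicit Types (g h : R[i] -> R[i]).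

Definition disc (n : nat) (z : R[i]) : R := (nat_of_bool (normc z <= n%:R))%:R.

Lemma disc_ge0 n z : 0 <= disc n z. Proof. by rewrite /disc ler0n. Qed.
Lemma disc_le1 n z : disc n z <= 1. Proof. by rewrite /disc lern1 leq_b1. Qed.

Lemma disc_out n z : n%:R < normc z -> disc n z = 0.
Proof. by rewrite /disc ltNge => /negbTE->. Qed.

Lemma measurable_disc n : measurable_fun setT (disc n).
Proof.
rewrite (_ : disc n = \1_[set z | normc z <= n%:R]); last first.
  apply/funext => z; rewrite /disc indicE; congr (nat_of_bool _)%:R.
  by apply/idP/idP; rewrite inE.
apply: measurable_indic.
have := meas_normc (@measurable_id _ R[i] setT) measurableT (measurable_itv `]-oo, n%:R]).
by rewrite setTI; congr measurable; apply/seteqP; split => z; rewrite /preimage /mkset in_itv.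
Qed.

(** Dominated convergence. Truncation makes the integrals of entire functions with
   radial weights computable by [radial_mean]. *)
Lemma mu_tail g : measurable_fun setT g -> cintegrable mu setT g ->
  forall e, 0 < e -> exists N, forall n, (N <= n)%N ->
    normc (cint mu setT g - cint mu setT (fun z => g z * (disc n z)%:C)) <= e.
Proof.
move=> mg ig e e0.
have iN := cintegrable_normc measurableT mg ig.
pose F n z : R := normc (g z) * (1 - disc n z).
have mF n : measurable_fun setT (F n).
  apply: measurable_funM; first exact: meas_normc.
  by apply: measurable_funB; [exact: measurable_cst|exact: measurable_disc].
have F0 n z : 0 <= F n z by rewrite mulr_ge0 ?normc_ge0 // subr_ge0 disc_le1.
have FN n z : F n z <= normc (g z).
  by rewrite ler_piMr ?normc_ge0 // gerBl disc_ge0.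
have iF n : mu.-integrable setT (EFin \o F n).
  by apply: le_integrableE iN => // z _; rewrite ger0_norm.
have [] := @dominated_convergence _ _ R (@mu R) setT measurableT (fun n z => (F n z)%:E) (fun=> 0%E)
  (fun z => (normc (g z))%:E) _ _ _ iN _.
- by move=> n; apply/measurable_EFinP.
- exact: measurable_cst.
- apply: aeW => z _.
  apply: cvg_near_cst; exists (Num.truncn (normc z)).+1 => // n /= hn.
  by rewrite /F /disc ltW ?subrr ?mulr0 // (lt_le_trans (truncnS_gt _)) // ler_nat.
- by apply: aeW => z n _; rewrite abse_EFin lee_fin ger0_norm.
move=> _ _; rewrite integral0 => /fine_cvg/cvgrPdist_le/(_ e e0)[N _ HN].
exists N => n /HN Hn0.
have {Hn0} Hn : `|0 - fine (\int[mu]_z (F n z)%:E)| <= e := Hn0.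
rewrite sub0r normrN in Hn.
have mgd : measurable_fun setT (fun z => g z * (disc n z)%:C).
  by apply: measC_M => //; apply: measC_real; exact: measurable_disc.
rewrite -cintB //; last first.
  apply: (cintegrable_le measurableT mgd _ iN) => z _.
  by rewrite normcM normcR ger0_norm ?disc_ge0 // ler_piMr ?normc_ge0 // disc_le1.
apply: le_trans (le_trans (ler_norm _) Hn).
apply: (normc_cint_le measurableT (measC_B mg mgd) _ (iF n)) => z _.
have -> : g z - g z * (disc n z)%:C = g z * (1 - disc n z)%:C by rewrite rmorphB mulrBr mulr1.
by rewrite normcM normcR ger0_norm // subr_ge0 disc_le1.
Qed.

Lemma disc_rot n u z : normc u = 1 -> disc n (u * z) = disc n z.
Proof. by move=> u1; rewrite /disc normcM u1 mul1r. Qed.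

Lemma mu_cint1 : cint mu setT (fun=> 1 : R[i]) = 1.
Proof.
have := cint_real (@mu R) measurableT (fun=> 1 : R).
by rewrite Rintegral_cst // mul1r [X in fine X]mu_setT.
Qed.

(** Truncate to discs, where [radial_mean] applies, and let the radius grow. *)
Lemma mu_mean_value g : holo g -> cintegrable mu setT g ->
  cint mu setT g = g 0.
Proof.
move=> dg ig.
have cg z : ccont g z by have [l /cder_ccont] := dg z.
have mg := measurable_ccont cg.
have i1 : cintegrable mu setT (fun=> 1 : R[i]).
  by apply: (@mu_cintegrable_bounded _ _ 1) => [|z]; [exact: measC_cst|rewrite normcR normr1].
have m1 : cint mu setT (fun=> 1 : R[i]) = 1.
  have := @cint_real _ _ _ (@mu R) setT measurableT (fun=> 1 : R).
  rewrite Rintegral_cst // mul1r.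
  by rewrite [X in fine X]mu_setT.
apply/eqP; rewrite -subr_eq0 -normc_eq0; apply/eqP/le_anti; rewrite normc_ge0 andbT.
apply/ler_addgt0Pl => e e0; rewrite addr0.
have e2 : 0 < e / 2 by rewrite divr_gt0.
have G0 : 0 < normc (g 0) + 1 by rewrite ltr_wpDl ?normc_ge0.
have [N1 H1] := mu_tail mg ig e2.
have [N2 H2] := mu_tail (measC_cst 1) i1 (divr_gt0 e2 G0).
pose n := maxn N1 N2.
have := H1 n (leq_maxl _ _); have := H2 n (leq_maxr _ _).
rewrite m1.
have d1 z : normc (disc n z)%:C <= 1 by rewrite normcR ger0_norm ?disc_ge0 // disc_le1.
have dS z : n%:R < normc z -> (disc n z)%:C = 0 :> R[i] by move=> /disc_out->.
have dr (u z : R[i]) : normc u = 1 -> (disc n (u * z))%:C = (disc n z)%:C :> R[i].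
  by move=> u1; rewrite disc_rot.
rewrite (radial_mean dg (measC_real (measurable_disc n)) d1 dS dr) => h2 h1.
have E1 : cint mu setT (fun z => (1 : R[i]) * (disc n z)%:C) = cint mu setT (fun z => (disc n z)%:C).
  by apply: eq_cint => z _; rewrite mul1r.
rewrite E1 in h2; set d := cint mu setT (fun z => (disc n z)%:C) in h2 h1.
have -> : cint mu setT g - g 0 = (cint mu setT g - g 0 * d) - g 0 * (1 - d) by ring.
rewrite (le_trans (normcB _ _)) // [leRHS]splitr lerD // normcM.
apply: (@le_trans _ _ ((normc (g 0) + 1) * (e / 2 / (normc (g 0) + 1)))).
  by rewrite ler_pM ?normc_ge0 // lerDl.
by rewrite mulrC divfK // gt_eqF.
Qed.

End MeanValue.

(** * Derivatives of entire functions *)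

Section EntireDerivative.
Context {R : realType}.
Local Notation dens := (@gauss_density R).
Implicit Types (g h : R[i] -> R[i]).

(** The square of the positive part has a Lipschitz derivative: this is why the bump
   [rbump] below enters squared. *)
Lemma maxsq_taylor (x y : R) :
  `|Num.max 0 y ^+ 2 - Num.max 0 x ^+ 2 - 2 * Num.max 0 x * (y - x)| <= (y - x) ^+ 2.
Proof.
have s := sqr_ge0 (y - x); have sx := sqr_ge0 x; have sy := sqr_ge0 y.
by have [x0|x0] := leP 0 x; have [y0|y0] := leP 0 y;
  rewrite ler_norml; apply/andP; split; nra.
Qed.

Lemma densV z : (dens z)^-1 = pi * expR (normc z ^+ 2).
Proof. by rewrite /gauss_density invfM invrK -expRN opprK. Qed.

Lemma measurable_densV : measurable_fun setT (fun z => (dens z)^-1).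
Proof.
under eq_fun do rewrite densV.
apply: measurable_funM; first exact: measurable_cst.
by apply: measurableT_comp => //; exact: measurable_normc2.
Qed.

Lemma area_integrable_supp (r : R[i] -> R) (B S : R) : measurable_fun setT r ->
  (forall z, `|r z| <= B) -> (forall z, S < normc z -> r z = 0) ->
  area.-integrable setT (EFin \o r).
Proof.
move=> mr rB rS.
have mr' : measurable_fun setT (fun z => r z / dens z).
  by apply: measurable_funM => //; exact: measurable_densV.
have : mu.-integrable setT (EFin \o (fun z => r z / dens z)).
  apply: (@mu_integrable_growth _ _ (B * (pi * expR (S ^+ 2))) 0) => // z.
  rewrite mul0r expR0 mulr1; have [zS|Sz] := leP (normc z) S; last first.
    by rewrite rS // mul0r normr0 mulr_ge0 ?mulr_ge0 ?pi_ge0 ?expR_ge0 // (le_trans _ (rB 0)).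
  rewrite normrM ler_pM // normfV ger0_norm ?dens_ge0 // densV.
  rewrite ler_wpM2l ?pi_ge0 // ler_expR; apply: lerXn2r => //; rewrite nnegrE ?normc_ge0 //.
  exact: le_trans (normc_ge0 z) zS.
move/mu_integrable => /(_ mr'); apply: eq_integrable => // z _ /=.
by rewrite divfK // gt_eqF // dens_gt0.
Qed.

Lemma area_cintegrable_supp g (B S : R) : measurable_fun setT g ->
  (forall z, normc (g z) <= B) -> (forall z, S < normc z -> g z = 0) ->
  cintegrable area setT g.
Proof.
move=> /measurable_ReP[m1 m2] gB gS; split.
  apply: (@area_integrable_supp _ B S) => // z; last by move/gS->.
  exact: le_trans (normc_Re _) (gB z).
apply: (@area_integrable_supp _ B S) => // z; last by move/gS->.
exact: le_trans (normc_Im _) (gB z).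
Qed.

(** A radial bump with support in the disc of radius [sqrt T], inside the disc of
   radius [T] when [1 <= T]. *)
Definition rbump (T : R) (z : R[i]) : R := Num.max 0 (T - normc z ^+ 2).

Lemma rbump_ge0 T z : 0 <= rbump T z. Proof. by rewrite le_max lexx. Qed.

Lemma rbump_le T z : 0 <= T -> rbump T z <= T.
Proof. by move=> T0; rewrite ge_max T0 gerBl sqr_ge0. Qed.

Lemma rbump_out T z : 1 <= T -> T < normc z -> rbump T z = 0.
Proof.
move=> T1 Tz; apply/max_idPl; rewrite subr_le0.
have := normc_ge0 z; nra.
Qed.

Lemma measurable_rbump T : measurable_fun setT (rbump T).
Proof.
apply: measurable_maxr; first exact: measurable_cst.
by apply: measurable_funB; [exact: measurable_cst|exact: measurable_normc2].
Qed.

Lemma rbump_rot T u z : normc u = 1 -> rbump T (u * z) = rbump T z.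
Proof. by move=> u1; rewrite /rbump normcM u1 mul1r. Qed.

(** [radial_mean] at the centre [a], with the Gaussian density divided out. *)
Lemma area_mean h T a : 1 <= T -> holo h ->
  cint area setT (fun w => h w * (rbump T (w - a) ^+ 2)%:C) =
  h a * (\int[area]_w (rbump T w ^+ 2))%R%:C.
Proof.
move=> T1 dh; have T0 : 0 <= T by rewrite (le_trans _ T1).
have dha z : exists l, cder (fun z => h (z + a)) z l.
  by have [l dl] := dh (z + a); exists l; exact: cder_shift.
have mb := measurable_funX 2 (measurable_rbump T).
have md := measurable_densV.
have mh := measurable_ccont (fun z => let: ex_intro l dl := dh z in cder_ccont dl).
have mr : measurable_fun setT (fun z => (rbump T z ^+ 2 / dens z)%:C).
  by apply: measC_real; exact: measurable_funM.
have b1 z : normc (rbump T z ^+ 2 / dens z)%:C <= T ^+ 2 * (pi * expR (T ^+ 2)).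
  rewrite normcR; have [zS|Sz] := leP (normc z) T; last first.
    by rewrite rbump_out // expr0n mul0r normr0 mulr_ge0 ?sqr_ge0 ?mulr_ge0 ?pi_ge0 ?expR_ge0.
  rewrite normrM ler_pM // ?(ger0_norm (sqr_ge0 _)).
    by apply: lerXn2r; rewrite ?nnegrE ?rbump_ge0 // rbump_le.
  rewrite normfV ger0_norm ?dens_ge0 // densV.
  rewrite ler_wpM2l ?pi_ge0 // ler_expR; apply: lerXn2r => //; rewrite nnegrE ?normc_ge0 //.
have b2 z : T < normc z -> (rbump T z ^+ 2 / dens z)%:C = 0 :> R[i].
  by move=> /(rbump_out T1)->; rewrite expr0n mul0r.
have b3 (u z : R[i]) : normc u = 1 ->
    (rbump T (u * z) ^+ 2 / dens (u * z))%:C = (rbump T z ^+ 2 / dens z)%:C :> R[i].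
  by move=> u1; rewrite rbump_rot // /gauss_density normcM u1 mul1r.
have := radial_mean dha mr b1 b2 b3; rewrite add0r.
have mha : measurable_fun setT (fun z : R[i] => h (z + a)).
  by case: (area_preserving_shift a) => ma _; exact: measurableT_comp mh ma.
rewrite mu_cint; last exact: measC_M.
rewrite [X in _ = _ * X]mu_cint // => E.
have dd (x : R) z : (x / dens z)%:C * (dens z)%:C = x%:C :> R[i].
  by rewrite -rmorphM divfK // gt_eqF // dens_gt0.
rewrite -(cint_real _ (@measurableT _ R[i])).
transitivity (h a * cint area setT (fun x => (rbump T x ^+ 2 / dens x)%:C * (dens x)%:C)); last first.
  by congr (_ * _); apply: eq_cint => z _; rewrite dd.
rewrite -E.
have mk : measurable_fun setT (fun w => h w * (rbump T (w - a) ^+ 2)%:C).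
  apply: measC_M => //; apply: measC_real.
  by case: (area_preserving_shift (- a)) => ma _; exact: measurableT_comp mb ma.
rewrite -(area_preserving_cint (area_preserving_shift a) mk).
by apply: eq_cint => z _; rewrite -mulrA dd addrK.
Qed.

(** For large [T] the bump is at least 1 on a disc that carries half of the Gaussian
   mass. *)
Lemma rbump_mass : exists2 T : R, 1 <= T & 0 < (\int[area]_w (rbump T w ^+ 2))%R.
Proof.
have i1 : cintegrable mu setT (fun=> 1 : R[i]).
  by apply: (@mu_cintegrable_bounded _ _ 1) => [|z]; [exact: measC_cst|rewrite normcR normr1].
have [N] := mu_tail (measC_cst 1) i1 (@divr_gt0 R 1 2 ltr01 ltac:(by rewrite ltr0n)).
move=> /(_ N (leqnn _)).
rewrite mu_cint1.
under eq_cint do rewrite mul1r.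
rewrite cint_real // -rmorphB normcR => HN.
have {HN} HN : 1 / 2 <= (\int[@mu R]_z disc N z)%R.
  move: HN; rewrite ler_norml => /andP[_ HN]; lra.
pose T : R := (N.+1)%:R ^+ 2.
have T1 : 1 <= T by rewrite exprn_ege1 // ler1n.
exists T => //; apply: (@lt_le_trans _ _ (pi * (1 / 2))); first by rewrite mulr_gt0 // pi_gt0.
apply: (@le_trans _ _ (pi * (\int[@mu R]_z disc N z)%R)); first by rewrite ler_wpM2l ?pi_ge0.
have mD := @measurable_disc R N.
rewrite mu_Rintegral //.
have iD : area.-integrable setT (EFin \o (fun z => disc N z * dens z)).
  have : (@mu R).-integrable setT (EFin \o disc N).
    apply: (@mu_integrable_growth _ _ 1 0) => // z.
    by rewrite mul0r expR0 mulr1 ger0_norm ?disc_ge0 // disc_le1.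
  by move/mu_integrable; apply.
rewrite -RintegralZl //.
have mB := measurable_funX 2 (measurable_rbump T).
apply: le_Rintegral => //.
- by apply: eq_integrable (integrableZl measurableT pi iD) => // z _; rewrite /= EFinM.
- apply: (@area_integrable_supp _ (T ^+ 2) T) => // z.
    rewrite ger0_norm ?sqr_ge0 //; apply: lerXn2r; rewrite ?nnegrE ?rbump_ge0 ?rbump_le //;
    exact: le_trans T1.
  by move=> /(rbump_out T1)->; rewrite expr0n.
move=> z _; apply: (@le_trans _ _ (disc N z)).
  rewrite mulrCA ler_piMr ?disc_ge0 // /gauss_density mulrA divff ?mul1r ?gt_eqF ?pi_gt0 //.
  by rewrite -expR0 ler_expR oppr_le0 sqr_ge0.
rewrite /disc; case: (leP (normc z) N%:R) => [zN|_]; last by rewrite sqr_ge0.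
rewrite exprn_ege1 // /rbump le_max; apply/orP; right.
rewrite lerBrDr /T -natr1.
have := normc_ge0 z; have : 0 <= N%:R :> R by []. 
nra.
Qed.

(** Moving the centre [a] in [area_mean] moves only the kernel, which has a first
   order expansion with quadratic error. The linear term of the expansion has to be the
   derivative of [h]. *)
Lemma entire_quad h S : holo h -> exists2 C, 0 <= C &
  forall a l x, normc a <= S -> cder h a l -> normc x <= 1 ->
    normc (h (a + x) - h a - l * x) <= C * normc x ^+ 2.
Proof.
move=> dh; have [T T1 M0] := rbump_mass; set M := Rintegral _ _ _ in M0.
have T0 : 0 <= T by rewrite (le_trans _ T1).
(* All kernels with centre within distance 1 of the disc of radius [S] live in the disc
   of radius [n], where [h] is bounded by [H]. *)
pose n := (Num.truncn (`|S| + T + 1)).+1.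
have nS : `|S| + T + 1 < n%:R by exact: truncnS_gt.
have ch z : ccont h z by have [l /cder_ccont] := dh z.
have mh := measurable_ccont ch.
have [H H0 HH] := ccont_bounded n%:R ch.
pose c := 2 * T + (2 * T + 3) ^+ 2.
have c0 : 0 <= c by rewrite addr_ge0 ?sqr_ge0 // mulr_ge0.
pose A := (\int[@area R]_w disc n w)%R.
have mdn := @measurable_disc R n.
have idn : (@area R).-integrable setT (EFin \o disc n).
  apply: (@area_integrable_supp _ 1 n%:R) => // z; last exact: disc_out.
  by rewrite ger0_norm ?disc_ge0 // disc_le1.
have A0 : 0 <= A by apply: Rintegral_ge0 => z _; exact: disc_ge0.
pose Lin (a x : R[i]) := cint area setT (fun w => h w * (4 * rbump T (w - a) * complex.Re ((w - a) * x^*))%:C).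
(* The second order remainder of the kernel; [main] integrates it against [h]. *)
pose Q a x w : R := rbump T (w - (a + x)) ^+ 2 - rbump T (w - a) ^+ 2 -
  4 * rbump T (w - a) * complex.Re ((w - a) * x^*).
have Qout a x w : normc x <= 1 -> T + 1 < normc (w - a) -> Q a x w = 0.
  move=> x1 va; have E : w - (a + x) = (w - a) - x by ring.
  have B1 : rbump T (w - (a + x)) = 0.
    apply: rbump_out => //; rewrite E.
    by have := normcD ((w - a) - x) x; rewrite subrK => h1; lra.
  have B2 : rbump T (w - a) = 0 by apply: rbump_out => //; lra.
  by rewrite /Q B1 B2; ring.
have QB a x w : normc x <= 1 -> `|Q a x w| <= c * normc x ^+ 2.
  move=> x1; have [va|/Qout->//] := leP (normc (w - a)) (T + 1); last first.
    by rewrite normr0 mulr_ge0 // sqr_ge0.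
  pose v := w - a; pose p := complex.Re (v * x^*).
  have E : normc (w - (a + x)) ^+ 2 = normc v ^+ 2 - 2 * p + normc x ^+ 2.
    rewrite (_ : w - (a + x) = v - x); last by rewrite /v; ring.
    by rewrite /p !normc2 !reim; ring.
  have := maxsq_taylor (T - normc v ^+ 2) (T - normc (w - (a + x)) ^+ 2).
  have -> : T - normc (w - (a + x)) ^+ 2 - (T - normc v ^+ 2) = 2 * p - normc x ^+ 2 by rewrite E; ring.
  rewrite -/(rbump T v) -/(rbump T (w - (a + x))) => K.
  have -> : Q a x w = (rbump T (w - (a + x)) ^+ 2 - rbump T v ^+ 2 - 2 * rbump T v * (2 * p - normc x ^+ 2))
      - 2 * rbump T v * normc x ^+ 2 by rewrite /Q -/v -/p; ring.
  have pB : `|p| <= (T + 1) * normc x.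
    by rewrite (le_trans (normc_Re _)) // normcM normcJ ler_wpM2r ?normc_ge0.
  have b1 := rbump_le v T0; have b0 := rbump_ge0 T v; have x0 := normc_ge0 x.
  have -> : c * normc x ^+ 2 = (2 * T + 3) ^+ 2 * normc x ^+ 2 + 2 * T * normc x ^+ 2.
    by rewrite /c; ring.
  rewrite (le_trans (ler_normB _ _)) // lerD //; last first.
    by rewrite ger0_norm ?mulr_ge0 ?sqr_ge0 // ler_wpM2r ?sqr_ge0 // ler_wpM2l.
  rewrite (le_trans K) // -exprMn -[leLHS]real_normK ?num_real //; apply: lerXn2r; rewrite ?nnegrE ?mulr_ge0 //.
    by rewrite addr_ge0 // mulr_ge0.
  rewrite (le_trans (ler_normB _ _)) // normrM ger0_norm // (ger0_norm (sqr_ge0 _)).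
  clear -pB x1 x0 T0; nra.
have Q0 a x w : normc a <= S -> normc x <= 1 -> n%:R < normc w -> Q a x w = 0.
  move=> aS x1 nw; apply: Qout => //.
  have := normcD (w - a) a; rewrite subrK => h1.
  have := ler_norm S; lra.
have far (b w : R[i]) : normc b <= `|S| + 1 -> n%:R < normc w -> rbump T (w - b) = 0.
  move=> bS nw; apply: rbump_out => //.
  by have := normcD (w - b) b; rewrite subrK => h1; lra.
have mbs b : measurable_fun setT (fun w : R[i] => rbump T (w - b)).
  case: (area_preserving_shift (- b)) => ma _.
  by apply: measurableT_comp ma; exact: measurable_rbump.
have I1 b : normc b <= `|S| + 1 -> cintegrable area setT (fun w => h w * (rbump T (w - b) ^+ 2)%:C).
  move=> bS; apply: (@area_cintegrable_supp _ (H * T ^+ 2) n%:R) => [|w|w nw].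
  - by apply: measC_M => //; apply: measC_real; exact: measurable_funX.
  - have [wn|nw] := leP (normc w) n%:R; last first.
      by rewrite far // expr0n mulr0 normc0 mulr_ge0 ?sqr_ge0.
    rewrite normcM normcR ger0_norm ?sqr_ge0 // ler_pM ?normc_ge0 ?sqr_ge0 ?HH //.
    by apply: lerXn2r; rewrite ?nnegrE ?rbump_ge0 // rbump_le.
  by rewrite far // expr0n mulr0.
have I3 a x : normc a <= S -> normc x <= 1 ->
    cintegrable area setT (fun w => h w * (4 * rbump T (w - a) * complex.Re ((w - a) * x^*))%:C).
  move=> aS x1; have aS' : normc a <= `|S| + 1.
    by rewrite (le_trans aS) // (le_trans (ler_norm _)) // lerDl.
  apply: (@area_cintegrable_supp _ (H * (4 * T * T)) n%:R) => [|w|w nw].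
  - apply: measC_M => //; apply: measC_real; apply: measurable_funM.
      by apply: measurable_funM; [exact: measurable_cst|].
    have : measurable_fun setT (fun w : R[i] => (w - a) * x^*).
      apply: measC_M; last exact: measC_cst.
      by apply: measC_B; [exact: measurable_id|exact: measC_cst].
    by move/measurable_ReP => [].
  - have [wn|nw] := leP (normc w) n%:R; last first.
      by rewrite far // mulr0 mul0r mulr0 normc0 mulr_ge0 // !mulr_ge0.
    rewrite normcM ler_pM ?normc_ge0 ?HH // normcR.
    have [vT|Tv] := leP (normc (w - a)) T; last first.
      by rewrite rbump_out // mulr0 mul0r normr0 !mulr_ge0.
    rewrite normrM ler_pM // ?(ger0_norm (mulr_ge0 _ _)) ?rbump_ge0 //.
      by rewrite ler_wpM2l // rbump_le.
    rewrite (le_trans (normc_Re _)) // normcM normcJ.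
    by rewrite -[leRHS]mulr1 ler_pM ?normc_ge0.
  by rewrite far // mulr0 mul0r mulr0.
have main a x : normc a <= S -> normc x <= 1 ->
    normc (M%:C * (h (a + x) - h a) - Lin a x) <= H * c * A * normc x ^+ 2.
  move=> aS x1.
  have aS' : normc a <= `|S| + 1.
    by rewrite (le_trans aS) // (le_trans (ler_norm _)) // lerDl.
  have axS : normc (a + x) <= `|S| + 1.
    by rewrite (le_trans (normcD _ _)) // lerD // (le_trans aS) // ler_norm.
  have -> : M%:C * (h (a + x) - h a) - Lin a x = cint area setT (fun w => h w * (Q a x w)%:C).
    rewrite mulrBr ![M%:C * _]mulrC -(area_mean _ T1 dh) -(area_mean _ T1 dh).
    rewrite -(cintB _ (I1 _ axS) (I1 _ aS')) // -cintB //; last 2 first.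
    + exact: cintegrableB (I1 _ axS) (I1 _ aS').
    + exact: I3.
    by apply: eq_cint => w _; rewrite -!mulrBr -!rmorphB.
  have mQ : measurable_fun setT (fun w => h w * (Q a x w)%:C).
    have [_ _] := (I1, I3); apply: measC_M => //; apply: measC_real.
    apply: measurable_funB; first by apply: measurable_funB; exact: measurable_funX.
    apply: measurable_funM; first by apply: measurable_funM; [exact: measurable_cst|].
    have : measurable_fun setT (fun w : R[i] => (w - a) * x^*).
      apply: measC_M; last exact: measC_cst.
      by apply: measC_B; [exact: measurable_id|exact: measC_cst].
    by move/measurable_ReP => [].
  have idn' : area.-integrable setT (EFin \o (fun w => H * (c * normc x ^+ 2) * disc n w)).
    have := integrableZl measurableT (H * (c * normc x ^+ 2)) idn.
    by apply: eq_integrable => // w _; rewrite /= EFinM.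
  have -> : H * c * A * normc x ^+ 2 = (\int[area]_w (H * (c * normc x ^+ 2) * disc n w))%R.
    by rewrite RintegralZl // -/A; ring.
  apply: (normc_cint_le measurableT mQ _ idn') => w _.
  have [wn|nw] := leP (normc w) n%:R; last first.
    rewrite Q0 // normcM normcR normr0 mulr0.
    by rewrite mulr_ge0 ?disc_ge0 // mulr_ge0 // mulr_ge0 // sqr_ge0.
  rewrite /disc wn mulr1 normcM ler_pM ?normc_ge0 ?HH // normcR.
  exact: QB.
have LinZ a x (t : R) : normc a <= S -> normc x <= 1 -> Lin a (t%:C * x) = t%:C * Lin a x.
  move=> aS x1; rewrite /Lin -cintZ //; last exact: I3.
  apply: eq_cint => w _; rewrite mulrCA -rmorphM; congr (_ * _%:C).
  by rewrite !reim /=; ring.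
exists (M^-1 * (H * c * A)); first by rewrite !mulr_ge0 // invr_ge0 ltW.
move=> a l x aS dl x1.
(* Both sides are linear in [x] over the reals and agree up to [o(x)]. *)
have LinE : Lin a x = M%:C * l * x.
  apply/eqP; rewrite -subr_eq0 -normc_eq0; apply/eqP/le_anti; rewrite normc_ge0 andbT.
  apply/ler_addgt0Pl => e e0; rewrite addr0.
  have K0 : 0 <= H * c * A by rewrite !mulr_ge0.
  have K1 : 0 < H * c * A + 1 by rewrite ltr_wpDl.
  have e1 : 0 < e / 2 / M by rewrite !divr_gt0.
  have [d d0 D] := dl _ e1.
  pose t := Num.min 1 (Num.min (d / 2) (e / 2 / (H * c * A + 1))).
  have t0 : 0 < t by rewrite !lt_min ltr01 !divr_gt0.
  have t1 : t <= 1 by rewrite ge_min lexx.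
  have td : t < d.
    by rewrite (@le_lt_trans _ _ (d / 2)) ?ltr_pdivrMr ?mulr_natr ?mulr2n ?ltrDl // !ge_min lexx !orbT.
  have te : t <= e / 2 / (H * c * A + 1) by rewrite !ge_min lexx !orbT.
  have nx : normc (t%:C * x) = t * normc x by rewrite normcM normcR gtr0_norm.
  have tx1 : normc (t%:C * x) <= t by rewrite nx ler_piMr // ltW.
  have m1 := main a (t%:C * x) aS (le_trans tx1 t1).
  have m2 := D (t%:C * x) (le_lt_trans tx1 td).
  have E : t%:C * (Lin a x - M%:C * l * x) =
      M%:C * (h (a + t%:C * x) - h a - l * (t%:C * x)) -
      (M%:C * (h (a + t%:C * x) - h a) - Lin a (t%:C * x)).
    by rewrite LinZ //; ring.
  rewrite -(ler_pM2l t0) -[X in X * _ <= _]gtr0_norm // -[X in X * _ <= _]normcR -normcM E.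
  rewrite (le_trans (normcB _ _)) // normcM normcR gtr0_norm //.
  have b1 : M * normc (h (a + t%:C * x) - h a - l * (t%:C * x)) <= t * (e / 2).
    apply: (@le_trans _ _ (M * (e / 2 / M * t))).
      by rewrite ler_wpM2l ?(ltW M0) // (le_trans m2) // ler_wpM2l // ltW.
    by rewrite mulrA [M * _]mulrC divfK ?gt_eqF // mulrC.
  have b2 : H * c * A * normc (t%:C * x) ^+ 2 <= t * (e / 2).
    apply: (@le_trans _ _ ((H * c * A + 1) * (t * t))).
      apply: ler_pM; rewrite ?sqr_ge0 ?lerDl //.
      by rewrite expr2 ler_pM ?normc_ge0.
    rewrite mulrCA ler_wpM2l ?(ltW t0) // mulrC -ler_pdivlMr //.
  rewrite [leRHS](_ : _ = t * (e / 2) + t * (e / 2)); last by field.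
  by rewrite lerD // (le_trans m1).
have M1 : M%:C != 0 :> R[i] by rewrite -normc_gt0 normcR gtr0_norm.
have -> : h (a + x) - h a - l * x = (M%:C)^-1 * (M%:C * (h (a + x) - h a) - Lin a x).
  by rewrite LinE; field.
rewrite normcM normcV normcR (gtr0_norm M0) -[leRHS]mulrA.
apply: ler_wpM2l; first by rewrite invr_ge0 ltW.
exact: main.
Qed.

Lemma cder_choice h : holo h ->
  exists h', forall z, cder h z (h' z).
Proof. by move=> dh; have [h' H] := choice dh; exists h'. Qed.

Lemma normc_eq_sub (z w : R[i]) : (forall e, 0 < e -> normc (z - w) <= e) -> z = w.
Proof.
move=> H; apply/eqP; rewrite -subr_eq0 -normc_eq0; apply/eqP/le_anti; rewrite normc_ge0 andbT.
by apply/ler_addgt0Pl => e e0; rewrite addr0 H.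
Qed.

(** Cauchy's formula for the derivative on a unit circle: by [cavg_scale] it can be
   checked on small circles, where [h] is nearly affine. *)
Lemma cauchy_der h a l : holo h -> cder h a l ->
  (pi *+ 2)%:C * l = cavg 1 (fun z => h (z + a) - h a) 1.
Proof.
move=> dh dl; pose g z := h (z + a) - h a.
have dg z : exists l, cder g z l.
  by have [l' dl'] := dh (z + a); eexists; exact: cderD (cder_shift dl') (cder_cst _ _).
have p0 : 0 < pi *+ 2 :> R by rewrite pmulrn_lgt0 // pi_gt0.
apply: normc_eq_sub => e e0.
have [d d0 D] := dl _ (divr_gt0 e0 p0).
pose t := d / 2; have t0 : 0 < t by rewrite divr_gt0.
have td : t < d by rewrite /t ltr_pdivrMr // mulr_natr mulr2n ltrDl.
have E := cavg_scale 1 1 dg t0; rewrite expr1 mulr1 in E.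
set C := cavg 1 g 1 in E *.
have cI : lcont (fun=> l * t%:C) by split => x; exact: cvg_cst.
pose k z := h (z + a) - h a - l * z.
have dk z : exists l, cder (fun z => - k z) z l.
  have [l' dl'] := dg z; eexists; apply: cderN.
  exact: cderD dl' (cderN (cderZ _ (cder_id _))).
have E2 : t%:C * ((pi *+ 2)%:C * l - C) = cint lebesgue_measure `[0, pi *+ 2]
    (fun y => cexp (- (1%:R * (0 +i* y))) * (- k (t%:C * cexp (0 +i* y)))).
  have -> : t%:C * ((pi *+ 2)%:C * l - C) = (pi *+ 2 - 0)%:C * (l * t%:C) - t%:C * C.
    by rewrite subr0; ring.
  rewrite -E -(cint_cst_itv _ (ltW p0)) -cintB //; last 2 first.
  - exact: lcont_int.
  - exact/lcont_int/lcont_cavg.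
  apply: eq_cint => y _; rewrite /k /g cexpV mul1r; field.
  exact: cexp_neq0.
rewrite -(ler_pM2l t0) -[X in X * _ <= _]gtr0_norm // -[X in X * _ <= _]normcR -normcM E2.
have -> : t * e = e / (pi *+ 2) * t * (pi *+ 2 - 0).
  by rewrite subr0 -mulrA [t * (_ *+ 2)]mulrC mulrA divfK ?gt_eqF // mulrC.
apply: normc_cint_itv; first exact: ltW.
  exact: (lcont_cavg 1 (h := fun z => - k z) t%:C dk).
move=> y _; rewrite normcM normcNE normc_cexp mul1r /= oppr0 expR0 mul1r /k addrC.
have nt : normc (t%:C * cexp (0 +i* y)) = t by rewrite normcM normcR normc_cexp /= expR0 mulr1 gtr0_norm.
by rewrite -[X in _ <= _ * X]nt [_ + a]addrC addrC; apply: D; rewrite nt.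
Qed.

Lemma ccont_comp (f g : R[i] -> R[i]) z : ccont f z -> ccont g (f z) ->
  ccont (fun x => g (f x)) z.
Proof.
move=> cf cg e e0; have [d d0 D] := cg e e0; have [d' d'0 D'] := cf d d0.
exists d' => // x /D'/D; have -> // : f z + (f (z + x) - f z) = f (z + x) by ring.
Qed.

(** By [entire_quad] the derivative is locally Lipschitz, and Cauchy's formula for it
   can be differentiated under the integral. *)
Lemma entire_der h : holo h ->
  exists2 h' : R[i] -> R[i], (forall z, cder h z (h' z)) & forall z, exists l, cder h' z l.
Proof.
move=> dh; have [h' dh'] := cder_choice dh; exists h' => // a.
have lip S : exists2 C, 0 <= C & forall b x, normc b <= S -> normc x <= 1 ->
    normc (h' (b + x) - h' b) <= C * normc x.
  have [C C0 HC] := entire_quad (S + 1) dh.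
  exists (C + C); first by rewrite addr_ge0.
  move=> b x bS x1; have [->|x0] := eqVneq x 0.
    by rewrite addr0 subrr normc0 mulr0.
  have nx : 0 < normc x by rewrite normc_gt0.
  have bS' : normc b <= S + 1 by rewrite (le_trans bS) // lerDl.
  have bxS : normc (b + x) <= S + 1 by rewrite (le_trans (normcD _ _)) // lerD.
  have q1 := HC b (h' b) x bS' (dh' b) x1.
  have x1' : normc (- x) <= 1 by rewrite normcNE.
  have q2 := HC (b + x) (h' (b + x)) (- x) bxS (dh' _) x1'.
  rewrite -(ler_pM2r nx) -normcM -mulrA -expr2 [(C + C) * _]mulrDl.
  have -> : (h' (b + x) - h' b) * x = (h (b + x) - h b - h' b * x) +
     (h (b + x - x) - h (b + x) - h' (b + x) * - x) by rewrite addrK; ring.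
  by rewrite (le_trans (normcD _ _)) // lerD // (le_trans q2) // normcNE.
have ch' z : ccont h' z.
  have [C C0 HC] := lip (normc z); move=> e e0.
  have C1 : 0 < C + 1 by rewrite ltr_wpDl.
  exists (Num.min 1 (e / (C + 1))); first by rewrite lt_min ltr01 divr_gt0.
  move=> x; rewrite lt_min => /andP[x1 xe].
  apply: le_lt_trans (HC z x (lexx _) (ltW x1)) _.
  move: xe; rewrite ltr_pdivlMr // mulrC; apply: le_lt_trans.
  by rewrite ler_wpM2r ?normc_ge0 // lerDl.
pose p : R := pi *+ 2.
have p0 : 0 < p by rewrite pmulrn_lgt0 // pi_gt0.
have pc : p%:C != 0 :> R[i] by rewrite -normc_gt0 normcR gtr0_norm.
have ch z : ccont h z := cder_ccont (dh' z).
have cc (g : R[i] -> R[i]) : (forall z, ccont g z) ->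
    lcont (fun y => cexp (- (1%:R * (0 +i* y))) * g (1 * cexp (0 +i* y))).
  move=> cg.
  have d2 z1 : ccont (fun z2 => cexp (- (1%:R * z2)) * g (1 * cexp z2)) z1.
    apply: ccontM.
      have := cder_comp (cderN (cderZ 1%:R (cder_id z1))) (cder_cexp _).
      exact: cder_ccont.
    apply: (ccont_comp (f := fun z => 1 * cexp z)) (cg _).
    exact: cder_ccont (cderZ _ (cder_cexp _)).
  have [L1 L2] := lcont_circle 0 d2.
  by split; [move: L1|move: L2]; under eq_fun do rewrite add0r.
exists (p%:C^-1 * cavg 1 (fun z => h' (z + a) - h' a) 1) => e e0.
have [C C0 HC] := entire_quad (normc a + 1) dh.
pose K := C + C + 1; have K0 : 0 < K by rewrite ltr_wpDl // addr_ge0.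
exists (Num.min 1 (e / K)); first by rewrite lt_min ltr01 divr_gt0.
move=> x; rewrite lt_min => /andP[/ltW x1 xe].
have cshift (f : R[i] -> R[i]) b c : (forall z, ccont f z) -> forall z, ccont (fun z => f (z + b) - c) z.
  move=> cf z; apply: ccontD; last exact: cder_ccont (cder_cst _ _).
  apply: (ccont_comp (f := fun z => z + b)) (cf _).
  exact: cder_ccont (cderD (cder_id _) (cder_cst _ _)).
have c1 := cc _ (cshift h (a + x) (h (a + x)) ch).
have c2 := cc _ (cshift h a (h a) ch).
have c3 := cc _ (cshift h' a (h' a) ch').
(* The first order remainder in [x] of the integrand of [cauchy_der]. *)
pose k (z : R[i]) := (h (z + (a + x)) - h (a + x)) - (h (z + a) - h a) - (h' (z + a) - h' a) * x.
have E : p%:C * (h' (a + x) - h' a - p%:C^-1 * cavg 1 (fun z => h' (z + a) - h' a) 1 * x) =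
    cint lebesgue_measure `[0, p] (fun y => cexp (- (1%:R * (0 +i* y))) * k (1 * cexp (0 +i* y))).
  rewrite !mulrBr (cauchy_der dh (dh' _)) (cauchy_der dh (dh' _)) !mulrA divff // mul1r.
  rewrite mulrC -cintZ //; last exact: lcont_int.
  rewrite -cintB //; try exact: lcont_int.
  rewrite -cintB //; last 2 first.
  - by apply: cintegrableB => //; exact: lcont_int.
  - by apply: cintegrableZ => //; exact: lcont_int.
  by apply: eq_cint => y _; rewrite /k; ring.
have kB : normc (p%:C * (h' (a + x) - h' a - p%:C^-1 * cavg 1 (fun z => h' (z + a) - h' a) 1 * x)) <=
    (C + C) * normc x ^+ 2 * (p - 0).
  rewrite E; apply: normc_cint_itv; first exact: ltW.
    apply: cc => z.
    have cst c z' : ccont (fun=> c) z' by exact: cder_ccont (cder_cst _ _).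
    have -> : k = fun z => ((h (z + (a + x)) - h (a + x)) + (-1) * (h (z + a) - h a)) +
        (h' (z + a) - h' a) * (- x) by apply/funext => z'; rewrite /k; ring.
    apply: ccontD; last by apply: ccontM => //; exact: cshift.
    by apply: ccontD; [exact: cshift|apply: ccontM => //; exact: cshift].
  move=> y _.
  have nu : normc (cexp (- (1%:R * (0 +i* y)))) = 1 by rewrite normc_cexp mul1r /= oppr0 expR0.
  rewrite normcM nu mul1r; set u := cexp _; have u1 : normc u = 1 by rewrite normc_cexp /= expR0.
  have -> : k (1 * u) = (h (u + a + x) - h (u + a) - h' (u + a) * x) - (h (a + x) - h a - h' a * x).
    by rewrite /k mul1r addrA; ring.
  rewrite (le_trans (normcB _ _)) // mulrDl lerD // HC //; last by rewrite lerDl.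
  by rewrite (le_trans (normcD _ _)) // u1 addrC.
move: kB; rewrite subr0 normcM normcR (gtr0_norm p0) mulrC ler_pM2r // => kB.
rewrite (le_trans kB) // expr2 mulrA ler_wpM2r ?normc_ge0 //.
move: xe; rewrite ltr_pdivlMr // => /ltW; apply: le_trans.
by rewrite mulrC ler_wpM2l ?normc_ge0 // lerDl.
Qed.

End EntireDerivative.

(** * The reproducing kernel *)

Section ExpTaylor.
Context {R : realType}.
Implicit Types (f g : R[i] -> R[i]) (z w s : R[i]).

Lemma cder_mean_le f df M z : (forall w, cder f w (df w)) ->
  (forall w, normc w <= normc z -> normc (df w) <= M) ->
  normc (f z - f 0) <= M * normc z.
Proof.
move=> df_ dM; set D := f z - f 0.
have [->|D0] := eqVneq D 0.
  rewrite normc0 mulr_ge0 ?normc_ge0 // (le_trans _ (dM 0 _)) ?normc_ge0 ?normc0 ?normc_ge0 //.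
have nD : 0 < normc D by rewrite normc_gt0.
pose c := D^* * (normc D)%:C^-1.
have cD : c * D = (normc D)%:C.
  rewrite /c mulrAC [D^* * _]mulrC normcJM expr2 rmorphM mulfK //.
  by rewrite -normc_gt0 normcR gtr0_norm.
have nc : normc c = 1.
  by rewrite normcM normcJ normcV normcR gtr0_norm // divff // gt_eqF.
clearbody c.
pose F w := c * f (w * z).
have dF w : cder F w (c * (df (w * z) * z)).
  apply: cderZ; apply: (cder_comp (f := fun w => w * z)) (df_ _).
  by have := cderM (cder_id w) (cder_cst z w); rewrite mul1r mulr0 addr0.
pose p (t : R) := complex.Re (F (0 + t%:C * 1)).
have dp (t : R) : is_derive t 1 p (complex.Re (c * (df (t%:C * z) * z))).
  have [hp pE] := partial_cder 1 (dF (0 + t%:C * 1)).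
  have [+ _] := line_partial hp.
  by rewrite pE !mul1r mulr1 add0r.
have [x x1 E] := MVT_abs dp 1.
have -> : normc D = p 1 - p 0.
  by rewrite /p /F !add0r mul0r mul0r mulr1 mul1r -cReN -cReD -mulrBr -/D cD.
rewrite E mulr1 (le_trans (ler_norm _)) // (le_trans (normc_Re _)) // !normcM nc mul1r.
rewrite ler_wpM2r ?normc_ge0 // dM // normcM normcR ler_piMl ?normc_ge0 //.
by move: x1; rewrite normr1.
Qed.

Definition texp n s := \sum_(j < n) (j`!%:R)^-1 * s ^+ j.

Lemma natfact_neq0 n : n`!%:R != 0 :> R[i].
Proof. by rewrite pnatr_eq0 -lt0n fact_gt0. Qed.

Lemma cder_sum (I : Type) (r : seq I) (F dF : I -> R[i] -> R[i]) z :
  (forall i, cder (F i) z (dF i z)) ->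
  cder (fun w => \sum_(i <- r) F i w) z (\sum_(i <- r) dF i z).
Proof.
move=> H; elim: r => [|i r IH].
  by rewrite big_nil; under eq_fun do rewrite big_nil; exact: cder_cst.
rewrite big_cons; under eq_fun do rewrite big_cons.
exact: (cderD (H i) IH).
Qed.

Lemma texpS0 n : texp n.+1 0 = 1.
Proof.
rewrite /texp big_ord_recl /= fact0 invr1 mul1r expr0 big1 ?addr0 // => i _.
by rewrite expr0n /= mulr0.
Qed.

Lemma cder_texp n z : cder (texp n.+1) z (texp n z).
Proof.
have -> : texp n z = \sum_(j < n.+1) (j`!%:R)^-1 * (j%:R * z ^+ j.-1).
  rewrite big_ord_recl /= mul0r mulr0 add0r; apply: eq_bigr => i _ /=.
  by rewrite /bump /= add1n factS natrM invfM mulrACA mulVf ?mul1r // pnatr_eq0.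
apply: (@cder_sum _ _ (fun j : 'I_n.+1 => fun z => (j`!%:R)^-1 * z ^+ j)
  (fun j : 'I_n.+1 => fun z => (j`!%:R)^-1 * (j%:R * z ^+ j.-1))) => j.
by apply: cderZ; have := cder_expr 0 z j; rewrite subr0; apply: cder_eq => x; rewrite subr0.
Qed.

(** Taylor's inequality, by induction on the order from the mean value inequality. *)
Lemma texp_le n s : normc (cexp s - texp n s) <= normc s ^+ n * expR (normc s).
Proof.
elim: n s => [|n IH] s.
  rewrite /texp big_ord0 subr0 expr0 mul1r normc_cexp ler_expR.
  exact: le_trans (ler_norm _) (normc_Re _).
have d w : cder (fun w => cexp w - texp n.+1 w) w (cexp w - texp n w).
  by apply: cderD; [exact: cder_cexp|apply: cderN; exact: cder_texp].
have := @cder_mean_le (fun w => cexp w - texp n.+1 w) _ (normc s ^+ n * expR (normc s)) s d.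
rewrite cexp0 texpS0 subrr subr0 exprSr mulrAC; apply => w ws.
rewrite (le_trans (IH w)) // ler_pM ?exprn_ge0 ?normc_ge0 ?expR_ge0 ?ler_expR //.
by apply: lerXn2r; rewrite ?nnegrE ?normc_ge0.
Qed.

Lemma pow_expR_le (t : R) n : 0 <= t -> t ^+ n <= expR (n%:R * t).
Proof.
move=> t0; rewrite expRM_natl; apply: lerXn2r; rewrite ?nnegrE ?expR_ge0 //.
by have := expR_ge1Dx t; lra.
Qed.

Lemma expR_quad_le (c a t : R) : 0 < a -> expR (c * t) <= expR (c ^+ 2 / (4 * a)) * expR (a * t ^+ 2).
Proof.
move=> a0; rewrite -expRD ler_expR.
have -> : c ^+ 2 / (4 * a) + a * t ^+ 2 = c * t + a * (t - c / (2 * a)) ^+ 2.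
  by field; rewrite gt_eqF.
by rewrite lerDl mulr_ge0 ?sqr_ge0 // ltW.
Qed.

Lemma tame_poly_exp phi n (K c : R) : measurable_fun setT phi -> 0 <= K ->
  (forall z, normc (phi z) <= K * (normc z ^+ n * expR (c * normc z))) ->
  tame (K * expR ((n%:R + c) ^+ 2)) phi.
Proof.
move=> mphi K0 H; split => // z; rewrite (le_trans (H z)) // -mulrA ler_wpM2l //.
apply: (@le_trans _ _ (expR ((n%:R + c) * normc z))).
  by rewrite mulrDl expRD ler_wpM2r ?expR_ge0 // pow_expR_le // normc_ge0.
apply: le_trans (@expR_quad_le _ 4^-1 _ _) _; first by rewrite invr_gt0.
by rewrite mulfV ?divr1 // [4^-1 * _]mulrC.
Qed.

End ExpTaylor.

Section Holomorphy.
Context {R : realType}.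
Implicit Types (f g u v : R[i] -> R[i]) (z w s : R[i]).

Lemma holoD f g : holo f -> holo g -> holo (fun z => f z + g z).
Proof. by move=> hf hg z; have [a Ha] := hf z; have [b Hb] := hg z; eexists; exact: (cderD Ha Hb). Qed.

Lemma holoM f g : holo f -> holo g -> holo (fun z => f z * g z).
Proof. by move=> hf hg z; have [a Ha] := hf z; have [b Hb] := hg z; eexists; exact: (cderM Ha Hb). Qed.

Lemma holo_cst (c : R[i]) : holo (fun=> c). Proof. by move=> z; eexists; exact: cder_cst. Qed.
Lemma holo_id : holo (@id R[i]). Proof. by move=> z; eexists; exact: cder_id. Qed.

Lemma holoN f : holo f -> holo (fun z => - f z).
Proof. by move=> hf z; have [a Ha] := hf z; eexists; exact: (cderN Ha). Qed.

Lemma holoX f n : holo f -> holo (fun z => f z ^+ n).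
Proof.
move=> hf; elim: n => [|n IH]; first by under eq_fun do rewrite expr0; exact: holo_cst.
by under eq_fun do rewrite exprS; exact: holoM.
Qed.

Lemma holo_sum (I : Type) (r : seq I) (F : I -> R[i] -> R[i]) :
  (forall i, holo (F i)) -> holo (fun w => \sum_(i <- r) F i w).
Proof.
move=> H; elim: r => [|i r IH]; first by under eq_fun do rewrite big_nil; exact: holo_cst.
by under eq_fun do rewrite big_cons; exact: holoD.
Qed.

Lemma holo_comp f g : holo f -> holo g -> holo (fun z => g (f z)).
Proof. by move=> hf hg z; have [a Ha] := hf z; have [b Hb] := hg (f z); eexists; exact: (cder_comp Ha Hb). Qed.

Lemma holo_cexp : holo (@cexp R). Proof. by move=> z; eexists; exact: cder_cexp. Qed.

Lemma holo_ccont f : holo f -> forall z, ccont f z.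
Proof. by move=> hf z; have [l /cder_ccont] := hf z. Qed.

Lemma holo_meas f : holo f -> measurable_fun setT f.
Proof. by move/holo_ccont/measurable_ccont. Qed.

(** Densities against which every exponential [e^{z w'}] is integrable. *)
Definition wint v := measurable_fun setT v /\
  forall c : R, mu.-integrable setT (fun w => (normc (v w) * expR (c * normc w))%:E).

(** On L^2 this is the projection onto level 0; the larger domain [wint] is stable
   under the multiplications that differentiation in [z] produces. *)
Definition wexp v z := cint mu setT (fun w => v w * cexp (z * w^*)).

Lemma measurable_ker z : measurable_fun setT (fun w : R[i] => cexp (z * w^*)).
Proof.
apply: measC_cexp; apply: measC_M; first exact: measC_cst.
by apply: measC_J; exact: measurable_id.
Qed.

Lemma normc_ker z w : normc (cexp (z * w^*)) <= expR (normc z * normc w).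
Proof.
rewrite normc_cexp ler_expR (le_trans (ler_norm _)) // (le_trans (normc_Re _)) //.
by rewrite normcM normcJ.
Qed.

Lemma L2_growth v (M c : R) : measurable_fun setT v ->
  (forall w, normc (v w) <= M * expR (c * normc w)) -> L2 v.
Proof.
move=> mv H; split => //.
apply: (@mu_integrable_growth _ _ (M ^+ 2 * expR ((c * 2) ^+ 2 / (4 * (1 / 2)))) (1 / 2)).
- lra.
- by apply: measurable_funX; exact: meas_normc.
move=> w; rewrite ger0_norm ?sqr_ge0 // -mulrA.
apply: (@le_trans _ _ ((M * expR (c * normc w)) ^+ 2)).
  apply: lerXn2r; rewrite ?nnegrE ?normc_ge0 ?(le_trans (normc_ge0 _) (H w)) //.
rewrite exprMn ler_wpM2l ?sqr_ge0 // -expRM_natr mulrAC.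
apply: expR_quad_le; lra.
Qed.

Lemma wint_L2 u : L2 u -> wint u.
Proof.
move=> Lu; split; first by case: Lu.
move=> c; pose e (w : R[i]) : R[i] := (expR (c * normc w))%:C.
have me : measurable_fun setT e.
  apply: measC_real; apply: measurableT_comp => //; apply: measurable_funM => //.
  by apply: meas_normc; exact: measurable_id.
have Le : L2 e.
  by apply: (@L2_growth _ 1 c) => // w; rewrite normcR mul1r ger0_norm ?expR_ge0.
have := L2M_int Lu Le; apply: eq_integrable => // w _.
by rewrite normcM normcR [`|expR _|]ger0_norm ?expR_ge0.
Qed.

Lemma wintM v p (M c : R) : measurable_fun setT p ->
  (forall w, normc (p w) <= M * expR (c * normc w)) -> wint v -> wint (fun w => v w * p w).
Proof.
move=> mp H [mv iv]; split; first exact: measC_M.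
move=> c'; have := integrableZl measurableT M (iv (c + c')).
apply: le_integrableE => //.
  apply: measurable_funM; first by apply: meas_normc; exact: measC_M.
  apply: measurableT_comp => //; apply: measurable_funM => //.
  by apply: meas_normc; exact: measurable_id.
move=> w _; rewrite ger0_norm ?mulr_ge0 ?normc_ge0 ?expR_ge0 // normcM mulrDl expRD.
rewrite !mulrA ler_wpM2r ?expR_ge0 // [M * _]mulrC -mulrA ler_wpM2l ?normc_ge0 //.
Qed.

Lemma wint_cintegrable v z : wint v -> cintegrable mu setT (fun w => v w * cexp (z * w^*)).
Proof.
move=> [mv iv]; apply: (cintegrable_le measurableT _ _ (iv (normc z))).
  by apply: measC_M => //; exact: measurable_ker.
by move=> w _; rewrite normcM ler_wpM2l ?normc_ge0 // normc_ker.
Qed.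

Lemma normc_le_expR (w : R[i]) : normc w <= 1 * expR (1 * normc w).
Proof. by rewrite !mul1r; have := expR_ge1Dx (normc w); lra. Qed.

Lemma wint_conj v : wint v -> wint (fun w => v w * w^*).
Proof.
apply: (@wintM _ _ 1 1) => [|w]; first by apply: measC_J; exact: measurable_id.
by rewrite normcJ normc_le_expR.
Qed.

(** Differentiation under the integral, with the second order Taylor bound. *)
Lemma cder_wexp v z : wint v -> cder (wexp v) z (wexp (fun w => v w * w^*) z).
Proof.
move=> wv e e0; have wv1 := wint_conj wv; have [mv iv] := wv; have [mv1 _] := wv1.
have [mv2 iv2] := wint_conj wv1.
pose K := (\int[@mu R]_w (normc (v w * w^* * w^*) * expR ((normc z + 1) * normc w)))%R.
have K0 : 0 <= K by apply: Rintegral_ge0 => w _; rewrite mulr_ge0 ?normc_ge0 ?expR_ge0.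
have K1 : 0 < K + 1 by rewrite ltr_wpDl.
exists (Num.min 1 (e / (K + 1))); first by rewrite lt_min ltr01 divr_gt0.
move=> h; rewrite lt_min => /andP[/ltW h1 he].
have E : wexp v (z + h) - wexp v z - wexp (fun w => v w * w^*) z * h =
    cint mu setT (fun w => v w * cexp (z * w^*) * (cexp (h * w^*) - texp 2 (h * w^*))).
  rewrite mulrC /wexp -cintZ //; last exact: wint_cintegrable.
  rewrite -cintB //; try exact: wint_cintegrable.
  rewrite -cintB //; last 2 first.
  - by apply: cintegrableB => //; exact: wint_cintegrable.
  - by apply: cintegrableZ => //; exact: wint_cintegrable.
  apply: eq_cint => w _; rewrite mulrDl cexpD /texp !big_ord_recl big_ord0 /= !fact0 !invr1.
  by rewrite expr0 expr1; ring.
have B : normc (cint mu setT (fun w => v w * cexp (z * w^*) * (cexp (h * w^*) - texp 2 (h * w^*)))) <=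
    normc h ^+ 2 * K.
  rewrite /K -RintegralZl //; last exact: iv2.
  apply: (normc_cint_le measurableT) => [|w _|].
  - apply: measC_M; first by apply: measC_M => //; exact: measurable_ker.
    have mhw : measurable_fun setT (fun w : R[i] => h * w^*).
      by apply: measC_M; [exact: measC_cst|apply: measC_J; exact: measurable_id].
    apply: measC_B; first exact: measC_cexp.
    rewrite /texp; under eq_fun do rewrite !big_ord_recl big_ord0.
    apply: measC_D; first by apply: measC_M; [exact: measC_cst|exact: measC_X].
    by apply: measC_D; [apply: measC_M; [exact: measC_cst|exact: measC_X]|exact: measC_cst].
  - have t2 := texp_le 2 (h * w^*); rewrite normcM normcJ in t2.
    rewrite !normcM !normcJ mulrDl expRD mul1r.
    apply: (@le_trans _ _ (normc (v w) * expR (normc z * normc w) *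
       ((normc h * normc w) ^+ 2 * expR (normc h * normc w)))).
      rewrite ler_pM ?mulr_ge0 ?normc_ge0 // ler_pM ?normc_ge0 ?normc_ker //.
    have e1 : expR (normc h * normc w) <= expR (normc w).
      by rewrite ler_expR ler_piMl ?normc_ge0.
    have -> : normc h ^+ 2 * (normc (v w) * normc w * normc w * (expR (normc z * normc w) * expR (normc w)))
      = normc (v w) * expR (normc z * normc w) * ((normc h * normc w) ^+ 2 * expR (normc w)) by ring.
    by rewrite ler_wpM2l ?mulr_ge0 ?normc_ge0 ?expR_ge0 // ler_wpM2l ?sqr_ge0.
  - have := integrableZl measurableT (normc h ^+ 2) (iv2 (normc z + 1)).
    by apply: eq_integrable => // w _; rewrite /= EFinM.
rewrite E (le_trans B) // expr2 mulrAC ler_wpM2r ?normc_ge0 //.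
move: he; rewrite ltr_pdivlMr // => /ltW; apply: le_trans.
by rewrite ler_wpM2l ?normc_ge0 // lerDl.
Qed.

Lemma holo_wexp v : wint v -> holo (wexp v).
Proof. by move=> wv z; eexists; exact: cder_wexp. Qed.

(** Level 0, described by its reproducing kernel; by [holo_F1] and [holo_wexp] it
   consists of the entire functions of L^2. *)
Definition F1 g := L2 g /\ forall z, g z = wexp g z.

(** An entire function of L^2 is reproduced: this is the mean value property at 0
   of its Weyl translate. *)
Lemma holo_F1 g : holo g -> L2 g -> F1 g.
Proof.
move=> hg Lg; split=> // z.
(* Up to a constant, [G (w + z)] is the Weyl translate of [g]. *)
pose G w := g w * cexp (- (w * z^*) + z * z^*).
have hG : holo G.
  apply: holoM => //; apply: (holo_comp (f := fun w => - (w * z^*) + z * z^*)) holo_cexp.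
  apply: holoD (holo_cst _); apply: holoN; apply: holoM holo_id _; exact: holo_cst.
have mg := holo_meas hg; have mG := holo_meas hG.
have hGz : holo (fun w => G (w + z)).
  by apply: (holo_comp (f := fun w => w + z)) hG; apply: holoD holo_id _; exact: holo_cst.
have E w : G w * (expR (complex.Re (w * z^*) *+ 2 - normc z ^+ 2))%:C = g w * cexp (z * w^*).
  rewrite /G -cexpR -mulrA -cexpD; congr (_ * cexp _).
  by apply: complexP; rewrite ?normc2 !reim /= ?reim /= ?normc2; ring.
have wg := wint_L2 Lg.
have iG : cintegrable mu setT (fun w => G (w + z)).
  by apply: mu_cintegrable_shift mG _; under eq_fun do rewrite E; exact: wint_cintegrable.
have := mu_mean_value hGz iG; rewrite add0r mu_cint_shift // /wexp.
under eq_cint do rewrite E.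
by move->; rewrite /G addNr cexp0 mulr1.
Qed.

End Holomorphy.

(** * Ladder operators and level projections *)

Section LadderOperators.
Context {R : realType}.
Implicit Types (f g u v : R[i] -> R[i]) (z w s : R[i]) (J : seq nat).

Definition raise j z := (- z^*) ^+ j.
Definition lower j z := z ^+ j.

Definition tmass (j : nat) : R := expR (j%:R ^+ 2).

Lemma tame_lower j : tame (tmass j) (lower j).
Proof.
rewrite /tmass -[X in expR (X ^+ 2)]addr0 -[expR _]mul1r; apply: (tame_poly_exp (n := j)) => // [|z].
  by apply: measC_X; exact: measurable_id.
by rewrite mul0r expR0 mulr1 mul1r normcX.
Qed.

Lemma tame_raise j : tame (tmass j) (raise j).
Proof.
rewrite /tmass -[X in expR (X ^+ 2)]addr0 -[expR _]mul1r; apply: (tame_poly_exp (n := j)) => // [|z].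
  by apply: measC_X; apply: measC_N; apply: measC_J; exact: measurable_id.
by rewrite mul0r expR0 mulr1 mul1r normcX normcNE normcJ.
Qed.

(* The operators and their bounds are locked: unification would otherwise unfold
   them into integrals. *)
Fact op_key : unit. Proof. exact: tt. Qed.
(** [Aop j] takes level [j] to level 0, and [Bop j] takes level 0 to level [j]. *)
Definition Aop j u : R[i] -> R[i] := locked_with op_key (tc (lower j) u).
Definition Bop j u : R[i] -> R[i] := locked_with op_key (tc (raise j) u).
Definition opc j : R := locked_with op_key (tmass j * (@gmass R / pi)).
Definition fc j : R[i] := locked_with op_key ((j`!%:R)^-1).

Lemma AopE j u : Aop j u = tc (lower j) u. Proof. exact: unlock. Qed.
Lemma BopE j u : Bop j u = tc (raise j) u. Proof. exact: unlock. Qed.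
Lemma opcE j : opc j = tmass j * (@gmass R / pi). Proof. exact: unlock. Qed.
Lemma fcE j : fc j = (j`!%:R)^-1. Proof. exact: unlock. Qed.

Lemma opc_ge0 j : 0 <= opc j.
Proof. by rewrite opcE mulr_ge0 ?expR_ge0 // divr_ge0 ?gmass_ge0 ?pi_ge0. Qed.

Lemma Aop_L2 j u : L2 u -> L2 (Aop j u) /\ nrm (Aop j u) <= opc j * nrm u.
Proof. by move=> Lu; rewrite AopE opcE; exact: (tc_L2 (tame_lower j) Lu). Qed.

Lemma Bop_L2 j u : L2 u -> L2 (Bop j u) /\ nrm (Bop j u) <= opc j * nrm u.
Proof. by move=> Lu; rewrite BopE opcE; exact: (tc_L2 (tame_raise j) Lu). Qed.

Lemma Aop0 u : Aop 0 u = wexp u.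
Proof.
by rewrite AopE; apply/funext => z; apply: eq_cint => w _; rewrite /tck /lower expr0 mul1r.
Qed.

Lemma Bop0 u : Bop 0 u = wexp u.
Proof.
by rewrite BopE; apply/funext => z; apply: eq_cint => w _; rewrite /tck /raise expr0 mul1r.
Qed.

Lemma wint_mono u (p : R[i] -> R[i]) n : wint u -> measurable_fun setT p ->
  (forall w, normc (p w) = normc w) -> wint (fun w => u w * p w ^+ n).
Proof.
move=> wu mp np; apply: (@wintM _ _ _ 1 n%:R) => // [|w]; first exact: measC_X.
by rewrite normcX np mul1r pow_expR_le // normc_ge0.
Qed.

Lemma holo_Aop j u : L2 u -> holo (Aop j u).
Proof.
move=> /wint_L2 wu.
have mN : measurable_fun setT (fun w : R[i] => - w) by apply: measC_N; exact: measurable_id.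
have wi i := wint_mono i wu mN (fun w => normcNE w).
have -> : Aop j u = fun z => \sum_(i < j.+1) (z ^+ (j - i) *+ 'C(j, i)) * wexp (fun w => u w * (- w) ^+ i) z.
  apply/funext => z; rewrite AopE /tc.
  rewrite (@eq_cint _ _ _ _ _ _ (fun w => \sum_(i < j.+1) (z ^+ (j - i) *+ 'C(j, i)) *
      (u w * (- w) ^+ i * cexp (z * w^*)))); last first.
    move=> w _; rewrite /tck /lower exprDn mulr_suml mulr_sumr; apply: eq_bigr => i _.
    by rewrite -!mulrnAl; ring.
  rewrite (cint_sum _ _ _).2 //; first by apply: eq_bigr => i _; rewrite cintZ //; exact: wint_cintegrable.
  by move=> i; apply: cintegrableZ => //; exact: wint_cintegrable.
apply: holo_sum => i; apply: holoM; last exact: holo_wexp.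
under eq_fun do rewrite -mulr_natr; apply: holoM (holo_cst _); exact: holoX holo_id.
Qed.

Lemma F1_Aop j u : L2 u -> F1 (Aop j u).
Proof. by move=> Lu; apply: holo_F1; [exact: holo_Aop|exact: (Aop_L2 j Lu).1]. Qed.

Lemma F1_wexp u : L2 u -> F1 (wexp u).
Proof. by rewrite -Aop0; exact: F1_Aop. Qed.

(** The kernel integrals of [Aop l] after [Bop j]: multiplication by the conjugate
   variable under the integral is differentiation in [z]. *)
Lemma kernel_AB l j (z0 x z : R[i]) :
  wexp (fun w => (z0 - w) ^+ l * cexp (w * x^*) * (x^* - w^*) ^+ j) z =
  (l ^_ j)%:R * (z0 - z) ^+ (l - j) * cexp (z * x^*).
Proof.
have m1 : measurable_fun setT (fun w : R[i] => (z0 - w) ^+ l * cexp (w * x^*)).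
  apply: measC_M; first by apply: measC_X; apply: measC_B; [exact: measurable_cst|exact: measurable_id].
  by apply: measC_cexp; apply: measC_M; [exact: measurable_id|exact: measC_cst].
have lin (a w : R[i]) : normc (a - w) <= expR (normc a) * expR (1 * normc w).
  rewrite mul1r -expRD (le_trans (normcB _ _)) //.
  by have := expR_ge1Dx (normc a + normc w); lra.
have pw (a w : R[i]) n : normc ((a - w) ^+ n) <= expR (normc a) ^+ n * expR (n%:R * normc w).
  rewrite normcX expRM_natl -exprMn; apply: lerXn2r; rewrite ?nnegrE ?normc_ge0 ?mulr_ge0 ?expR_ge0 //.
  by have := lin a w; rewrite mul1r.
have G0 : L2 (fun w : R[i] => (z0 - w) ^+ l * cexp (w * x^*)).
  apply: (@L2_growth _ _ (expR (normc z0) ^+ l) (l%:R + normc x)) => // w.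
  rewrite normcM mulrDl expRD mulrA ler_pM ?normc_ge0 ?pw //.
  rewrite normc_cexp ler_expR (le_trans (ler_norm _)) // (le_trans (normc_Re _)) //.
  by rewrite normcM normcJ mulrC.
have wG i : wint (fun w => (z0 - w) ^+ l * cexp (w * x^*) * (x^* - w^*) ^+ i).
  apply: (@wintM _ _ _ (expR (normc x) ^+ i) i%:R) => [|w|]; last exact: wint_L2.
    by apply: measC_X; apply: measC_B; [exact: measC_cst|apply: measC_J; exact: measurable_id].
  by have := pw x^* w^* i; rewrite !normcJ.
elim: j z => [|j IH] z.
  rewrite ffactn0 mul1r subn0.
  have hG : holo (fun w => (z0 - w) ^+ l * cexp (w * x^*)).
    apply: holoM; first by apply: holoX; apply: holoD (holo_cst _) _; exact: holoN holo_id.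
    by apply: (holo_comp (f := fun w => w * x^*)) holo_cexp; exact: holoM holo_id (holo_cst _).
  have [_ ->] := holo_F1 hG G0.
  by apply: eq_cint => w _; rewrite expr0 mulr1.
have dX := cder_wexp z (wG j).
have E : wexp (fun w => (z0 - w) ^+ l * cexp (w * x^*) * (x^* - w^*) ^+ j.+1) z =
    x^* * wexp (fun w => (z0 - w) ^+ l * cexp (w * x^*) * (x^* - w^*) ^+ j) z -
    wexp (fun w => (z0 - w) ^+ l * cexp (w * x^*) * (x^* - w^*) ^+ j * w^*) z.
  rewrite /wexp -cintZ //; last exact: wint_cintegrable.
  rewrite -cintB //; last 2 first.
  - by apply: cintegrableZ => //; exact: wint_cintegrable.
  - exact/wint_cintegrable/wint_conj.
  by apply: eq_cint => w _; rewrite exprS; ring.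
rewrite E.
have dY : cder (fun z => (l ^_ j)%:R * (z0 - z) ^+ (l - j) * cexp (z * x^*)) z
   ((l ^_ j)%:R * (- ((l - j)%:R * (z0 - z) ^+ (l - j).-1)) * cexp (z * x^*) +
    (l ^_ j)%:R * (z0 - z) ^+ (l - j) * (cexp (z * x^*) * x^*)).
  apply: cderM; last first.
    apply: (cder_comp (f := fun z => z * x^*)) (cder_cexp _).
    by have := cderM (cder_id z) (cder_cst x^* z); rewrite mul1r mulr0 addr0.
  apply: cderZ.
  have := cder_comp (f := fun z => z0 - z) (cderD (cder_cst z0 z) (cderN (cder_id z))) (cder_expr 0 (z0 - z) (l - j)).
  rewrite !subr0 add0r mulrN1; apply: cder_eq => w; by rewrite subr0.
rewrite (cder_unique dX (cder_eq (fun w => esym (IH w)) dY)) IH.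
rewrite ffactnSr natrM subnS; ring.
Qed.

(** After Fubini, the composite kernel is that of [kernel_AB] at [z0 = z]: the falling
   factorial vanishes for [l < j], the power of [z - z] for [j < l]. *)
Lemma AopBop l j u z : L2 u ->
  Aop l (Bop j u) z = (if l == j then j`!%:R else 0) * wexp u z.
Proof.
move=> Lu; rewrite AopE BopE {1}/tc.
rewrite (tc_Fubini (tame_raise j) Lu (tck_L2 z (tame_lower l))).
rewrite /wexp -cintZ //; last exact/wint_cintegrable/wint_L2.
apply: eq_cint => w _; rewrite mulrCA; congr (_ * _).
have := kernel_AB l j z w z; rewrite /wexp => E.
rewrite (@eq_cint _ _ _ _ _ _ (fun x : R[i] => (z - x) ^+ l * cexp (x * w^*) * (w^* - x^*) ^+ j * cexp (z * x^*))).
  rewrite E subrr expr0n subn_eq0; have [->|lj] := eqVneq l j.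
    by rewrite leqnn ffactnn mulr1.
  case: leqP => [lj2|]; last by rewrite mulr0.
  by rewrite ffact_small ?mul0r // ltn_neqAle lj.
by move=> x _; rewrite /tck /raise /lower conjB opprB; ring.
Qed.

Lemma inner_AopBop j u v : L2 u -> L2 v -> inner (Aop j u) v = inner u (Bop j v).
Proof.
move=> Lu Lv; rewrite !innerE AopE BopE (tc_Fubini (tame_lower j) Lu (L2J Lv).1).
apply: eq_cint => w _; congr (_ * _).
rewrite -cintJ //; last exact: (tc_cintegrable _ (tame_raise j)).
apply: eq_cint => z _; rewrite /tck /raise /lower !conjM cexpJ conjX conjN conjM !conjcK opprB.
by rewrite mulrC; congr (_ * (_ * cexp _)); exact: mulrC.
Qed.

Lemma inner_BopAop j u v : L2 u -> L2 v -> inner (Bop j u) v = inner u (Aop j v).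
Proof.
move=> Lu Lv; have [LA _] := Aop_L2 j Lv; have [LB _] := Bop_L2 j Lu.
by rewrite (innerJ Lv LB) -inner_AopBop // -(innerJ LA Lu).
Qed.

Lemma fcK j z : fc j * (j`!%:R * z) = z.
Proof. by rewrite fcE mulKf // natfact_neq0. Qed.

Lemma fcJ j : (fc j)^* = fc j.
Proof. by rewrite fcE -[j`!%:R](rmorph_nat (@real_complex R)) -fmorphV conj_real. Qed.

Lemma tc_sum (I : Type) (s : seq I) (F : I -> R[i] -> R[i]) M phi z : tame M phi ->
  (forall i, L2 (F i)) ->
  tc phi (fun w => \sum_(i <- s) F i w) z = \sum_(i <- s) tc phi (F i) z.
Proof.
move=> H LF; elim: s => [|i s IH].
  rewrite big_nil /tc -[RHS](@cint0 _ _ _ (@mu R) setT measurableT).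
  by apply: eq_cint => w _; rewrite big_nil mul0r.
rewrite big_cons -IH -[tc phi (F i) z]mul1r -[X in _ + X]mul1r.
rewrite -(tc_lin H 1 1 z (LF i) (L2_sum s LF).1).
by apply: eq_cint => w _; rewrite big_cons !mul1r.
Qed.

Lemma tcZ M phi c u z : tame M phi -> L2 u -> tc phi (fun w => c * u w) z = c * tc phi u z.
Proof.
move=> H Lu; rewrite /tc -cintZ //; last exact: (tc_cintegrable z H).
by apply: eq_cint => w _; rewrite mulrA.
Qed.

Lemma Aop_lin j a b u v : L2 u -> L2 v ->
  Aop j (fun w => a * u w + b * v w) = fun w => a * Aop j u w + b * Aop j v w.
Proof. by move=> Lu Lv; rewrite !AopE; apply/funext => z; exact: (tc_lin (tame_lower j)). Qed.

Lemma Bop_lin j a b u v : L2 u -> L2 v ->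
  Bop j (fun w => a * u w + b * v w) = fun w => a * Bop j u w + b * Bop j v w.
Proof. by move=> Lu Lv; rewrite !BopE; apply/funext => z; exact: (tc_lin (tame_raise j)). Qed.

Lemma Aop_sum j (I : Type) (s : seq I) (c : I -> R[i]) (F : I -> R[i] -> R[i]) z :
  (forall i, L2 (F i)) ->
  Aop j (fun w => \sum_(i <- s) c i * F i w) z = \sum_(i <- s) c i * Aop j (F i) z.
Proof.
move=> LF; rewrite AopE (tc_sum s z (tame_lower j) (fun i => (L2Z (c i) (LF i)).1)).
by apply: eq_bigr => i _; rewrite AopE; exact: tcZ (tame_lower j) _.
Qed.

Lemma Bop_pt j u z : L2 u -> normc (Bop j u z) <= nrm u * nrm (tck (raise j) z).
Proof. by rewrite BopE; exact: normc_tc_pt (tame_raise j). Qed.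

Lemma wexp_F1 g : F1 g -> wexp g = g.
Proof. by move=> [_ H]; apply/funext => z; rewrite -H. Qed.

(** For [uniq J], the orthogonal projection onto the levels in [J]; see [orth_proj_levels]. *)
Definition lproj J u z := \sum_(j <- J) fc j * Bop j (Aop j u) z.

Definition levels J : set (R[i] -> R[i]) := [set F | L2 F /\ forall z, F z = lproj J F z].

Lemma BA_L2 j u : L2 u -> L2 (Bop j (Aop j u)) /\ nrm (Bop j (Aop j u)) <= opc j * (opc j * nrm u).
Proof.
move=> /(Aop_L2 j)[L1 n1]; have [L2_ n2] := Bop_L2 j L1; split => //.
by rewrite (le_trans n2) // ler_wpM2l ?opc_ge0.
Qed.

Definition lproj_cst J : R := \sum_(j <- J) normc (fc j) * (opc j * opc j).

Lemma lproj_L2 J u : L2 u -> L2 (lproj J u) /\ nrm (lproj J u) <= lproj_cst J * nrm u.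
Proof.
move=> Lu; have LB j := L2Z (fc j) (BA_L2 j Lu).1.
have [L1 n1] := L2_sum J (fun j => (LB j).1); split => //.
rewrite (le_trans n1) // /lproj_cst mulr_suml; apply: ler_sum => j _.
rewrite (LB j).2 -!mulrA ler_wpM2l ?normc_ge0 //.
by have := (BA_L2 j Lu).2.
Qed.

Lemma Aop_lproj J l u z : uniq J -> L2 u ->
  Aop l (lproj J u) z = if l \in J then Aop l u z else 0.
Proof.
move=> uJ Lu; have LB j := (BA_L2 j Lu).1.
rewrite /lproj (Aop_sum l J fc z LB).
have E j : fc j * Aop l (Bop j (Aop j u)) z = if j == l then Aop l u z else 0.
  rewrite (AopBop l j z (Aop_L2 j Lu).1) (wexp_F1 (F1_Aop j Lu)) [l == j]eq_sym.
  by case: eqVneq => [->|_]; [rewrite fcK|rewrite mul0r mulr0].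
under eq_bigr do rewrite E.
elim: J uJ => [|j J IH] /=; first by rewrite big_nil.
move=> /andP[jJ /IH{}IH]; rewrite big_cons IH inE [l == j]eq_sym.
by case: eqVneq => [<-|_] /=; rewrite ?(negbTE jJ) ?addr0 ?add0r.
Qed.

Lemma lproj_lproj J u : uniq J -> L2 u -> lproj J (lproj J u) = lproj J u.
Proof.
move=> uJ Lu; apply/funext => z; rewrite /lproj; apply: eq_big_seq => j jJ.
have -> // : Aop j (lproj J u) = Aop j u.
by apply/funext => w; rewrite Aop_lproj // jJ.
Qed.

Lemma levels_lproj J u : uniq J -> L2 u -> levels J (lproj J u).
Proof. by move=> uJ Lu; split; [exact: (lproj_L2 J Lu).1|move=> z; rewrite lproj_lproj]. Qed.

Lemma inner_lproj J u v : L2 u -> L2 v -> inner (lproj J u) v = inner u (lproj J v).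
Proof.
move=> Lu Lv; have LB x Lx j := L2Z (fc j) (@BA_L2 j x Lx).1.
rewrite (inner_suml J (fun j => (LB u Lu j).1) Lv) (inner_sumr J (fun j => (LB v Lv j).1) Lu).
apply: eq_bigr => j _; have [L1 _] := BA_L2 j Lu; have [L3 _] := BA_L2 j Lv.
have [L5 _] := Aop_L2 j Lu; have [L6 _] := Aop_L2 j Lv.
rewrite (innerZl _ L1 Lv) (innerZr _ L3 Lu) fcJ (inner_BopAop j L5 Lv).
by rewrite -(inner_AopBop j Lu L6).
Qed.

Lemma lproj_lin J a b u v z : L2 u -> L2 v ->
  lproj J (fun w => a * u w + b * v w) z = a * lproj J u z + b * lproj J v z.
Proof.
move=> Lu Lv; rewrite /lproj !mulr_sumr -big_split /=; apply: eq_bigr => j _.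
rewrite (Aop_lin j a b Lu Lv) (Bop_lin j a b (Aop_L2 j Lu).1 (Aop_L2 j Lv).1).
by rewrite mulrDr [X in X + _ = _]mulrCA [X in _ + X = _]mulrCA.
Qed.

Lemma lprojB J u v z : L2 u -> L2 v -> lproj J (fun w => u w - v w) z = lproj J u z - lproj J v z.
Proof.
move=> Lu Lv; have := lproj_lin J 1 (-1) z Lu Lv; rewrite mul1r mulN1r => <-.
by congr (lproj J _ z); apply/funext => w; rewrite mul1r mulN1r.
Qed.

(** Makes sequences of [levels J] that are Cauchy in norm converge at every point. *)
Lemma lproj_pt J z : exists2 C, 0 <= C & forall u, L2 u -> normc (lproj J u z) <= C * nrm u.
Proof.
exists (\sum_(j <- J) normc (fc j) * (opc j * nrm (tck (raise j) z))).
  by apply: sumr_ge0 => j _; rewrite !mulr_ge0 ?opc_ge0 ?nrm_ge0 // normc_ge0.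
move=> u Lu; rewrite (le_trans (normc_sum _ _)) // mulr_suml; apply: ler_sum => j _.
rewrite normcM -!mulrA ler_wpM2l ?normc_ge0 //.
rewrite (le_trans (Bop_pt j z (Aop_L2 j Lu).1)) //.
have -> : opc j * (nrm (tck (raise j) z) * nrm u) = opc j * nrm u * nrm (tck (raise j) z) by ring.
by apply: ler_wpM2r; [exact: nrm_ge0|exact: (Aop_L2 j Lu).2].
Qed.

Lemma levels_ext J F : levels J F -> lproj J F = F.
Proof. by move=> [_ H]; apply/funext => z; rewrite -H. Qed.

Lemma levels_nrm0 J F z : levels J F -> nrm F = 0 -> F z = 0.
Proof.
move=> [LF FE] F0; have [C C0 H] := lproj_pt J z.
have := H F LF; rewrite -FE F0 mulr0 => n0.
by apply/eqP; rewrite -normc_eq0; apply/eqP/le_anti; rewrite n0 normc_ge0.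
Qed.

Lemma orth_proj_levels J u : uniq J -> L2 u -> orth_proj (levels J) u = lproj J u.
Proof.
move=> uJ Lu; have [LE _] := lproj_L2 J Lu.
have ex : [set h | levels J h /\ forall v, levels J v -> inner (u \- h) v = 0] (lproj J u).
  split; first exact: levels_lproj.
  move=> v Fv; have [Lv _] := Fv.
  have := innerBl Lu LE Lv; rewrite (inner_lproj J Lu Lv) (levels_ext Fv) subrr => <-.
  by congr (inner _ _).
have [Fh Hh] := getPex (ex_intro _ _ ex).
rewrite /orth_proj; set h := get _ in Fh Hh *; clearbody h.
have [Lh _] := Fh.
pose d z := h z - lproj J u z.
have Ld : L2 d := (L2B Lh LE).1.
have Fd : levels J d.
  split=> // z; rewrite [RHS](lprojB J z Lh LE) (levels_ext Fh) (lproj_lproj uJ Lu) //.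
have d0 : inner d d = 0.
  have -> : inner d d = inner (fun z => u z - lproj J u z) d - inner (fun z => u z - h z) d.
    rewrite -(innerBl (L2B Lu LE).1 (L2B Lu Lh).1 Ld).
    by congr (inner _ d); apply/funext => z; rewrite /d; ring.
  have [_ e1] := ex; have := e1 d Fd; have := Hh d Fd.
  rewrite (_ : u \- h = fun z => u z - h z) // (_ : u \- lproj J u = fun z => u z - lproj J u z) // => -> ->.
  by rewrite subrr.
have n0 : nrm d = 0.
  by move: d0; rewrite inner_nrm // => /eqP; rewrite -normc_eq0 normcR normr_eq0 sqrf_eq0 => /eqP.
apply/funext => z; have /eqP := levels_nrm0 z Fd n0; rewrite subr_eq0 => /eqP //.
Qed.
End LadderOperators.

(** * Compact sesquilinear forms *)

Section CompactForms.
Context {R : realType}.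
Implicit Types (f g h u v : R[i] -> R[i]) (z w x : R[i]) (J : seq nat).
Local Notation form := ((R[i] -> R[i]) -> (R[i] -> R[i]) -> R[i]).
Implicit Types (D E : set (R[i] -> R[i])) (Q : form) (s : nat -> nat) (G : nat -> R[i] -> R[i]).

Definition incr s := {homo s : i j / (i < j)%N}.

Lemma incr_comp s t : incr s -> incr t -> incr (s \o t).
Proof. by move=> hs ht i j ij; apply: hs; exact: ht. Qed.

Lemma incr_le s n : incr s -> (n <= s n)%N.
Proof. by move=> hs; elim: n => // n IH; rewrite (leq_ltn_trans IH) // hs. Qed.

Definition bounded_seq D G :=
  (forall n, D (G n)) /\ exists M : R, forall n, nrm (G n) <= M.

(** Up to a tolerance, compactness of the operator that represents the form: in this
   shape it passes to finite sums and to uniform limits. *)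
Definition cptform D E Q := forall G, bounded_seq D G -> forall e : R, 0 < e ->
  exists s, incr s /\ forall a b h, E h -> normc (Q (G (s a)) h - Q (G (s b)) h) <= e * nrm h.

Lemma bounded_sub D G s : bounded_seq D G -> bounded_seq D (G \o s).
Proof. by move=> [Dg [M HM]]; split=> [n|]; [exact: Dg|exists M => n; exact: HM]. Qed.

Lemma cptform_eq D E Q Q' : (forall g h, D g -> E h -> Q g h = Q' g h) -> cptform D E Q -> cptform D E Q'.
Proof.
move=> QQ' H g Bg e e0; have [s [hs Hs]] := H g Bg e e0; exists s; split => // a b h Eh.
by rewrite -!QQ' ?Hs //; apply: Bg.1.
Qed.

Lemma cptform0 D E : cptform D E (fun _ _ => 0).
Proof.
move=> g _ e e0; exists id; split => // a b h _.
by rewrite subrr normc0 mulr_ge0 ?nrm_ge0 // ltW.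
Qed.

Lemma cptformD D E Q1 Q2 : cptform D E Q1 -> cptform D E Q2 -> cptform D E (fun g h => Q1 g h + Q2 g h).
Proof.
move=> H1 H2 g Bg e e0; have e2 : 0 < e / 2 by rewrite divr_gt0.
have [s [hs Hs]] := H1 g Bg _ e2.
have [t [ht Ht]] := H2 _ (bounded_sub s Bg) _ e2.
exists (s \o t); split; first exact: incr_comp.
move=> a b h Eh; have -> : forall a1 a2 b1 b2 : R[i], a1 + a2 - (b1 + b2) = (a1 - b1) + (a2 - b2).
  by move=> *; ring.
rewrite (le_trans (normcD _ _)) // [e]splitr mulrDl lerD //; first exact: Hs.
exact: (Ht a b).
Qed.

Lemma cptformZ D E c Q : cptform D E Q -> cptform D E (fun g h => c * Q g h).
Proof.
move=> H g Bg e e0; have c1 : 0 < normc c + 1 by rewrite ltr_wpDl ?normc_ge0.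
have [s [hs Hs]] := H g Bg _ (divr_gt0 e0 c1); exists s; split => // a b h Eh.
rewrite -mulrBr normcM (le_trans (ler_wpM2l (normc_ge0 _) (Hs a b h Eh))) //.
rewrite mulrA ler_wpM2r ?nrm_ge0 // mulrA ler_pdivrMr // mulrC ler_wpM2l ?ltW //.
by rewrite ltrDl.
Qed.

Lemma cptform_sum D E (I : Type) (r : seq I) (P : pred I) (F : I -> form) :
  (forall i, P i -> cptform D E (F i)) -> cptform D E (fun g h => \sum_(i <- r | P i) F i g h).
Proof.
move=> H; elim: r => [|i r IH].
  by apply: (@cptform_eq D E _ _ _ (@cptform0 D E)) => g h _ _; rewrite big_nil.
have [Pi|nPi] := boolP (P i); last first.
  by apply: (@cptform_eq D E _ _ _ IH) => g h _ _; rewrite big_cons (negbTE nPi).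
by apply: (@cptform_eq D E _ _ _ (cptformD (H i Pi) IH)) => g h _ _; rewrite big_cons Pi.
Qed.

Lemma cptform_approx D E Q :
  (forall e : R, 0 < e -> exists2 Q', cptform D E Q' &
     forall g h, D g -> E h -> normc (Q g h - Q' g h) <= e * (nrm g * nrm h)) ->
  cptform D E Q.
Proof.
move=> H g Bg e e0; have [Dg [M HM]] := Bg.
have M0 : 0 <= M by rewrite (le_trans (nrm_ge0 (g 0%N))).
have M1 : 0 < 4 * (M + 1) by rewrite mulr_gt0 // ltr_wpDl.
have [Q' CQ' HQ] := H _ (divr_gt0 e0 M1).
have [s [hs Hs]] := CQ' g Bg _ (@divr_gt0 R e 2 e0 ltac:(by [])).
exists s; split => // a b h Eh.
have near n : normc (Q (g n) h - Q' (g n) h) <= e / 4 * nrm h.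
  apply: le_trans (HQ _ _ (Dg n) Eh) _.
  rewrite mulrA ler_wpM2r ?nrm_ge0 // mulrAC ler_pdivrMr // [_ * (4 * _)]mulrA divfK //.
  by rewrite ler_wpM2l ?(ltW e0) // (le_trans (HM n)) // lerDl.
have -> : Q (g (s a)) h - Q (g (s b)) h = (Q (g (s a)) h - Q' (g (s a)) h) -
  (Q (g (s b)) h - Q' (g (s b)) h) + (Q' (g (s a)) h - Q' (g (s b)) h) by ring.
have -> : e * nrm h = e / 4 * nrm h + e / 4 * nrm h + e / 2 * nrm h by field.
apply: le_trans (normcD _ _) _; apply: lerD; last exact: Hs.
by apply: le_trans (normcB _ _) _; apply: lerD; exact: near.
Qed.

Lemma cptform_comp D E D' E' Q (V W : (R[i] -> R[i]) -> R[i] -> R[i]) (c : R) : 0 <= c ->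
  (forall g, D g -> D' (V g) /\ nrm (V g) <= c * nrm g) ->
  (forall h, E h -> E' (W h) /\ nrm (W h) <= c * nrm h) ->
  cptform D' E' Q -> cptform D E (fun g h => Q (V g) (W h)).
Proof.
move=> c0 HV HW H g [Dg [M HM]] e e0.
have c1 : 0 < c + 1 by rewrite ltr_wpDl.
have Bg : bounded_seq D' (fun n => V (g n)).
  split=> [n|]; first exact: (HV _ (Dg n)).1.
  by exists (c * M) => n; rewrite (le_trans (HV _ (Dg n)).2) // ler_wpM2l.
have [s [hs Hs]] := H _ Bg _ (divr_gt0 e0 c1); exists s; split => // a b h Eh.
have [Eh' nh] := HW h Eh.
rewrite (le_trans (Hs a b _ Eh')) // mulrAC ler_pdivrMr // -mulrA ler_wpM2l ?(ltW e0) //.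
by rewrite (le_trans nh) // mulrC ler_wpM2l ?nrm_ge0 // lerDl.
Qed.

(** Points of the unit disc at which the ratios of the points to their conjugates are
   distinct, so that homogeneous polynomials in x and x' can be interpolated. *)
Definition node N k : R[i] := (N.+2%:R^-1) +i* (k%:R / N.+2%:R).

Lemma node_le1 N k : (k <= N)%N -> normc (node N k) <= 1.
Proof.
move=> kN; rewrite (le_trans (normc_le_ReIm _)) //= !ger0_norm ?divr_ge0 ?invr_ge0 //.
rewrite -[X in X + _]mul1r -mulrDl ler_pdivrMr // mul1r.
by rewrite -[1]/(1%:R) -natrD ler_nat add1n ltnS (leq_trans kN).
Qed.

(** After division by the power [N] of the conjugates, a Vandermonde system in the
   ratios of the nodes to their conjugates. *)
Lemma interpolation N j0 : (j0 <= N)%N -> exists al : 'I_N.+1 -> R[i],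
  forall j, (j <= N)%N ->
    \sum_(k < N.+1) al k * (node N k ^+ j * (node N k)^* ^+ (N - j)) = (j == j0)%:R.
Proof.
move=> j0N; pose r (k : nat) := node N k / (node N k)^*.
have p0 : N.+2%:R^-1 != 0 :> R by rewrite invr_neq0 // pnatr_eq0.
have n0 k : node N k != 0 by apply/eqP => /(congr1 (@complex.Re R)) /= /eqP; rewrite (negbTE p0).
have nc0 k : (node N k)^* != 0 by rewrite conjc_eq0.
have r_inj k m : r k = r m -> k = m.
  move=> /eqP; rewrite eqr_div // => /eqP/(congr1 (@complex.Im R)); rewrite !reim /= => E.
  have : N.+2%:R^-1 * (N.+2%:R^-1 * (k%:R - m%:R)) = 0 :> R.
    by set p := N.+2%:R^-1 in E *; clearbody p; lra.
  move/eqP; rewrite !mulf_eq0 (negbTE p0) /= subr_eq0 eqr_nat => /eqP //.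
pose rr : 'rV[R[i]]_N.+1 := \row_k r k.
have V1 : Vandermonde N.+1 rr \in unitmx.
  rewrite unitmxE det_Vandermonde unitfE; apply/prodf_neq0 => i _; apply/prodf_neq0 => j ij.
  rewrite !mxE subr_eq0; apply/eqP => /r_inj E.
  by move: ij; rewrite E ltnn.
pose be := invmx (Vandermonde N.+1 rr) *m delta_mx (inord j0) (0 : 'I_1).
exists (fun k => be k 0 / (node N k)^* ^+ N) => j jN.
have := congr1 (fun M : 'cV[R[i]]_N.+1 => M (inord j) 0) (mulKVmx V1 (delta_mx (inord j0) (0 : 'I_1))).
rewrite -/be !mxE eqxx andbT.
have -> : (inord j == inord j0 :> 'I_N.+1) = (j == j0) by rewrite -val_eqE /= !inordK.
move=> <-; apply: eq_bigr => k _; rewrite !mxE inordK // /r expr_div_n.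
have -> : node N k ^+ j / (node N k)^* ^+ j = node N k ^+ j * (node N k)^* ^+ (N - j) / (node N k)^* ^+ N.
  have -> : (node N k)^* ^+ N = (node N k)^* ^+ (N - j) * (node N k)^* ^+ j by rewrite -exprD subnK.
  by field; rewrite !expf_neq0.
by rewrite mulrAC -mulrA mulrC.
Qed.

(** By induction on the total degree [N] of the coefficient. Once the terms of lower
   degree are known to be compact, they can be subtracted from [q (t u)], and division by
   [t ^ N] leaves the terms of degree [N] up to [O(t)]. Varying the direction [u] separates
   these terms by [interpolation]. *)
Lemma cptform_coef D E (q : R[i] -> form) (c : nat -> nat -> form) (K1 : nat -> R) (K2 : nat -> nat -> R) :
  (forall x, normc x <= 1 -> cptform D E (q x)) ->
  (forall N x g h, normc x <= 1 -> D g -> E h ->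
     normc (q x g h - \sum_(p : 'I_N * 'I_N) x ^+ p.1 * x^* ^+ p.2 * c p.1 p.2 g h) <=
     K1 N * normc x ^+ N * (nrm g * nrm h)) ->
  (forall j l g h, D g -> E h -> normc (c j l g h) <= K2 j l * (nrm g * nrm h)) ->
  forall j l, cptform D E (c j l).
Proof.
move=> Hq Hexp Hc j l; move: {2}(j + l)%N (leqnn (j + l)) => N.
elim/ltn_ind: N j l => N IH j l; rewrite leq_eqVlt => /orP[/eqP jl|jl]; last first.
  exact: (IH (j + l)%N).
pose d (u : R[i]) : form := fun g h => \sum_(p : 'I_N.+1 * 'I_N.+1 | (p.1 + p.2)%N == N)
  u ^+ p.1 * u^* ^+ p.2 * c p.1 p.2 g h.
have Hd (u : R[i]) : normc u <= 1 -> cptform D E (d u).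
  move=> u1; apply: cptform_approx => e e0.
  pose K := `|K1 N.+1| + \sum_(p : 'I_N.+1 * 'I_N.+1) `|K2 p.1 p.2|.
  have K0 : 0 <= K by rewrite addr_ge0 // sumr_ge0.
  have K3 : 0 < K + 1 by rewrite ltr_wpDl.
  pose t := Num.min 1 (e / (K + 1)).
  have t0 : 0 < t by rewrite lt_min ltr01 divr_gt0.
  have t1 : t <= 1 by rewrite ge_min lexx.
  have te : t * K <= e.
    apply: (@le_trans _ _ (t * (K + 1))); first by rewrite ler_wpM2l ?(ltW t0) // lerDl.
    by rewrite -ler_pdivlMr // !ge_min lexx orbT.
  pose x := t%:C * u.
  have nx : normc x <= t by rewrite normcM normcR gtr0_norm // ler_piMr // ltW.
  have x1 : normc x <= 1 by exact: le_trans t1.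
  have tc0 : t%:C != 0 :> R[i] by rewrite -normc_gt0 normcR gtr0_norm.
  (* Compact by the induction hypothesis. *)
  pose low : form := fun g h => \sum_(p : 'I_N.+1 * 'I_N.+1 | (p.1 + p.2 < N)%N)
    x ^+ p.1 * x^* ^+ p.2 * c p.1 p.2 g h.
  exists (fun g h => t%:C^-1 ^+ N * (q x g h + (-1) * low g h)).
    apply: cptformZ; apply: cptformD; first exact: Hq.
    apply: cptformZ; apply: cptform_sum => p pN; apply: cptformZ.
    exact: IH pN _ _ (leqnn _).
  move=> g h Dg Eh.
  pose T (p : 'I_N.+1 * 'I_N.+1) := x ^+ p.1 * x^* ^+ p.2 * c p.1 p.2 g h.
  have split3 : \sum_p T p = low g h + t%:C ^+ N * d u g h +
      \sum_(p : 'I_N.+1 * 'I_N.+1 | (N < p.1 + p.2)%N) T p.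
    rewrite (bigID (fun p : 'I_N.+1 * 'I_N.+1 => (p.1 + p.2 < N)%N)) /= -addrA; congr (_ + _).
    rewrite (bigID (fun p : 'I_N.+1 * 'I_N.+1 => (p.1 + p.2)%N == N)) /=; congr (_ + _).
      rewrite /d mulr_sumr; apply: eq_big => [p|p /andP[_ /eqP pN]].
        by case: (ltngtP (p.1 + p.2)%N N).
      rewrite /T /x conjM conj_real !exprMn -[in t%:C ^+ N]pN exprD; ring.
    by apply: eq_bigl => p; case: (ltngtP (p.1 + p.2)%N N).
  have E1 : d u g h - t%:C^-1 ^+ N * (q x g h + -1 * low g h) =
     t%:C^-1 ^+ N * ((\sum_(p : 'I_N.+1 * 'I_N.+1 | (N < p.1 + p.2)%N) - T p) -
       (q x g h - \sum_p T p)).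
    rewrite split3 sumrN exprVn; field; exact: expf_neq0.
  rewrite E1 normcM normcX normcV normcR gtr0_norm // exprVn mulrC ler_pdivrMr ?exprn_gt0 //.
  have ng : 0 <= nrm g * nrm h by rewrite mulr_ge0 ?nrm_ge0.
  have b1 : normc (q x g h - \sum_p T p) <= `|K1 N.+1| * t ^+ N.+1 * (nrm g * nrm h).
    apply: le_trans (Hexp N.+1 x g h x1 Dg Eh) _; rewrite ler_wpM2r //.
    apply: (@le_trans _ _ (`|K1 N.+1| * normc x ^+ N.+1)).
      by rewrite ler_wpM2r ?exprn_ge0 ?normc_ge0 ?ler_norm.
    by rewrite ler_wpM2l //; apply: lerXn2r; rewrite ?nnegrE ?normc_ge0 ?(ltW t0).
  have b2 : normc (\sum_(p : 'I_N.+1 * 'I_N.+1 | (N < p.1 + p.2)%N) - T p) <=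
     (\sum_(p : 'I_N.+1 * 'I_N.+1) `|K2 p.1 p.2|) * t ^+ N.+1 * (nrm g * nrm h).
    rewrite big_mkcond /= !mulr_suml; apply: le_trans (normc_sum _ _) _.
    apply: ler_sum => p _; case: ifP => [pN|_]; last first.
      by rewrite normc0 !mulr_ge0 ?nrm_ge0 // exprn_ge0 // ltW.
    rewrite normcNE !normcM !normcX normcJ -exprD -mulrA mulrCA.
    apply: ler_pM; rewrite ?exprn_ge0 ?normc_ge0 //.
      apply: (@le_trans _ _ (t ^+ (p.1 + p.2))).
        by apply: lerXn2r; rewrite ?nnegrE ?normc_ge0 ?(ltW t0).
      by apply: ler_wiXn2l => //; exact: ltW.
    by rewrite (le_trans (Hc _ _ _ _ Dg Eh)) // ler_wpM2r // ler_norm.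
  have -> : e * (nrm g * nrm h) * t ^+ N = e * t ^+ N * (nrm g * nrm h) by ring.
  apply: (@le_trans _ _ (K * t ^+ N.+1 * (nrm g * nrm h))).
    apply: le_trans (normcB _ _) (le_trans (lerD b2 b1) _).
    by rewrite /K -!mulrDl addrC.
  by rewrite ler_wpM2r // exprS mulrA ler_wpM2r ?exprn_ge0 ?(ltW t0) // mulrC.
have jN : (j <= N)%N by rewrite -jl leq_addr.
have [al Hal] := interpolation jN.
apply: (@cptform_eq D E (fun g h => \sum_(k < N.+1) al k * d (node N k) g h)) => [g h _ _|]; last first.
  apply: cptform_sum => k _; apply: cptformZ; apply: Hd; apply: node_le1.
  by rewrite -ltnS.
have lN : (l <= N)%N by rewrite -jl leq_addl.
under eq_bigr do rewrite /d mulr_sumr.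
have S (p : 'I_N.+1 * 'I_N.+1) : (p.1 + p.2)%N == N ->
    \sum_(k < N.+1) al k * (node N k ^+ p.1 * (node N k)^* ^+ p.2 * c p.1 p.2 g h) =
    (p.1 == j :> nat)%:R * c p.1 p.2 g h.
  move=> /eqP pN; rewrite -Hal -?[X in (_ <= X)%N]pN ?leq_addr // mulr_suml; apply: eq_bigr => k _.
  have -> : (N - p.1)%N = p.2.
    by apply/eqP; rewrite -(eqn_add2l p.1) subnKC ?pN // -ltnS.
  by rewrite !mulrA.
rewrite exchange_big (bigD1 (inord j, inord l)); last by rewrite /= !inordK // jl.
rewrite S; last by rewrite /= !inordK // jl.
rewrite big1 => [|p /andP[pN pjl]].
  by rewrite Monoid.mulm1 /= !inordK // eqxx mul1r.
rewrite S //; case: eqP => [pj|]; last by rewrite mul0r.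
case/eqP: pjl; case: p pN pj => p1 p2 /= /eqP pN pj; congr (_, _); apply: val_inj; rewrite /= inordK //.
by apply/eqP; rewrite -(eqn_add2l j) -{1}pj pN jl.
Qed.

End CompactForms.

(** * Weyl translations of a Toeplitz operator *)

Section WeylExpansion.
Context {R : realType}.
Local Notation fcR := (@fc R).
Local Notation opcR := (@opc R).
Implicit Types (g h u v : R[i] -> R[i]) (z w x : R[i]).

(** [tc (phix x)] is the generating function of the [Bop j], see [tc_phix_expand]; on
   level 0 it is a translation up to a factor, see [tc_phix_F1]. *)
Definition phix x z := cexp (- (x * z^*)).
(** The Weyl translation by [x], an isometry of level 0. *)
Definition Wx x g z := g (z + x) * cexp (- (z * x^*) - (normc x ^+ 2 / 2)%:C).

Lemma meas_phix x : measurable_fun setT (phix x).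
Proof.
apply: measC_cexp; apply: measC_N; apply: measC_M; first exact: measC_cst.
by apply: measC_J; exact: measurable_id.
Qed.

Lemma normc_xv x z : normc (- (x * z^*)) = normc x * normc z.
Proof. by rewrite normcNE normcM normcJ. Qed.

Lemma tame_phix x : normc x <= 1 -> tame (expR 1) (phix x).
Proof.
move=> x1; have -> : expR 1 = 1 * expR ((0%:R + 1) ^+ 2) :> R by rewrite add0r expr1n mul1r.
apply: tame_poly_exp => // [|z]; first exact: meas_phix.
rewrite mul1r expr0 !mul1r normc_cexp ler_expR (le_trans (ler_norm _)) //.
by rewrite (le_trans (normc_Re _)) // normc_xv ler_piMl ?normc_ge0.
Qed.

Definition rest N x z := phix x z - \sum_(j < N) (x ^+ j * fcR j) * raise j z.

Lemma tame_rest N x : normc x <= 1 -> tame (normc x ^+ N * expR ((N%:R + 1) ^+ 2)) (rest N x).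
Proof.
move=> x1; apply: tame_poly_exp => [||z]; last 2 first.
- by rewrite exprn_ge0 ?normc_ge0.
- have -> : rest N x z = cexp (- (x * z^*)) - texp N (- (x * z^*)).
    rewrite /rest /phix /texp; congr (_ - _); apply: eq_bigr => j _.
    by rewrite fcE /raise -mulrN exprMn mulrAC [RHS]mulrC.
  rewrite (le_trans (texp_le _ _)) // normc_xv exprMn -mulrA ler_wpM2l ?exprn_ge0 ?normc_ge0 //.
  by rewrite ler_wpM2l ?exprn_ge0 ?normc_ge0 // ler_expR mul1r ler_piMl ?normc_ge0.
apply: measC_B; first exact: meas_phix.
elim: N => [|N IH]; first by under eq_fun do rewrite big_ord0; exact: measC_cst.
under eq_fun do rewrite big_ord_recr; apply: measC_D => //.
by apply: measC_M; [exact: measC_cst|case: (@tame_raise R N)].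
Qed.

Lemma tc_phix_F1 x g z : F1 g -> tc (phix x) g z = cexp (- (x * z^*)) * g (z + x).
Proof.
move=> [Lg ->]; rewrite /tc /wexp -cintZ //; last exact/wint_cintegrable/wint_L2.
apply: eq_cint => w _; rewrite [RHS]mulrCA; congr (_ * _).
by rewrite /tck /phix conjB -!cexpD; congr cexp; ring.
Qed.

Lemma Wx_F1 x g : F1 g -> F1 (Wx x g) /\ nrm (Wx x g) = nrm g.
Proof.
move=> Fg; have [Lg gE] := Fg.
have hg : holo g.
  by have -> : g = wexp g by [apply/funext => z]; exact/holo_wexp/wint_L2.
have hW : holo (Wx x g).
  apply: holoM.
    by apply: (holo_comp (f := fun z => z + x)) hg; apply: holoD holo_id _; exact: holo_cst.
  apply: (holo_comp (f := fun z => - (z * x^*) - (normc x ^+ 2 / 2)%:C)) holo_cexp.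
  by apply: holoD (holo_cst _); apply: holoN; apply: holoM holo_id _; exact: holo_cst.
pose r w : R := normc (g w) ^+ 2 * expR (- (complex.Re (w * x^*) *+ 2 - normc x ^+ 2)).
have r0 w : 0 <= r w by rewrite mulr_ge0 ?sqr_ge0 ?expR_ge0.
have mg := holo_meas hg.
have mr : measurable_fun setT r.
  apply: measurable_funM; first by apply: measurable_funX; exact: meas_normc.
  by apply: measurableT_comp => //; apply: measurable_funN; exact: measurable_shift_exponent.
have E1 z : normc (Wx x g z) ^+ 2 = r (z + x).
  rewrite /Wx /r normcM exprMn; congr (_ * _).
  rewrite normc_cexp -expRM_natl; congr expR; rewrite normc2 !reim /=.
  by clear; field.
have E2 w : r w * expR (complex.Re (w * x^*) *+ 2 - normc x ^+ 2) = normc (g w) ^+ 2.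
  by rewrite /r -mulrA -expRD addNr expR0 mulr1.
have E3 : (\int[mu]_z (normc (Wx x g z) ^+ 2)%:E = \int[mu]_z (normc (g z) ^+ 2)%:E)%E.
  under eq_integral do rewrite E1.
  by rewrite (ge0_mu_shift x mr r0); under eq_integral do rewrite E2.
have LW : L2 (Wx x g).
  split; first exact: holo_meas.
  apply/integrableP; split.
    by apply/measurable_EFinP; apply: measurable_funX; apply: meas_normc; exact: holo_meas.
  under eq_integral do rewrite abse_EFin ger0_norm ?sqr_ge0 //.
  rewrite E3; case: Lg => _ /integrableP[_]; apply: le_lt_trans.
  rewrite le_eqVlt; apply/orP; left; apply/eqP; apply: eq_integral => w _.
  by rewrite abse_EFin ger0_norm ?sqr_ge0.
split; first exact: holo_F1.
apply: (@pexpIrn _ 2) => //; rewrite ?nnegrE ?nrm_ge0 //.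
by apply: EFin_inj; rewrite !nrm_sqrE.
Qed.

Section Symbol.
Variables (f : R[i] -> R[i]) (Mf : R).
Hypotheses (Mf0 : 0 <= Mf)
  (Hf : forall u, L2 u -> L2 (fun z => f z * u z) /\ nrm (fun z => f z * u z) <= Mf * nrm u).

(** The form of the Toeplitz operator on level 0, transported by [tc (phix x)]. *)
Definition qform x g h := inner (fun z => f z * tc (phix x) g z) (tc (phix x) h).
(** The blocks of the Toeplitz operator, as forms on level 0. *)
Definition cform j l g h := fcR j * fcR l * inner (fun z => f z * Bop j g z) (Bop l h).

Lemma inner_f_le u v : L2 u -> L2 v -> normc (inner (fun z => f z * u z) v) <= Mf * (nrm u * nrm v).
Proof.
move=> Lu Lv; have [L n] := Hf Lu.
by rewrite (le_trans (inner_CS L Lv)) // mulrA ler_wpM2r ?nrm_ge0.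
Qed.

Lemma cform_le j l g h : L2 g -> L2 h ->
  normc (cform j l g h) <= (normc (fcR j) * normc (fcR l) * (Mf * (opcR j * opcR l))) * (nrm g * nrm h).
Proof.
move=> Lg Lh; have [Lb nb] := Bop_L2 j Lg; have [Lc nc] := Bop_L2 l Lh.
rewrite /cform (normcM (_ * _)) (normcM (fcR j)) -!mulrA.
apply: ler_wpM2l; first exact: normc_ge0.
apply: ler_wpM2l; first exact: normc_ge0.
apply: le_trans (inner_f_le Lb Lc) _; apply: ler_wpM2l => //.
have -> : opcR j * (opcR l * (nrm g * nrm h)) = (opcR j * nrm g) * (opcR l * nrm h) by ring.
by apply: ler_pM; rewrite ?nrm_ge0.
Qed.

Lemma tc_phix_expand N x u z : normc x <= 1 -> L2 u ->
  tc (phix x) u z = \sum_(j < N) (x ^+ j * fcR j) * Bop j u z + tc (rest N x) u z.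
Proof.
move=> x1 Lu; have iB j := tc_cintegrable z (tame_raise j) Lu.
have iBs : forall j : 'I_N, cintegrable mu setT (fun w => (x ^+ j * fcR j) * (u w * tck (raise j) z w)).
  by move=> j; apply: cintegrableZ => //; exact: iB.
have [i1 e1] := cint_sum measurableT (index_enum 'I_N) iBs.
have -> : \sum_(j < N) (x ^+ j * fcR j) * Bop j u z =
   cint mu setT (fun w => \sum_(j < N) (x ^+ j * fcR j) * (u w * tck (raise j) z w)).
  rewrite e1; apply: eq_bigr => j _; rewrite BopE /tc cintZ //; exact: iB.
rewrite /tc -cintD //; last exact: (tc_cintegrable z (tame_rest N x1)).
apply: eq_cint => w _.
have -> : \sum_(j < N) (x ^+ j * fcR j) * (u w * tck (raise j) z w) =
    u w * ((\sum_(j < N) (x ^+ j * fcR j) * raise j (z - w)) * cexp (z * w^*)).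
  by rewrite mulr_suml mulr_sumr; apply: eq_bigr => j _; rewrite /tck; ring.
by rewrite /tck /rest; ring.
Qed.

Definition restc (N : nat) : R := expR ((N%:R + 1) ^+ 2) * (@gmass R / pi).
Definition phic : R := expR 1 * (@gmass R / pi).

Lemma restc_ge0 N : 0 <= restc N.
Proof. by rewrite mulr_ge0 ?expR_ge0 // divr_ge0 ?gmass_ge0 ?pi_ge0. Qed.

Lemma phic_ge0 : 0 <= phic.
Proof. by rewrite mulr_ge0 ?expR_ge0 // divr_ge0 ?gmass_ge0 ?pi_ge0. Qed.

Lemma rest_L2 N x u : normc x <= 1 -> L2 u ->
  L2 (tc (rest N x) u) /\ nrm (tc (rest N x) u) <= restc N * normc x ^+ N * nrm u.
Proof.
move=> x1 Lu; have [L n] := tc_L2 (tame_rest N x1) Lu; split => //.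
rewrite (le_trans n) // /restc mulrC [X in _ <= X]mulrC; apply: ler_wpM2l; rewrite ?nrm_ge0 //.
by rewrite le_eqVlt; apply/orP; left; apply/eqP; ring.
Qed.

Lemma phix_L2 x u : normc x <= 1 -> L2 u ->
  L2 (tc (phix x) u) /\ nrm (tc (phix x) u) <= phic * nrm u.
Proof. by move=> x1 Lu; exact: (tc_L2 (tame_phix x1) Lu). Qed.

Lemma qform_expand N x g h : normc x <= 1 -> L2 g -> L2 h ->
  normc (qform x g h - \sum_(p : 'I_N * 'I_N) x ^+ p.1 * x^* ^+ p.2 * cform p.1 p.2 g h) <=
  (Mf * (2 * (phic * restc N) + restc N ^+ 2)) * normc x ^+ N * (nrm g * nrm h).
Proof.
move=> x1 Lg Lh.
pose P u z := \sum_(j < N) (x ^+ j * fcR j) * Bop j u z.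
have LP u : L2 u -> forall j : 'I_N, L2 (fun z => (x ^+ j * fcR j) * Bop j u z).
  by move=> Lu j; apply: (L2Z _ (Bop_L2 j Lu).1).1.
have PL2 u : L2 u -> L2 (P u) by move=> Lu; exact: (L2_sum _ (LP u Lu)).1.
have PE u : L2 u -> P u = fun z => tc (phix x) u z - tc (rest N x) u z.
  by move=> Lu; apply/funext => z; rewrite (tc_phix_expand N z x1 Lu) addrK.
have -> : \sum_(p : 'I_N * 'I_N) x ^+ p.1 * x^* ^+ p.2 * cform p.1 p.2 g h =
    inner (fun z => f z * P g z) (P h).
  have -> : (fun z => f z * P g z) = fun z => \sum_(j < N) (x ^+ j * fcR j) * (f z * Bop j g z).
    by apply/funext => z; rewrite mulr_sumr; apply: eq_bigr => j _; rewrite mulrCA.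
  have Lf (j : 'I_N) : L2 (fun z => (x ^+ j * fcR j) * (f z * Bop j g z)).
    by apply: (L2Z _ _).1; apply: (Hf _).1; exact: (Bop_L2 j Lg).1.
  rewrite (inner_suml _ Lf (PL2 h Lh)) -(pair_bigA _ (fun j l : 'I_N => x ^+ j * x^* ^+ l * cform j l g h)) /=.
  apply: eq_bigr => j _; rewrite (inner_sumr _ (LP h Lh) (Lf j)); apply: eq_bigr => l _.
  rewrite (innerZl _ (Hf (Bop_L2 j Lg).1).1 (LP h Lh l)).
  rewrite (innerZr _ (Bop_L2 l Lh).1 (Hf (Bop_L2 j Lg).1).1) conjM conjX fcJ /cform.
  ring.
have [LSg nSg] := phix_L2 x1 Lg; have [LSh nSh] := phix_L2 x1 Lh.
have [Lrg nrg] := rest_L2 N x1 Lg; have [Lrh nrh] := rest_L2 N x1 Lh.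
set t := normc x ^+ N in nrg nrh *.
have t0 : 0 <= t by rewrite exprn_ge0 ?normc_ge0.
have t1 : t <= 1 by rewrite exprn_ile1 ?normc_ge0.
have -> : qform x g h - inner (fun z => f z * P g z) (P h) =
  inner (fun z => f z * tc (rest N x) g z) (tc (phix x) h) +
  (inner (fun z => f z * tc (phix x) g z) (tc (rest N x) h) -
   inner (fun z => f z * tc (rest N x) g z) (tc (rest N x) h)).
  rewrite (PE g Lg) (PE h Lh) /qform.
  have innerBr a b c : L2 a -> L2 b -> L2 c -> inner c (fun z => a z - b z) = inner c a - inner c b.
    move=> La Lb Lc; rewrite (innerJ (L2B La Lb).1 Lc) (innerBl La Lb Lc) conjB.
    by rewrite -(innerJ La Lc) -(innerJ Lb Lc).
  have -> : (fun z => f z * (tc (phix x) g z - tc (rest N x) g z)) =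
      fun z => f z * tc (phix x) g z - f z * tc (rest N x) g z.
    by apply/funext => z; rewrite mulrBr.
  have [Fa _] := Hf LSg; have [Fb _] := Hf Lrg.
  rewrite (innerBr _ _ _ LSh Lrh (L2B Fa Fb).1) (innerBl Fa Fb LSh) (innerBl Fa Fb Lrh).
  have alg (a b c d : R[i]) : a - (a - b - (c - d)) = b + (c - d) by ring.
  exact: alg.
have bound a b ca cb : L2 a -> L2 b -> nrm a <= ca * nrm g -> nrm b <= cb * nrm h -> 0 <= ca ->
    normc (inner (fun z => f z * a z) b) <= Mf * (ca * cb) * (nrm g * nrm h).
  move=> La Lb na nb ca0; apply: le_trans (inner_f_le La Lb) _.
  rewrite -mulrA; apply: ler_wpM2l => //.
  have -> : ca * cb * (nrm g * nrm h) = (ca * nrm g) * (cb * nrm h) by ring.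
  by apply: ler_pM; rewrite ?nrm_ge0.
have r0 := restc_ge0 N; have p0 := phic_ge0.
have b1 := bound _ _ _ _ Lrg LSh nrg nSh (mulr_ge0 r0 t0).
have b2 := bound _ _ _ _ LSg Lrh nSg nrh p0.
have b3 := bound _ _ _ _ Lrg Lrh nrg nrh (mulr_ge0 r0 t0).
apply: le_trans (normcD _ _) _; apply: le_trans (lerD b1 (le_trans (normcB _ _) (lerD b2 b3))) _.
have n0 : 0 <= nrm g * nrm h by rewrite mulr_ge0 ?nrm_ge0.
rewrite -!mulrDl; apply: ler_wpM2r => //; rewrite -!mulrDr -[leRHS]mulrA; apply: ler_wpM2l => //.
have tt : t * t <= t by rewrite ler_piMr.
have := ler_wpM2l (sqr_ge0 (restc N)) tt.
set ro := restc N; set si := phic; clearbody ro si t => H.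
have -> : ro * t * si + (si * (ro * t) + ro * t * (ro * t)) = 2 * (si * ro) * t + ro ^+ 2 * (t * t) by ring.
by rewrite [leRHS]mulrDl lerD2l.
Qed.

(** Up to the constant [e^{|x|^2}] and a unimodular factor that cancels, [qform x] is
   [qform 0] moved by the isometry [Wx x] of level 0. *)
Lemma cptform_qform x : cptform (@F1 R) (@F1 R) (fun g h => inner (fun z => f z * g z) h) ->
  cptform (@F1 R) (@F1 R) (qform x).
Proof.
move=> H.
apply: (@cptform_eq _ (@F1 R) (@F1 R) (fun g h => (expR (normc x ^+ 2))%:C *
    inner (fun z => f z * Wx x g z) (Wx x h))) => [g h Fg Fh|]; last first.
  apply: cptformZ; apply: (@cptform_comp _ (@F1 R) (@F1 R) (@F1 R) (@F1 R) _ (Wx x) (Wx x) 1 ler01 _ _ H);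
  by move=> g Fg; have [? ->] := Wx_F1 x Fg; rewrite mul1r.
have [Lg _] := Fg; have [Lh _] := Fh.
have [[LWg _] _] := Wx_F1 x Fg; have [[LWh _] _] := Wx_F1 x Fh.
rewrite /qform !innerE -cintZ //; last exact: (inner_int (Hf LWg).1 LWh).
apply: eq_cint => z _; rewrite (tc_phix_F1 x z Fg) (tc_phix_F1 x z Fh) /Wx !conjM !cexpJ -cexpR.
set a := g _; set b := (h _)^*.
have -> : cexp (normc x ^+ 2)%:C * (f z * (a * cexp (- (z * x^*) - (normc x ^+ 2 / 2)%:C)) *
    (b * cexp (- (z * x^*) - (normc x ^+ 2 / 2)%:C)^*)) = f z * a * b * (cexp (normc x ^+ 2)%:C *
    (cexp (- (z * x^*) - (normc x ^+ 2 / 2)%:C) * cexp (- (z * x^*) - (normc x ^+ 2 / 2)%:C)^*)) by ring.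
have -> : f z * (cexp (- (x * z^*)) * a) * (cexp (- (x * z^*))^* * b) =
   f z * a * b * (cexp (- (x * z^*)) * cexp (- (x * z^*))^*) by ring.
congr (_ * _); rewrite -!cexpD; congr cexp.
by apply: complexP; rewrite ?reim /= ?reim /= ?reim /=; field.
Qed.

Lemma cptform_cform j l : cptform (@F1 R) (@F1 R) (fun g h => inner (fun z => f z * g z) h) ->
  cptform (@F1 R) (@F1 R) (cform j l).
Proof.
move=> H; apply: (@cptform_coef _ (@F1 R) (@F1 R) qform cform
  (fun N => Mf * (2 * (phic * restc N) + restc N ^+ 2))
  (fun j l => normc (fcR j) * normc (fcR l) * (Mf * (opcR j * opcR l)))).
- by move=> x _; exact: cptform_qform.
- by move=> N x g h x1 [Lg _] [Lh _]; exact: qform_expand.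
- by move=> j' l' g h [Lg _] [Lh _]; exact: cform_le.
Qed.

(** Expanding both sides over the levels leaves finitely many blocks, moved to level 0
   by bounded operators. *)
Lemma cptform_lproj J : cptform (@F1 R) (@F1 R) (fun g h => inner (fun z => f z * g z) h) ->
  cptform (levels J) L2 (fun g u => inner (lproj J (fun z => f z * g z)) u).
Proof.
move=> H; apply: (@cptform_eq _ (levels J) L2 (fun g u => \sum_(j <- J) \sum_(l <- J)
    cform j l (Aop j g) (Aop l u))) => [g u Fg Lu|]; last first.
  apply: cptform_sum => j _; apply: cptform_sum => l _.
  apply: (@cptform_comp _ (levels J) L2 (@F1 R) (@F1 R) (cform j l) (Aop j) (Aop l) (opcR j + opcR l)).
  - by rewrite addr_ge0 ?opc_ge0.
  - move=> g [Lg _]; split; first exact: F1_Aop.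
    apply: le_trans (Aop_L2 j Lg).2 _; apply: ler_wpM2r; first exact: nrm_ge0.
    by rewrite lerDl opc_ge0.
  - move=> g Lg; split; first exact: F1_Aop.
    apply: le_trans (Aop_L2 l Lg).2 _; apply: ler_wpM2r; first exact: nrm_ge0.
    by rewrite lerDr opc_ge0.
  - exact: cptform_cform.
have [Lg gE] := Fg; have [Lfg _] := Hf Lg.
rewrite (inner_lproj J Lfg Lu).
have LB j v : L2 v -> L2 (fun z => fcR j * Bop j (Aop j v) z).
  by move=> Lv; exact: (L2Z _ (BA_L2 j Lv).1).1.
have -> : (fun z => f z * g z) = fun z => \sum_(j <- J) fcR j * (f z * Bop j (Aop j g) z).
  apply/funext => z; rewrite {1}gE /lproj mulr_sumr; apply: eq_bigr => j _.
  by rewrite mulrCA.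
have LfB j : L2 (fun z => fcR j * (f z * Bop j (Aop j g) z)).
  by apply: (L2Z _ _).1; apply: (Hf _).1; exact: (BA_L2 j Lg).1.
rewrite (inner_suml J LfB (lproj_L2 J Lu).1); apply: eq_bigr => j _.
rewrite (inner_sumr J (fun l => LB l u Lu) (LfB j)); apply: eq_bigr => l _.
rewrite (innerZl _ (Hf (BA_L2 j Lg).1).1 (LB l u Lu)).
by rewrite (innerZr _ (BA_L2 l Lu).1 (Hf (BA_L2 j Lg).1).1) fcJ /cform mulrA.
Qed.

End Symbol.
End WeylExpansion.

(** * Toeplitz operators on finitely many levels *)

Section Subsequences.
Context {R : realType}.
Implicit Types (s : nat -> nat).

(** Cantor's diagonal subsequence. *)
Lemma diagonal (X : Type) (x : nat -> X) (P : nat -> X -> X -> Prop) :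
  (forall k s, incr s -> exists t, incr t /\ forall a b, P k (x (s (t a))) (x (s (t b)))) ->
  exists s, incr s /\ forall k m n, (k < m)%N -> (k < n)%N -> P k (x (s m)) (x (s n)).
Proof.
move=> H.
have [nxt Hn] : exists nxt : nat -> (nat -> nat) -> nat -> nat, forall k s, incr s ->
    incr (nxt k s) /\ forall a b, P k (x (s (nxt k s a))) (x (s (nxt k s b))).
  have K (ks : nat * (nat -> nat)) : exists t, incr ks.2 ->
      incr t /\ forall a b, P ks.1 (x (ks.2 (t a))) (x (ks.2 (t b))).
    have [hs|ns] := pselect (incr ks.2); last by exists id.
    by have [t Ht] := H ks.1 ks.2 hs; exists t.
  have [F HF] := choice K; exists (fun k s => F (k, s)) => k s; exact: (HF (k, s)).
(* [S n] has the properties [P k] for [k < n]; beyond index [n], the diagonal is a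
   subsequence of [S n]. *)
pose S := fix S n := if n is n'.+1 then S n' \o nxt n' (S n') else id.
have iS n : incr (S n).
  by elim: n => [|n IH] //=; apply: incr_comp => //; exact: (Hn n _ IH).1.
have tail n m : (n <= m)%N -> exists t, incr t /\ S m = S n \o t.
  move=> /subnKC <-; elim: (m - n)%N => [|k [t [it E]]]; first by exists id; split => //; rewrite addn0.
  rewrite addnS; exists (t \o nxt (n + k)%N (S (n + k)%N)); split.
    by apply: incr_comp => //; exact: (Hn _ _ (iS _)).1.
  by rewrite /= {1}E.
exists (fun n => S n n); split.
  move=> i j ij; have [t [it ->]] := tail _ _ (ltnW ij).
  by apply: iS; rewrite (leq_trans ij) // incr_le.
move=> k m n km kn; have [t [_ ->]] := tail _ _ km; have [t' [_ ->]] := tail _ _ kn.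
exact: (Hn k _ (iS k)).2.
Qed.

End Subsequences.

Section Completeness.
Context {R : realType}.
Implicit Types (g h u : R[i] -> R[i]) (J : seq nat) (G : nat -> R[i] -> R[i]).

(** Fatou's lemma for pointwise limits. *)
Lemma L2_limit G h (e : R) : (forall n, L2 (G n)) -> measurable_fun setT h -> 0 <= e ->
  (forall z (d : R), 0 < d -> exists N, forall n, (N <= n)%N -> normc (G n z - h z) <= d) ->
  (forall n, nrm (G n) <= e) -> L2 h /\ nrm h <= e.
Proof.
move=> LG mh e0 lim bnd.
pose F n z := ((normc (G n z) ^+ 2)%:E : \bar R).
have mF n : measurable_fun setT (F n).
  by apply/measurable_EFinP; apply: measurable_funX; apply: meas_normc; case: (LG n).
have F0 n z : (0 <= F n z)%E by rewrite lee_fin sqr_ge0.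
have cv z : F ^~ z @ \oo --> (normc (h z) ^+ 2)%:E.
  apply: cvg_EFin; first by apply: nearW.
  have cvn : (fun n => normc (G n z)) @ \oo --> normc (h z).
    apply/cvgrPdist_le => d d0; have [N HN] := lim z d d0.
    by exists N => // n /= /HN; apply: le_trans; rewrite distrC; exact: ler_dist_normc.
  have -> : fine \o F ^~ z = fun n => normc (G n z) * normc (G n z) by apply/funext => n; rewrite -expr2.
  by rewrite expr2; exact: cvgM.
have fat := fatou mu measurableT mF (fun n z _ => F0 n z).
have E : (\int[mu]_z (normc (h z) ^+ 2)%:E <= (e ^+ 2)%:E)%E.
  rewrite (eq_integral (fun z => limn_einf (F ^~ z))); last first.
    by move=> z _; rewrite is_cvg_limn_einfE ?(cvg_lim _ (cv z)) //; apply/cvg_ex; eexists; exact: cv.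
  apply: le_trans fat _.
  have b n : (\int[mu]_z F n z <= (e ^+ 2)%:E)%E.
    rewrite /F -(nrm_sqrE (LG n)) lee_fin; apply: lerXn2r => //; rewrite nnegrE //.
    exact: nrm_ge0.
  rewrite limn_einf_lim; apply: lime_le; first exact: is_cvg_einfs.
  apply: nearW => n; apply: le_trans (b n); apply: ereal_inf_lbound.
  by exists n => /=.
have Lh : L2 h.
  split => //; apply/integrableP; split.
    by apply/measurable_EFinP; apply: measurable_funX; exact: meas_normc.
  under eq_integral do rewrite abse_EFin ger0_norm ?sqr_ge0 //.
  exact: le_lt_trans E (ltry _).
split => //; move: E; rewrite -(nrm_sqrE Lh) lee_fin ler_pXn2r ?nnegrE ?nrm_ge0 //.
Qed.

Lemma seq_cauchy_cvg (u : nat -> R) :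
  (forall e : R, 0 < e -> exists N, forall n, (N <= n)%N -> `|u N - u n| < e) -> cvgn u.
Proof.
move=> H; apply: cauchy_cvg; apply: cauchy_exP => e e0; have [N HN] := H e e0.
by exists (u N); exists N => // n /HN.
Qed.

Lemma levels_pt_le J g h z : levels J g -> levels J h -> forall C : R,
  (forall u, L2 u -> normc (lproj J u z) <= C * nrm u) ->
  normc (g z - h z) <= C * nrm (fun w => g w - h w).
Proof.
move=> Fg Fh C HC; have [Lg _] := Fg; have [Lh _] := Fh.
have := HC _ (L2B Lg Lh).1.
by rewrite (lprojB J z Lg Lh) (levels_ext Fg) (levels_ext Fh).
Qed.

(** Point evaluations provide a pointwise limit, and [L2_limit] turns it into a limit in
   norm. *)
Lemma levels_complete J G : (forall n, levels J (G n)) ->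
  (forall k m n, (k < m)%N -> (k < n)%N -> nrm (fun z => G m z - G n z) <= k.+1%:R^-1) ->
  exists2 h, levels J h & forall k m, (k < m)%N -> L2 (fun z => G m z - h z) /\
    nrm (fun z => G m z - h z) <= k.+1%:R^-1.
Proof.
move=> FG HG; have LG n := (FG n).1.
have small (C e : R) : 0 <= C -> 0 < e -> exists k, C * k.+1%:R^-1 < e.
  move=> C0 e0; exists (Num.truncn (C / e)).
  by rewrite ltr_pdivrMr // mulrC -ltr_pdivrMr // truncnS_gt.
have pt z (e : R) : 0 < e -> exists N, forall m n, (N <= m)%N -> (N <= n)%N ->
    normc (G m z - G n z) < e.
  move=> e0; have [C C0 HC] := lproj_pt J z; have [k Hk] := small C e C0 e0.
  exists k.+1 => m n km kn; apply: le_lt_trans Hk.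
  apply: le_trans (levels_pt_le (FG m) (FG n) HC) _.
  by rewrite ler_wpM2l // HG.
have cr z : cvgn (fun n => complex.Re (G n z)).
  apply: seq_cauchy_cvg => e e0; have [N HN] := pt z e e0; exists N => n Nn.
  by rewrite (le_lt_trans _ (HN N n (leqnn _) Nn)) // -cReN -cReD normc_Re.
have ci z : cvgn (fun n => complex.Im (G n z)).
  apply: seq_cauchy_cvg => e e0; have [N HN] := pt z e e0; exists N => n Nn.
  by rewrite (le_lt_trans _ (HN N n (leqnn _) Nn)) // -cImN -cImD normc_Im.
pose h z : R[i] := limn (fun n => complex.Re (G n z)) +i* limn (fun n => complex.Im (G n z)).
have mh : measurable_fun setT h.
  have mG n : measurable_fun setT (G n) by case: (LG n).
  apply/measurable_ReP; split.
    apply: (@measurable_fun_cvg _ _ _ setT (fun n z => complex.Re (G n z))) => [n|z _].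
      by have /measurable_ReP[] := mG n.
    exact: cr.
  apply: (@measurable_fun_cvg _ _ _ setT (fun n z => complex.Im (G n z))) => [n|z _].
    by have /measurable_ReP[] := mG n.
  exact: ci.
have lim z (d : R) : 0 < d -> exists N, forall n, (N <= n)%N -> normc (G n z - h z) <= d.
  move=> d0; have d2 : 0 < d / 2 by rewrite divr_gt0.
  have /cvgrPdist_le/(_ _ d2)[N1 _ H1] := cr z.
  have /cvgrPdist_le/(_ _ d2)[N2 _ H2] := ci z.
  exists (maxn N1 N2) => n; rewrite geq_max => /andP[n1 n2].
  rewrite (le_trans (normc_le_ReIm _)) // !reim [d]splitr lerD // distrC.
    exact: (H1 n n1).
  exact: (H2 n n2).
have key k m : (k < m)%N -> L2 (fun z => G m z - h z) /\ nrm (fun z => G m z - h z) <= k.+1%:R^-1.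
  move=> km; apply: (@L2_limit (fun n z => G m z - G (n + k.+1)%N z)).
  - by move=> n; exact: (L2B (LG m) (LG _)).1.
  - by apply: measC_B => //; case: (LG m).
  - by rewrite invr_ge0.
  - move=> z d d0; have [N HN] := lim z d d0; exists N => n Nn.
    have -> : G m z - G (n + k.+1)%N z - (G m z - h z) = - (G (n + k.+1)%N z - h z) by ring.
    by rewrite normcNE HN // (leq_trans Nn) // leq_addr.
  - by move=> n; apply: HG => //; rewrite addnS ltnS leq_addl.
have Lh : L2 h.
  have := (L2B (LG 1%N) (key 0%N 1%N (ltnSn _)).1).1.
  by congr L2; apply/funext => z; ring.
exists h => //; split => // z; apply: normc_eq_sub => e e0.
have e2 : 0 < e / 2 by rewrite divr_gt0.
have [C C0 HC] := lproj_pt J z; have [k Hk] := small C _ C0 e2.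
have [N HN] := lim z _ e2; pose m := maxn N k.+1.
have [Ld nd] := key k m (leq_maxr _ _).
have := HC _ Ld; rewrite (lprojB J z (LG m) Lh) (levels_ext (FG m)) => b1.
have b2 := HN m (leq_maxl _ _).
have -> : h z - lproj J h z = (G m z - lproj J h z) - (G m z - h z) by ring.
rewrite (le_trans (normcB _ _)) // [e]splitr lerD // (le_trans b1) //.
by rewrite (le_trans (ler_wpM2l C0 nd)) // ltW.
Qed.

Lemma nrm_cvg0 (D : nat -> R[i] -> R[i]) : (forall n, L2 (D n)) ->
  (fun n => L2norm (D n)) @ \oo --> 0%E <->
  forall e : R, 0 < e -> exists N, forall n, (N <= n)%N -> nrm (D n) <= e.
Proof.
move=> LD; have -> : (fun n => L2norm (D n)) = fun n => (nrm (D n))%:E.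
  by apply/funext => n; rewrite L2norm_nrm.
split=> [/fine_cvg/cvgrPdist_le H e e0|H].
  have [N _ HN] := H e e0; exists N => n Nn.
  have Hn : `|0 - nrm (D n)| <= e := HN n Nn.
  by move: Hn; rewrite sub0r normrN ger0_norm ?nrm_ge0.
apply: cvg_EFin; first by apply: nearW.
apply/cvgrPdist_le => e e0; have [N HN] := H e e0; exists N => // n /= /HN.
by rewrite sub0r normrN ger0_norm ?nrm_ge0.
Qed.

End Completeness.

Section Transfer.
Context {R : realType}.
Implicit Types (g h u : R[i] -> R[i]) (J : seq nat) (G : nat -> R[i] -> R[i]).
Variables (f : R[i] -> R[i]) (Mf : R).
Hypotheses (Mf0 : 0 <= Mf)
  (Hf : forall u, L2 u -> L2 (fun z => f z * u z) /\ nrm (fun z => f z * u z) <= Mf * nrm u).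

Lemma toeplitz_levels J g : uniq J -> levels J g ->
  toeplitz f (levels J) g = lproj J (fun z => f z * g z).
Proof. by move=> uJ [Lg _]; rewrite /toeplitz (orth_proj_levels uJ (Hf Lg).1). Qed.

Lemma lproj0 u : L2 u -> lproj [:: 0%N] u = wexp u.
Proof.
move=> Lu; apply/funext => z; rewrite /lproj big_seq1 fcE fact0 invr1 mul1r Bop0.
by rewrite Aop0 (wexp_F1 (F1_wexp Lu)).
Qed.

Lemma levels0 : levels [:: 0%N] = @F1 R.
Proof.
apply/seteqP; split => g [Lg gE]; split => // z; first by rewrite gE lproj0.
by rewrite lproj0.
Qed.

Lemma bounded_L2norm D G : D `<=` (@L2 R : set _) -> (forall n, D (G n)) ->
  (exists M : R, forall n, (L2norm (G n) <= M%:E)%E) <-> bounded_seq D G.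
Proof.
move=> DL DG; split=> [[M HM]|[_ [M HM]]]; first split => //; exists M => n.
  by have := HM n; rewrite L2norm_nrm ?lee_fin //; exact: DL.
by rewrite L2norm_nrm ?lee_fin //; exact: DL.
Qed.

(** On level 0, testing [T_f g] and [f g] against level 0 is the same. *)
Lemma cptform_toeplitz0 : compact_op (levels [:: 0%N]) (toeplitz f (levels [:: 0%N])) ->
  cptform (@F1 R) (@F1 R) (fun g h => inner (fun z => f z * g z) h).
Proof.
move=> H G BG e e0; have [DG _] := BG.
have FG n : levels [:: 0%N] (G n) by rewrite levels0.
have F1L : @F1 R `<=` (@L2 R : set _) by move=> g [].
have [s [h [hs Fh cv]]] := H G FG ((bounded_L2norm F1L DG).2 BG).
have LG n := (DG n).1; have Lf n := (Hf (LG n)).1.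
have LE n := (lproj_L2 [:: 0%N] (Lf n)).1.
have [Lh _] := Fh.
have TE n := toeplitz_levels (J := [:: 0%N]) isT (FG n).
have LD n : L2 (toeplitz f (levels [:: 0%N]) (G (s n)) \- h).
  by rewrite TE; exact: (L2B (LE (s n)) Lh).1.
(* From index [N] on, all images are within [e / 2] of their limit [h]. *)
have [N HN] := (nrm_cvg0 LD).1 cv _ (@divr_gt0 R e 2 e0 ltac:(by [])).
exists (fun n => s (n + N)%N); split; first by move=> i j ij; apply: hs; rewrite ltn_add2r.
move=> a b u Fu; have [Lu _] := Fu.
have near n : nrm (fun z => lproj [:: 0%N] (fun z => f z * G (s (n + N)%N) z) z - h z) <= e / 2.
  by have := HN (n + N)%N (leq_addl _ _); rewrite TE.
rewrite -(innerBl (Lf _) (Lf _) Lu).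
have -> : u = lproj [:: 0%N] u by rewrite lproj0 // (wexp_F1 Fu).
rewrite -(inner_lproj _ (L2B (Lf _) (Lf _)).1 Lu).
have -> : lproj [:: 0%N] (fun z => f z * G (s (a + N)%N) z - f z * G (s (b + N)%N) z) =
  fun z => (lproj [:: 0%N] (fun z => f z * G (s (a + N)%N) z) z - h z) -
           (lproj [:: 0%N] (fun z => f z * G (s (b + N)%N) z) z - h z).
  apply/funext => z; rewrite (lprojB _ z (Lf (s (a + N)%N)) (Lf (s (b + N)%N))).
  have alg (p q r : R[i]) : p - q = p - r - (q - r) by ring.
  exact: alg.
have La n := (L2B (LE n) Lh).1.
have [Lab nab] := L2B (La (s (a + N)%N)) (La (s (b + N)%N)).
apply: le_trans (inner_CS Lab Lu) _.
rewrite (lproj0 Lu) (wexp_F1 Fu); apply: ler_wpM2r; first exact: nrm_ge0.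
by rewrite (le_trans nab) // [e]splitr lerD.
Qed.

(** Each tolerance [1 / (k + 1)] in [cptform_lproj] costs a subsequence. A diagonal
   subsequence makes the images Cauchy, and the levels are complete. *)
Lemma compact_up J : uniq J -> compact_op (levels [:: 0%N]) (toeplitz f (levels [:: 0%N])) ->
  compact_op (levels J) (toeplitz f (levels J)).
Proof.
move=> uJ /cptform_toeplitz0/(cptform_lproj Mf0 Hf (J := J)) C G FG bG.
have FL : levels J `<=` (@L2 R : set _) by move=> g [].
have BG := (bounded_L2norm FL FG).1 bG.
have LG n := (FG n).1; have Lf n := (Hf (LG n)).1; have LE n := (lproj_L2 J (Lf n)).1.
have [s [hs Hs]] : exists s, incr s /\ forall k m n, (k < m)%N -> (k < n)%N ->
    nrm (fun z => lproj J (fun w => f w * G (s m) w) z - lproj J (fun w => f w * G (s n) w) z) <= k.+1%:R^-1.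
  apply: (@diagonal _ G (fun k a b => nrm (fun z => lproj J (fun w => f w * a w) z -
    lproj J (fun w => f w * b w) z) <= k.+1%:R^-1)) => k s hs.
  have k0 : 0 < k.+1%:R^-1 :> R by rewrite invr_gt0.
  have [t [ht Ht]] := C _ (bounded_sub s BG) _ k0; exists t; split => // a b.
  have Ld := (L2B (LE (s (t a))) (LE (s (t b)))).1.
  have := Ht a b _ Ld; rewrite -(innerBl (LE _) (LE _) Ld) inner_nrm // normcR ger0_norm ?sqr_ge0 //.
  set nn := nrm _; have nn0 : 0 <= nn by exact: nrm_ge0.
  clearbody nn; have [->|n0] := eqVneq nn 0; first by move=> _; exact: ltW.
  by rewrite expr2 ler_pM2r // lt_neqAle eq_sym n0.
have [h Fh Hh] := levels_complete (fun n => levels_lproj uJ (Lf (s n))) Hs.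
have TE n := toeplitz_levels uJ (FG n).
exists s, h; split; [exact: hs|exact: Fh|have [Lh _] := Fh].
have LD n : L2 (toeplitz f (levels J) (G (s n)) \- h).
  by rewrite TE; exact: (L2B (LE (s n)) Lh).1.
apply/(nrm_cvg0 LD) => e e0.
exists (Num.truncn e^-1).+1 => n Nn; rewrite TE.
apply: le_trans (Hh _ _ Nn).2 _.
by rewrite -[leRHS]invrK lef_pV2 ?posrE ?invr_gt0 // ltW // truncnS_gt.
Qed.

Lemma F1_levels J g : uniq J -> 0%N \in J -> F1 g -> levels J g.
Proof.
move=> uJ J0 Fg; have [Lg _] := Fg; split => // z.
have E j : @fc R j * Bop j (Aop j g) z = if j == 0%N then g z else 0.
  have AE w : Aop j g w = (if j == 0%N then 1 else 0) * g w.
    rewrite -{1}(wexp_F1 Fg) -Bop0 (AopBop j 0 w Lg) (wexp_F1 Fg).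
    by case: eqVneq.
  case: eqVneq AE => [->|_] AE.
    have -> : Aop 0 g = g by apply/funext => w; rewrite AE mul1r.
    by rewrite Bop0 (wexp_F1 Fg) fcE fact0 invr1 mul1r.
  have -> : Aop j g = fun=> 0 by apply/funext => w; rewrite AE mul0r.
  apply/eqP; rewrite mulf_eq0; apply/orP; right; rewrite -normc_eq0; apply/eqP/le_anti.
  rewrite normc_ge0 andbT; have := Bop_pt j z L2_0.1.
  by rewrite L2_0.2 mul0r.
rewrite /lproj; under eq_bigr do rewrite E.
rewrite (bigD1_seq 0%N) //= big1 ?addr0 // => j /negbTE->//.
Qed.

(** Level 0 is part of [levels J], and [Aop 0] takes the projection onto [levels J] to
   the projection onto level 0. *)
Lemma compact_down J : uniq J -> 0%N \in J -> compact_op (levels J) (toeplitz f (levels J)) ->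
  compact_op (levels [:: 0%N]) (toeplitz f (levels [:: 0%N])).
Proof.
move=> uJ J0 C G FG bG.
have FGJ n : levels J (G n) by apply: F1_levels => //; have := FG n; rewrite levels0.
have [s [h [hs Fh cv]]] := C G FGJ bG; have [Lh _] := Fh.
have LG n := (FG n).1; have Lf n := (Hf (LG n)).1; have LE n := (lproj_L2 J (Lf n)).1.
have T0 n := toeplitz_levels (J := [:: 0%N]) isT (FG n).
have TJ n := toeplitz_levels uJ (FGJ n).
exists s, (Aop 0 h); split; [exact: hs|by rewrite levels0; exact: F1_Aop|].
have TE n : toeplitz f (levels [:: 0%N]) (G (s n)) \- Aop 0 h =
    Aop 0 (fun z => toeplitz f (levels J) (G (s n)) z - h z).
  rewrite T0 TJ (lproj0 (Lf (s n))); apply/funext => z; rewrite -Aop0.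
  transitivity (1 * Aop 0 (lproj J (fun z => f z * G (s n) z)) z + -1 * Aop 0 h z).
    by rewrite mul1r mulN1r (Aop_lproj 0 z uJ (Lf (s n))) J0.
  have E := Aop_lin 0 1 (-1) (LE (s n)) Lh.
  rewrite -[LHS]/((fun w => 1 * Aop 0 (lproj J (fun z => f z * G (s n) z)) w + -1 * Aop 0 h w) z) -E.
  by congr (Aop 0 _ z); apply/funext => w; rewrite mul1r mulN1r.
have LD n : L2 (toeplitz f (levels J) (G (s n)) \- h).
  by rewrite TJ; exact: (L2B (LE (s n)) Lh).1.
have LD0 n : L2 (toeplitz f (levels [:: 0%N]) (G (s n)) \- Aop 0 h).
  by rewrite TE; exact: (Aop_L2 0 (LD n)).1.
apply/(nrm_cvg0 LD0) => e e0.
have c1 : 0 < @opc R 0 + 1 by rewrite ltr_wpDl ?opc_ge0.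
have [N HN] := (nrm_cvg0 LD).1 cv _ (divr_gt0 e0 c1).
exists N => n Nn; rewrite TE (le_trans (Aop_L2 0 (LD n)).2) //.
rewrite (le_trans (ler_wpM2l (opc_ge0 _) (HN n Nn))) // mulrCA ger_pMr //.
by rewrite ler_pdivrMr // mul1r lerDl.
Qed.

End Transfer.

(** * Wirtinger derivatives *)

Section Wirtinger.
Context {R : realType}.
Implicit Types (f g q u : R[i] -> R[i]) (z w v : R[i]).

(** Directional derivatives as a relation, so that they can be computed by rules. *)
Definition pdir v f z l :=
  is_derive (0 : R) 1 (fun t : R => complex.Re (f (z + t%:C * v))) (complex.Re l) /\
  is_derive (0 : R) 1 (fun t : R => complex.Im (f (z + t%:C * v))) (complex.Im l).

Lemma pdirP v f z l : pdir v f z l <-> has_partial v f z /\ partial v f z = l.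
Proof.
split=> [[H1 H2]|[[H1 H2] <-]]; rewrite /pdir /has_partial /partial /= !derive1E.
  split; first by split; [case: H1|case: H2].
  by apply: complexP => /=; [case: H1|case: H2].
by split; apply: DeriveDef.
Qed.

Lemma pdirD v f g z l m : pdir v f z l -> pdir v g z m ->
  pdir v (fun w => f w + g w) z (l + m).
Proof.
move=> [f1 f2] [g1 g2]; split; rewrite reim.
  by under eq_fun do rewrite cReD; exact: is_deriveD.
by under eq_fun do rewrite cImD; exact: is_deriveD.
Qed.

Lemma pdirM v f g z l m : pdir v f z l -> pdir v g z m ->
  pdir v (fun w => f w * g w) z (l * g z + f z * m).
Proof.
move=> [f1 f2] [g1 g2]; split.
  under eq_fun do rewrite cReM.
  apply: (is_derive_eq (is_deriveB (is_deriveM f1 g1) (is_deriveM f2 g2))).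
  by rewrite !reim mul0r addr0 /GRing.scale /=; ring.
under eq_fun do rewrite cImM.
apply: (is_derive_eq (is_deriveD (is_deriveM f1 g2) (is_deriveM f2 g1))).
by rewrite !reim mul0r addr0 /GRing.scale /=; ring.
Qed.

Lemma pdir_cst v c z : pdir v (fun=> c) z 0.
Proof. by split; exact: is_derive_cst. Qed.

Lemma pdirZ v f z l c : pdir v f z l -> pdir v (fun w => c * f w) z (c * l).
Proof. by move=> H; have := pdirM (pdir_cst v c z) H; rewrite mul0r add0r. Qed.

Lemma pdir_cder v f z l : cder f z l -> pdir v f z (v * l).
Proof. by move=> H; apply/pdirP; exact: partial_cder. Qed.

Lemma pdir_conj v z : pdir v (fun w => w^*) z v^*.
Proof.
have [H1 H2] := pdir_cder v (cder_id z); rewrite mulr1 in H1 H2; split.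
  by under eq_fun do rewrite cReJ; rewrite cReJ.
by under eq_fun do rewrite cImJ; rewrite cImJ; exact: is_deriveN.
Qed.

Definition gauss z : R[i] := (expR (- normc z ^+ 2))%:C.

Lemma pdir_gauss v z : pdir v gauss z (- (z^* * v + z * v^*) * gauss z).
Proof.
have [E _] := pdirM (pdir_cder v (cder_id z)) (pdir_conj v z).
have D : is_derive (0 : R) 1 (fun t : R => - normc (z + t%:C * v) ^+ 2)
    (- complex.Re (v * 1 * z^* + z * v^*)).
  have := is_deriveN E; rewrite /GRing.opp /=.
  by under eq_fun do rewrite normcJM /=.
split.
  apply: (is_derive_eq (is_derive1_comp (is_derive_expR _) D)).
  by rewrite mul0r addr0 /gauss !reim /=; ring.
apply: (is_derive_eq (@is_derive_cst R R R 0 0 1)).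
by rewrite /gauss !reim /=; ring.
Qed.

(** The Wirtinger derivatives [a], in [z], and [b], in its conjugate, as the coefficients
   of the real differential of [f]. *)
Definition wder f z a b := forall v, pdir v f z (a * v + b * v^*).

Lemma wderD f g z a b c d : wder f z a b -> wder g z c d ->
  wder (fun w => f w + g w) z (a + c) (b + d).
Proof.
move=> Hf Hg v; have := pdirD (Hf v) (Hg v).
by congr pdir; rewrite !mulrDl addrACA.
Qed.

Lemma wderM f g z a b c d : wder f z a b -> wder g z c d ->
  wder (fun w => f w * g w) z (a * g z + f z * c) (b * g z + f z * d).
Proof. by move=> Hf Hg v; have := pdirM (Hf v) (Hg v); congr pdir; ring. Qed.

Lemma wder_cder f z l : cder f z l -> wder f z l 0.
Proof. by move=> H v; have := pdir_cder v H; rewrite mul0r addr0 mulrC. Qed.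

Lemma wder_conj z : wder (fun w => w^*) z 0 1.
Proof. by move=> v; rewrite mul0r add0r mul1r; exact: pdir_conj. Qed.

Lemma wder_conjX n z : wder (fun w => w^* ^+ n) z 0 (n%:R * z^* ^+ n.-1).
Proof.
elim: n => [|n IH].
  by under eq_fun do rewrite expr0; rewrite mul0r; exact: wder_cder (cder_cst _ _).
under eq_fun do rewrite exprS.
have := wderM (wder_conj z) IH; rewrite !mul0r mulr0 addr0 mul1r.
case: n IH => [|n] _ /=; first by rewrite mul0r mulr0 addr0 !mulr1.
by congr wder; rewrite [in RHS]mulrS exprS; ring.
Qed.

Lemma wder_gauss z : wder gauss z (- z^* * gauss z) (- z * gauss z).
Proof. by move=> v; have := pdir_gauss v z; congr pdir; ring. Qed.

Lemma wder_sum (I : Type) (s : seq I) (F : I -> R[i] -> R[i]) a b z :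
  (forall i, wder (F i) z (a i) (b i)) ->
  wder (fun w => \sum_(i <- s) F i w) z (\sum_(i <- s) a i) (\sum_(i <- s) b i).
Proof.
move=> H; elim: s => [|i s IH].
  by under eq_fun do rewrite big_nil; rewrite !big_nil; exact: wder_cder (cder_cst _ _).
by under eq_fun do rewrite big_cons; rewrite !big_cons; exact: wderD.
Qed.

Lemma wder_partial f z a b v : wder f z a b ->
  has_partial v f z /\ partial v f z = a * v + b * v^*.
Proof. by move=> H; apply/pdirP. Qed.

Lemma conj_i : ('i%C : R[i])^* = - 'i%C.
Proof. by apply: complexP; rewrite !reim /= ?oppr0. Qed.

Lemma mul_ii : 'i%C * 'i%C = -1 :> R[i].
Proof. by apply: complexP; rewrite !reim /=; ring. Qed.

Lemma wder_dz f z a b : wder f z a b -> d_z f z = a /\ d_zbar f z = b.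
Proof.
move=> H; rewrite /d_z /d_zbar (wder_partial 1 H).2 (wder_partial 'i%C H).2.
rewrite conj_i (_ : (1 : R[i])^* = 1); last exact: rmorph1.
have two : 2 != 0 :> R[i] by rewrite pnatr_eq0.
split; apply: (mulfI two); rewrite mulrA mulfV // mul1r mulrDr.
  transitivity (a + b - a * ('i%C * 'i%C) + b * ('i%C * 'i%C)); first by ring.
  by rewrite mul_ii; ring.
transitivity (a + b + a * ('i%C * 'i%C) - b * ('i%C * 'i%C)); first by ring.
by rewrite mul_ii; ring.
Qed.

Lemma continuousP f : continuous f <-> forall z, ccont f z.
Proof.
split=> H z; first by apply/(ccontP f z); exact: (H z).
by apply/(ccontP f z); exact: (H z).
Qed.

Lemma continuous_lin f g c : continuous f -> continuous g ->
  continuous (fun w => f w + c * g w).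
Proof.
move=> /continuousP cf /continuousP cg; apply/continuousP => z.
by apply: ccontD (cf z) _; apply: ccontM (cg z); exact: cder_ccont (cder_cst c z).
Qed.

Lemma cont_diff_lin m f g c : cont_diff m f -> cont_diff m g ->
  cont_diff m (fun w => f w + c * g w).
Proof.
elim: m f g => [|m IH] f g /= [cf Hf] [cg Hg].
  exact (conj (continuous_lin (c:=c) cf cg) I).
have [pf [f1 fi]] := Hf; have [pg [g1 gi]] := Hg.
have K v : (forall z, has_partial v f z) -> (forall z, has_partial v g z) ->
    (forall z, has_partial v (fun w => f w + c * g w) z) /\
    partial v (fun w => f w + c * g w) = fun w => partial v f w + c * partial v g w.
  move=> pfv pgv.
  have Q z : has_partial v (fun w => f w + c * g w) z /\
      partial v (fun w => f w + c * g w) z = partial v f z + c * partial v g z.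
    by apply/pdirP; apply: pdirD; [|apply: pdirZ]; apply/pdirP.
  by split=> [z|]; [case: (Q z)|apply/funext => z; case: (Q z)].
have [k1 e1] := K _ (fun z => (pf z).1) (fun z => (pg z).1).
have [ki ei] := K _ (fun z => (pf z).2) (fun z => (pg z).2).
split; first exact (continuous_lin (c:=c) cf cg).
rewrite e1 ei; split; first by move=> z; split.
by split; apply: IH.
Qed.

End Wirtinger.

(** * Polyanalytic functions and their entire coefficients *)

Section PolyanalyticForms.
Context {R : realType}.
Implicit Types (f g h u : R[i] -> R[i]) (q : nat -> R[i] -> R[i]) (z w : R[i]).

Definition cderiv g z := get [set l | cder g z l].

Lemma cderivE g z l : cder g z l -> cderiv g z = l.
Proof.
move=> H; have /cder_unique : cder g z (cderiv g z) by apply: (@getPex _ [set l | cder g z l]); exists l.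
exact.
Qed.

Lemma cder_cderiv g z : holo g -> cder g z (cderiv g z).
Proof. by move=> hg; have [l H] := hg z; rewrite (cderivE H). Qed.

Lemma holo_cderiv g : holo g -> holo (cderiv g).
Proof.
by move=> hg; have [g' H hg'] := entire_der hg; have -> : cderiv g = g' by apply/funext => z; exact: cderivE.
Qed.

Lemma holoZ c g : holo g -> holo (fun z => c * g z).
Proof. exact: holoM (holo_cst c). Qed.

(** A polynomial in the conjugate variable with coefficients [q j], which will be entire. *)
Definition polyform n q z := \sum_(j < n) z^* ^+ j * q j z.

Lemma polyform_lin n q q' c z : polyform n q z + c * polyform n q' z = polyform n (fun j z => q j z + c * q' j z) z.
Proof. by rewrite /polyform mulr_sumr -big_split; apply: eq_bigr => j _ /=; ring. Qed.

Lemma polyform_widen n m q z : (n <= m)%N ->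
  polyform n q z = polyform m (fun j z => if (j < n)%N then q j z else 0) z.
Proof.
move=> nm; rewrite /polyform (big_ord_widen m (fun j => z^* ^+ j * q j z) nm) big_mkcond /=.
by apply: eq_bigr => j _; case: ifP => // _; rewrite mulr0.
Qed.

Lemma polyform_conj n q z :
  z^* * polyform n q z = polyform n.+1 (fun j z => if j is j'.+1 then q j' z else 0) z.
Proof.
rewrite /polyform big_ord_recl mulr0 add0r mulr_sumr; apply: eq_bigr => j _ /=.
by rewrite mulrA -exprS.
Qed.

Lemma wder_polyform n q z : (forall j, holo (q j)) ->
  wder (polyform n q) z (polyform n (fun j => cderiv (q j)) z) (polyform n.-1 (fun j z => j.+1%:R * q j.+1 z) z).
Proof.
move=> hq.
have -> : polyform n.-1 (fun j z => j.+1%:R * q j.+1 z) z =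
    \sum_(j < n) (j%:R * z^* ^+ j.-1) * q j z.
  case: n => [|n]; first by rewrite /polyform !big_ord0.
  rewrite /polyform big_ord_recl /= !mul0r add0r; apply: eq_bigr => j _ /=.
  by rewrite mulrCA mulrA.
apply: (@wder_sum _ _ (index_enum 'I_n) (fun (j : 'I_n) z => z^* ^+ j * q j z)) => j.
have := wderM (wder_conjX j z) (wder_cder (cder_cderiv z (hq j))).
by rewrite mul0r add0r mulr0 addr0.
Qed.

Lemma iter_dzbar_polyform p q z : (forall j, holo (q j)) -> iter p d_zbar (polyform p q) z = 0.
Proof.
elim: p q => [|p IH] q hq; first by rewrite /= /polyform big_ord0.
rewrite iterSr (_ : d_zbar (polyform p.+1 q) = polyform p (fun j z => j.+1%:R * q j.+1 z)).
  by apply: IH => j; exact: holoZ.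
by apply/funext => w; exact: (wder_dz (wder_polyform p.+1 w hq)).2.
Qed.

Lemma ccont_conj z : ccont (fun w => w^* : R[i]) z.
Proof.
by move=> e e0; exists e => // h; rewrite conjD addrAC subrr add0r normcJ.
Qed.

Lemma ccont_polyform n q z : (forall j, holo (q j)) -> ccont (polyform n q) z.
Proof.
move=> hq; elim: n => [|n IH].
  have -> : polyform 0 q = fun=> 0 by apply/funext => w; rewrite /polyform big_ord0.
  exact: cder_ccont (cder_cst 0 z).
have -> : polyform n.+1 q = fun w => polyform n q w + w^* ^+ n * q n w.
  by apply/funext => w; rewrite /polyform big_ord_recr.
apply: ccontD IH _; apply: ccontM (holo_ccont (hq n) z).
apply: (ccont_comp (f := fun w => w^*)) (ccont_conj z) (holo_ccont (holoX n (@holo_id R)) z^* ).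
Qed.

Lemma smooth_polyform n q : (forall j, holo (q j)) -> smooth (polyform n q).
Proof.
move=> hq m; elim: m n q hq => [|m IH] n q hq.
  by split; [apply/continuousP => z; exact: ccont_polyform|exact: I].
have H z := wder_polyform n z hq.
have K v : cont_diff m (partial v (polyform n q)).
  have -> : partial v (polyform n q) = fun z => polyform n (fun j z => v * cderiv (q j) z) z +
     v^* * polyform n.-1 (fun j z => j.+1%:R * q j.+1 z) z.
    apply/funext => z; rewrite (wder_partial v (H z)).2 [_ * v]mulrC [_ * v^*]mulrC.
    by congr (_ + _); rewrite /polyform mulr_sumr; apply: eq_bigr => j _; rewrite mulrCA.
  by apply: cont_diff_lin; apply: IH => j; apply: holoZ => //; exact: holo_cderiv.
split; first by apply/continuousP => z; exact: ccont_polyform.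
by split=> [z|]; split; try exact: K; exact: (wder_partial _ (H z)).1.
Qed.

Lemma smooth_dzbar f : smooth f -> smooth (d_zbar f).
Proof.
move=> sf m; have [_ [_ [s1 si]]] := sf m.+1.
have s0 : cont_diff m (fun=> 0 : R[i]).
  have -> : (fun=> 0) = polyform 0 (fun=> fun=> 0 : R[i]) by apply/funext => w; rewrite /polyform big_ord0.
  by apply: smooth_polyform => _; exact: holo_cst.
have -> : d_zbar f = fun z => (0 + 2^-1 * partial 1 f z) + (2^-1 * 'i%C) * partial 'i%C f z.
  by apply/funext => z; rewrite add0r /d_zbar mulrDr mulrA.
exact: cont_diff_lin (cont_diff_lin _ s0 s1) si.
Qed.

(** By induction on [n]: integrating the coefficients of [d_zbar f] in the conjugate
   variable gives a function that differs from [f] by a solution [h] of the Cauchy-Riemann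
   equation. *)
Lemma polyanalytic_polyform n f : smooth f -> (forall z, iter n d_zbar f z = 0) ->
  exists2 q, forall j, holo (q j) & f = polyform n q.
Proof.
elim: n f => [|n IH] f sf H.
  exists (fun=> fun=> 0) => [j|]; first exact: holo_cst.
  by apply/funext => z; rewrite /polyform big_ord0; exact: H.
have [q hq E] : exists2 q, forall j, holo (q j) & d_zbar f = polyform n q.
  by apply: IH (smooth_dzbar sf) _ => z; rewrite -iterSr.
(* The coefficients of the primitive in the conjugate variable. *)
pose p j := if j is i.+1 then fun z => (j%:R)^-1 * q i z else fun=> 0.
have hp j : holo (p j) by case: j => [|j]; [exact: holo_cst|exact: holoZ].
pose h z := f z + -1 * polyform n.+1 p z.
have ph v z : has_partial v f z -> has_partial v h z /\
    partial v h z = partial v f z + -1 * partial v (polyform n.+1 p) z.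
  move=> pf; apply/pdirP; apply: pdirD; first exact/pdirP.
  by apply: pdirZ; apply/pdirP; split => //; exact: (wder_partial v (wder_polyform n.+1 z hp)).1.
have [_ [pf [c1 ci]]] := sf 1%N.
have dh z : d_zbar h z = 0.
  have zE : d_zbar h z = d_zbar f z - d_zbar (polyform n.+1 p) z.
    by rewrite /d_zbar (ph 1 z (pf z).1).2 (ph 'i%C z (pf z).2).2; ring.
  rewrite zE E (wder_dz (wder_polyform n.+1 z hp)).2 /=; apply/eqP; rewrite subr_eq0; apply/eqP.
  by apply: eq_bigr => j _; rewrite mulVKf // pnatr_eq0.
have CR z : partial 'i%C h z = 'i%C * partial 1 h z.
  have /eqP := dh z; rewrite /d_zbar mulf_eq0 invr_eq0 pnatr_eq0 /= => /eqP d0.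
  transitivity (- 'i%C * ('i%C * partial 'i%C h z)).
    by rewrite mulrA mulNr mul_ii opprK mul1r.
  by move/eqP: d0; rewrite addrC addr_eq0 => /eqP->; rewrite mulrNN.
have hh : holo h.
  move=> z; exists (partial 1 h z); apply: CR_cder => // [w|w|].
  - exact: (ph 1 w (pf w).1).1.
  - exact: (ph _ w (pf w).2).1.
  have -> : partial 1 h = fun z => partial 1 f z + -1 * partial 1 (polyform n.+1 p) z.
    by apply/funext => w; exact: (ph 1 w (pf w).1).2.
  have [_ [_ [[c2 _] _]]] := smooth_polyform n.+1 hp 1%N; case: c1 => c1 _.
  by have /continuousP := continuous_lin (c := -1) c1 c2; apply.
exists (fun j => if j is 0 then h else p j) => [j|]; first by case: j => [|j] //; exact: (hp j.+1).
apply/funext => z; rewrite /polyform big_ord_recl expr0 mul1r /h.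
by rewrite /polyform big_ord_recl /= mulr0 add0r mulN1r subrK.
Qed.

(** This is [(d/dz - z')^j g], which is [e^{|z|^2} (d/dz)^j (e^{-|z|^2} g)] by
   [iter_dz_gauss]. *)
Fixpoint rodr j g : R[i] -> R[i] :=
  if j is i.+1 then fun z => rodr i (cderiv g) z - z^* * rodr i g z else g.

(** The leading coefficient recovers [g]. *)
Lemma rodr_polyform j g : holo g -> exists q, [/\ forall i, holo (q i), rodr j g = polyform j.+1 q
  & forall z, q j z = (-1) ^+ j * g z].
Proof.
elim: j g => [|j IH] g hg.
  exists (fun=> g); split => // [|z]; last by rewrite expr0 mul1r.
  by apply/funext => z; rewrite /polyform big_ord1 expr0 mul1r.
have [q1 [h1 E1 t1]] := IH _ (holo_cderiv hg); have [q2 [h2 E2 t2]] := IH _ hg.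
exists (fun i z => (if (i < j.+1)%N then q1 i z else 0) +
  -1 * (if i is i'.+1 then q2 i' z else 0)); split.
- move=> i; apply: holoD; first by case: (i < j.+1)%N => //; exact: holo_cst.
  by apply: holoZ; case: i => [|i] //; exact: holo_cst.
- apply/funext => z; rewrite /= E1 E2 -(polyform_lin j.+2) -polyform_conj -polyform_widen //.
  by rewrite mulN1r.
by move=> z; rewrite ltnn add0r t2 exprS mulrA.
Qed.

Lemma wder_rodr j g z : holo g -> exists b, wder (rodr j g) z (rodr j (cderiv g) z) b.
Proof.
elim: j g => [|j IH] g hg; first by exists 0; exact: wder_cder (cder_cderiv z hg).
have [b1 H1] := IH _ (holo_cderiv hg); have [b2 H2] := IH _ hg.
have H := wderD H1 (wderM (wder_cder (cder_cst (-1) z)) (wderM (wder_conj z) H2)).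
move: H; rewrite !mul0r !add0r !mul1r => H; eexists.
rewrite (_ : rodr j.+1 g = fun w => rodr j (cderiv g) w + -1 * (w^* * rodr j g w)).
  have -> : rodr j.+1 (cderiv g) z = rodr j (cderiv (cderiv g)) z + -1 * (z^* * rodr j (cderiv g) z).
    by rewrite /= mulN1r.
  exact: H.
by apply/funext => w; rewrite /= mulN1r.
Qed.

Lemma iter_dz_gauss m g : holo g ->
  iter m d_z (fun w => gauss w * g w) = fun z => gauss z * rodr m g z.
Proof.
move=> hg; elim: m => [//|m IH]; rewrite iterS IH; apply/funext => z.
have [b H] := wder_rodr m z hg.
rewrite (wder_dz (wderM (wder_gauss z) H)).1 /=; ring.
Qed.

Lemma rodr_lin j g h c z : holo g -> holo h ->
  rodr j (fun w => g w + c * h w) z = rodr j g z + c * rodr j h z.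
Proof.
elim: j g h z => [//|j IH] g h z hg hh /=.
have -> : cderiv (fun w => g w + c * h w) = fun w => cderiv g w + c * cderiv h w.
  by apply/funext => w; apply: cderivE; exact: (cderD (cder_cderiv w hg) (cderZ c (cder_cderiv w hh))).
rewrite !IH //; [ring|exact: holo_cderiv|exact: holo_cderiv].
Qed.

Lemma wint_shiftX j v z : wint v -> wint (fun w => v w * (w^* - z^*) ^+ j).
Proof.
move=> wv; elim: j => [|j IH]; first by under eq_fun do rewrite expr0 mulr1.
have -> : (fun w => v w * (w^* - z^*) ^+ j.+1) = fun w => v w * (w^* - z^*) ^+ j * (w^* - z^*).
  by apply/funext => w; rewrite exprSr mulrA.
apply: (@wintM _ _ _ (expR (normc z)) 1) IH => [|w].
  by apply: measC_B; [apply: measC_J; exact: measurable_id|exact: measC_cst].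
rewrite mul1r -expRD (le_trans (normcB _ _)) // !normcJ.
by have := expR_ge1Dx (normc z + normc w); lra.
Qed.

(** Differentiation under the integral multiplies the density by the conjugate of [w]. *)
Lemma rodr_wexp j v z : wint v -> rodr j (wexp v) z = wexp (fun w => v w * (w^* - z^*) ^+ j) z.
Proof.
elim: j v => [|j IH] v wv.
  by apply: eq_cint => w _; rewrite expr0 mulr1.
have -> : rodr j.+1 (wexp v) z = rodr j (cderiv (wexp v)) z - z^* * rodr j (wexp v) z by [].
have -> : cderiv (wexp v) = wexp (fun w => v w * w^*).
  by apply/funext => w; exact: cderivE (cder_wexp w wv).
have wJ := wint_conj wv; have i1 := wint_cintegrable z (wint_shiftX j z wJ).
have i2 := wint_cintegrable z (wint_shiftX j z wv).
rewrite (IH _ wJ) (IH _ wv) /wexp -(cintZ measurableT _ i2) -(cintB measurableT i1); last first.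
  by apply: cintegrableZ.
by apply: eq_cint => w _; rewrite exprS; ring.
Qed.

Lemma Bop_rodr j g : F1 g -> Bop j g = rodr j g.
Proof.
move=> Fg; have [Lg _] := Fg; rewrite BopE -{2}(wexp_F1 Fg); apply/funext => z.
rewrite rodr_wexp; last exact: wint_L2.
by apply: eq_cint => w _; rewrite /tck /raise conjB opprB mulrA.
Qed.

End PolyanalyticForms.

(** * Leading coefficients from moments *)

Section Moments.
Context {R : realType}.
Implicit Types (g h u G : R[i] -> R[i]) (q : nat -> R[i] -> R[i]) (z w x c : R[i]).

Lemma cintegrable_disc h N : (forall z, ccont h z) ->
  cintegrable mu setT (fun w => h w * (disc N w)%:C).
Proof.
move=> ch; have [M M0 HM] := ccont_bounded N%:R ch.
apply: (@mu_cintegrable_bounded _ _ M) => [|z].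
  by apply: measC_M; [exact: measurable_ccont|apply: measC_real; exact: measurable_disc].
rewrite normcM normcR ger0_norm ?disc_ge0 //; have [zN|zN] := leP (normc z) N%:R.
  by rewrite (le_trans _ (HM _ zN)) // ler_piMr ?normc_ge0 ?disc_le1.
by rewrite disc_out // mulr0.
Qed.

Definition dmass N l : R[i] := cint mu setT (fun w : R[i] => ((normc w ^+ 2) ^+ l * disc N w)%:C).

(** The weight [|w|^2 ^ l] being radial, [radial_mean] picks the value at 0 of
   [w ^ (m - l) u]. *)
Lemma moment1 m l u N : holo u -> (l <= m)%N ->
  cint mu setT (fun w => w ^+ m * w^* ^+ l * u w * (disc N w)%:C) =
  (if l == m then u 0 else 0) * dmass N l.
Proof.
move=> hu lm; have hh : holo (fun w => w ^+ (m - l) * u w).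
  exact: holoM (holoX _ (@holo_id R)) hu.
pose r w : R[i] := ((normc w ^+ 2) ^+ l * disc N w)%:C.
have rB z : normc (r z) <= (N%:R ^+ 2) ^+ l.
  rewrite normcR ger0_norm ?mulr_ge0 ?exprn_ge0 ?disc_ge0 ?normc_ge0 //.
  have [zN|zN] := leP (normc z) N%:R; last by rewrite disc_out // mulr0 ?exprn_ge0 ?ler0n.
  rewrite (le_trans (ler_piMr _ (disc_le1 _ _))) ?exprn_ge0 ?normc_ge0 //.
  by rewrite -!exprM; apply: lerXn2r; rewrite ?nnegrE ?normc_ge0 ?ler0n.
have mr : measurable_fun setT r.
  apply: measC_real; apply: measurable_funM; last exact: measurable_disc.
  by apply: measurable_funX; apply: measurable_funX; apply: meas_normc; exact: measurable_id.
have rS z : N%:R < normc z -> r z = 0 by move=> zN; rewrite /r disc_out // mulr0.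
have rr v z : normc v = 1 -> r (v * z) = r z by move=> v1; rewrite /r disc_rot // normcM v1 mul1r.
have := radial_mean hh mr rB rS rr.
under eq_cint => w _.
  have -> : w ^+ (m - l) * u w * r w = w ^+ m * w^* ^+ l * u w * (disc N w)%:C.
    rewrite /r rmorphM rmorphXn /= -normcJM exprMn.
    by rewrite -[in RHS](subnK lm) exprD; ring.
  over.
move=> ->; congr (_ * _).
rewrite expr0n subn_eq0; have [->|ne] := eqVneq l m; first by rewrite leqnn mul1r.
by rewrite leqNgt ltn_neqAle ne lm mul0r.
Qed.

(** Shifting the conjugate variable only adds terms of lower degree, which do not
   reach the moment of order [m]. *)
Lemma moment_shift m j c u N : holo u -> (j <= m)%N ->
  cint mu setT (fun w => w ^+ m * (w^* + c) ^+ j * u w * (disc N w)%:C) =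
  (if j == m then u 0 else 0) * dmass N m.
Proof.
move=> hu jm.
have ci l : cintegrable mu setT (fun w => w ^+ m * w^* ^+ l * u w * (disc N w)%:C).
  apply: cintegrable_disc => z; apply: ccontM (holo_ccont hu z).
  apply: ccontM (holo_ccont (holoX m (@holo_id R)) z) _.
  by apply: (ccont_comp (f := fun w => w^*)) (ccont_conj z) (holo_ccont (holoX l (@holo_id R)) z^* ).
pose F (i : 'I_j.+1) w := (c ^+ i *+ 'C(j, i)) * (w ^+ m * w^* ^+ (j - i) * u w * (disc N w)%:C).
have iF i : cintegrable mu setT (F i) by exact: cintegrableZ.
have -> : (fun w => w ^+ m * (w^* + c) ^+ j * u w * (disc N w)%:C) =
    fun w => \sum_(i < j.+1) F i w.
  apply/funext => w; rewrite exprDn mulr_sumr !mulr_suml; apply: eq_bigr => i _.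
  have alg (p r s t v : R[i]) l : p * (r * s *+ l) * t * v = s *+ l * (p * r * t * v).
    by rewrite -[r * s *+ l]mulr_natr -[s *+ l]mulr_natr; ring.
  exact: alg.
rewrite (cint_sum measurableT (index_enum 'I_j.+1) iF).2.
have FE i : cint mu setT (F i) = (c ^+ i *+ 'C(j, i)) * ((if (j - i)%N == m then u 0 else 0) * dmass N (j - i)).
  by rewrite /F cintZ // moment1 // (leq_trans (leq_subr _ _)).
rewrite big_ord_recl FE /= subn0 bin0 expr0 mulr1n mul1r big1 ?addr0.
  by case: eqVneq => [->|]; rewrite ?mul0r.
move=> i _; rewrite FE /= /bump /= add1n; case: eqVneq => [e|]; last by rewrite mul0r mulr0.
by have := ltn_ord i; lia.
Qed.

Lemma cint_disc0 g : measurable_fun setT g -> cintegrable mu setT g ->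
  (forall N, cint mu setT (fun w => g w * (disc N w)%:C) = 0) -> cint mu setT g = 0.
Proof.
move=> mg ig H; apply: normc_eq_sub => e e0; have [N HN] := mu_tail mg ig e0.
by have := HN N (leqnn N); rewrite H.
Qed.

(** Read off from [kernel_AB] at the origin. *)
Lemma normc_moment m : cint mu setT (fun w : R[i] => ((normc w ^+ 2) ^+ m)%:C) = m`!%:R.
Proof.
have := kernel_AB m m 0 0 (0 : R[i]); rewrite ffactnn subnn subr0 expr0 mulr1 mul0r cexp0 mulr1 => <-.
apply: eq_cint => w _; rewrite mul0r cexp0 mulr1 conjc0 mulr0 cexp0 mulr1 !sub0r.
by rewrite -exprMn mulrNN normcJM rmorphXn.
Qed.

(** The value at [x] of [Aop m] is the moment of order [m] of the Weyl translate by [x]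
   and hence, up to a factor, the value at [x] of the leading coefficient. The integrals of
   the single terms need not converge, so both sides are compared on discs. *)
Lemma lead_polyform_eq0 m q : (forall j, holo (q j)) -> L2 (polyform m.+1 q) ->
  (forall x, Aop m (polyform m.+1 q) x = 0) -> forall x, q m x = 0.
Proof.
move=> hq; set G := polyform m.+1 q => LG A0 x.
pose g w := G w * (x - w) ^+ m * cexp (- (w * x^*) + x * x^*).
have mG : measurable_fun setT G by case: LG.
have mxw : measurable_fun setT (fun w : R[i] => (x - w) ^+ m).
  by apply: measC_X; apply: measC_B; [exact: measC_cst|exact: measurable_id].
have he (b : R[i]) : holo (fun w => cexp (- (w * x^*) + b)).
  apply: (holo_comp (f := fun w => - (w * x^*) + b)) (@holo_cexp R).
  by apply: holoD (holo_cst _); apply: holoN; exact: holoM (@holo_id R) (holo_cst _).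
have mg : measurable_fun setT g by apply: measC_M (holo_meas (he _)); exact: measC_M.
have gE w : g w * (expR (complex.Re (w * x^*) *+ 2 - normc x ^+ 2))%:C = G w * tck (lower m) x w.
  rewrite /g -cexpR -mulrA -cexpD /tck /lower mulrA; congr (_ * cexp _).
  by apply: complexP; rewrite ?normc2 !reim /= ?reim /= ?normc2; ring.
have ig : cintegrable mu setT (fun w => g (w + x)).
  apply: (mu_cintegrable_shift mg); under eq_fun do rewrite gE.
  exact: (tc_cintegrable x (tame_lower m) LG).
have mgx : measurable_fun setT (fun w => g (w + x)).
  by apply: measurableT_comp mg _; case: (area_preserving_shift x).
have g0 : cint mu setT (fun w => g (w + x)) = 0.
  rewrite (mu_cint_shift x mg); have := A0 x; rewrite AopE /tc => <-.
  by apply: eq_cint => w _; exact: gE.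
pose u j w := q j (w + x) * cexp (- (w * x^*) + 0).
have hu j : holo (u j).
  apply: holoM (he _); apply: (holo_comp (f := fun w => w + x)) (hq j).
  exact: holoD (@holo_id R) (holo_cst _).
have gxE w : g (w + x) = \sum_(j < m.+1) (-1) ^+ m * (w ^+ m * (w^* + x^*) ^+ j * u j w).
  rewrite /g /G /polyform conjD mulr_suml mulr_suml; apply: eq_bigr => j _; rewrite /u.
  have -> : x - (w + x) = -1 * w by ring.
  have -> : - ((w + x) * x^*) + x * x^* = - (w * x^*) + 0 by ring.
  by rewrite exprMn; ring.
(* Subtracting a multiple of [|w|^2 ^ m] from the translate leaves a function [k] whose
   integrals over discs vanish, so that its full integral vanishes too. *)
pose n2 (w : R[i]) : R[i] := ((normc w ^+ 2) ^+ m)%:C.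
have mn2 : measurable_fun setT n2.
  by apply: measC_real; apply: measurable_funX; apply: measurable_funX; apply: meas_normc; exact: measurable_id.
have in2 : cintegrable mu setT n2.
  apply: (@mu_cintegrable_growth _ _ (expR ((m + m)%:R ^+ 2)) (1 / 4)) => // [|w]; first by lra.
  rewrite normcR ger0_norm ?exprn_ge0 ?normc_ge0 // -exprM mul2n -addnn.
  apply: le_trans (pow_expR_le (m + m) (normc_ge0 w)) _.
  have q4 : 0 < 1 / 4 :> R by lra.
  have -> : (m + m)%:R ^+ 2 = (m + m)%:R ^+ 2 / (4 * (1 / 4)) :> R by field.
  exact: expR_quad_le.
pose k w := g (w + x) - (-1) ^+ m * q m x * n2 w.
have i2 : cintegrable mu setT (fun w => (-1) ^+ m * q m x * n2 w) by exact: cintegrableZ.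
have mk : measurable_fun setT k by apply: measC_B => //; apply: measC_M => //; exact: measC_cst.
have ik : cintegrable mu setT k by exact: cintegrableB.
have k0 : cint mu setT k = 0.
  apply: cint_disc0 => // N.
  pose F (j : 'I_m.+1) w := (-1) ^+ m * (w ^+ m * (w^* + x^*) ^+ j * u j w * (disc N w)%:C).
  have ci j : cintegrable mu setT (fun w => w ^+ m * (w^* + x^*) ^+ j * u j w * (disc N w)%:C).
    apply: cintegrable_disc => z; apply: ccontM (holo_ccont (hu j) z).
    apply: ccontM (holo_ccont (holoX m (@holo_id R)) z) _.
    apply: (ccont_comp (f := fun w => w^* + x^*) (g := fun w => w ^+ j)).
      by apply: ccontD (ccont_conj z) (cder_ccont (cder_cst _ z)).
    exact: holo_ccont (holoX j (@holo_id R)) _.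
  have iF j : cintegrable mu setT (F j) by exact: cintegrableZ.
  have id : cintegrable mu setT (fun w => n2 w * (disc N w)%:C).
    apply: cintegrable_disc => z.
    have -> : n2 = fun w => (w * w^*) ^+ m by apply/funext => w; rewrite normcJM /n2 rmorphXn.
    apply: (ccont_comp (f := fun w => w * w^*) (g := fun w => w ^+ m)).
      by apply: ccontM (ccont_conj z); exact: cder_ccont (cder_id z).
    exact: holo_ccont (holoX m (@holo_id R)) _.
  have -> : (fun w => k w * (disc N w)%:C) =
      fun w => \sum_(j < m.+1) F j w - (-1) ^+ m * q m x * (n2 w * (disc N w)%:C).
    apply/funext => w; rewrite /k gxE mulrBl mulr_suml mulrA; congr (_ - _).
    by apply: eq_bigr => j _; exact/esym/mulrA.
  have [is_ sE] := cint_sum measurableT (index_enum 'I_m.+1) iF.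
  rewrite cintB //; last exact: cintegrableZ.
  rewrite cintZ // sE.
  have FE j : cint mu setT (F j) = (-1) ^+ m * ((if (j : nat) == m then u j 0 else 0) * dmass N m).
    by rewrite /F cintZ // (moment_shift _ _ (hu j)) // -ltnS.
  under eq_bigr do rewrite FE.
  rewrite big_ord_recr /= eqxx big1 ?add0r => [|j _]; last first.
    by rewrite (ltn_eqF (ltn_ord j)) mul0r mulr0.
  have -> : cint mu setT (fun w => n2 w * (disc N w)%:C) = dmass N m.
    by apply: eq_cint => w _; rewrite /n2 -rmorphM.
  by rewrite /u mul0r oppr0 !addr0 add0r cexp0 mulr1 mulrA subrr.
have : cint mu setT k = - ((-1) ^+ m * q m x * m`!%:R).
  by rewrite /k cintB // g0 sub0r cintZ // normc_moment.
rewrite k0 => /esym/eqP; rewrite oppr_eq0 !mulf_eq0 (negPf (natfact_neq0 m)) orbF signr_eq0 /=.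
by move/eqP.
Qed.

Lemma polyform_eq0 n q : (forall j, holo (q j)) -> L2 (polyform n q) ->
  (forall j x, (j < n)%N -> Aop j (polyform n q) x = 0) -> polyform n q = fun=> 0.
Proof.
move=> hq; elim: n => [|n IH] LG A0; first by apply/funext => z; rewrite /polyform big_ord0.
have q0 := lead_polyform_eq0 hq LG (fun x => A0 n x (ltnSn n)).
have E : polyform n.+1 q = polyform n q by apply/funext => z; rewrite /polyform big_ord_recr /= q0 mulr0 addr0.
by move: LG A0; rewrite E => LG A0; apply: IH => // j x /ltnW; exact: A0.
Qed.

End Moments.

(** * The polyanalytic Fock spaces as sums of levels *)

Section Identification.
Context {R : realType}.
Implicit Types (g h u F : R[i] -> R[i]) (q : nat -> R[i] -> R[i]) (z w x c : R[i]).

Lemma lproj_polyform J n u : L2 u -> all (fun j => j < n)%N J ->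
  exists2 q, forall j, holo (q j) & lproj J u = polyform n q.
Proof.
move=> Lu; elim: J => [|j J IH] /=.
  move=> _; exists (fun=> fun=> 0) => [j|]; first exact: holo_cst.
  by apply/funext => z; rewrite /lproj big_nil /polyform big1 // => i _; rewrite mulr0.
move=> /andP[jn /IH[q hq E]].
have [p [hp Ep _]] := rodr_polyform j (holo_Aop j Lu).
exists (fun i z => q i z + fc j * (if (i < j.+1)%N then p i z else 0)).
  move=> i; apply: holoD => //; apply: holoZ; case: (i < j.+1)%N => //; exact: holo_cst.
apply/funext => z; rewrite -polyform_lin -polyform_widen // -E -Ep /lproj big_cons addrC.
by rewrite (Bop_rodr j (F1_Aop j Lu)).
Qed.

Lemma Aop_sublproj J j u x : uniq J -> j \in J -> L2 u ->
  Aop j (fun w => u w + -1 * lproj J u w) x = 0.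
Proof.
move=> uJ jJ Lu; have [LE _] := lproj_L2 J Lu.
have := Aop_lin j 1 (-1) Lu LE; under eq_fun do rewrite mul1r.
by move=> ->; rewrite (Aop_lproj j x uJ Lu) jJ mul1r mulN1r subrr.
Qed.

Lemma L2_sublproj J u : L2 u -> L2 (fun w => u w + -1 * lproj J u w).
Proof.
move=> Lu; have := (L2B Lu (lproj_L2 J Lu).1).1.
by under eq_fun do rewrite -mulN1r.
Qed.

(** The difference of a polyanalytic function and its projection is polyanalytic, in
   L^2, and annihilated by all [Aop j] with [j < n]; so it vanishes. *)
Theorem polyFock_levels n : polyFock n = levels (iota 0 n) :> set (R[i] -> R[i]).
Proof.
have uJ := iota_uniq 0 n.
have aJ : all (fun j => j < n)%N (iota 0 n) by apply/allP => j; rewrite mem_iota.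
apply/seteqP; split=> F.
  move=> [/L2P LF sF /(polyanalytic_polyform sF)[q hq FE]]; split => // z.
  have [p hp EE] := lproj_polyform LF aJ.
  have GE : (fun w => F w + -1 * lproj (iota 0 n) F w) = polyform n (fun j z => q j z + -1 * p j z).
    by apply/funext => w; rewrite -polyform_lin -EE {1}FE.
  have hG j : holo (fun z => q j z + -1 * p j z) by apply: holoD => //; exact: holoZ.
  have LG := L2_sublproj (iota 0 n) LF; rewrite GE in LG.
  have G0 : polyform n (fun j z => q j z + -1 * p j z) = fun=> 0.
    apply: (polyform_eq0 hG LG) => j x jn; rewrite -GE; apply: Aop_sublproj => //.
    by rewrite mem_iota.
  have := congr1 (fun f => f z) (etrans GE G0) => /= /eqP.
  by rewrite mulN1r subr_eq0 => /eqP.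
move=> FF; have [LF _] := FF; have [q hq E] := lproj_polyform LF aJ; rewrite (levels_ext FF) in E.
by split; [exact/L2P|rewrite E; exact: smooth_polyform|move=> z; rewrite E; exact: iter_dzbar_polyform].
Qed.

Lemma lproj1 m u : L2 u -> lproj [:: m] u = fun z => fc m * rodr m (Aop m u) z.
Proof.
by move=> Lu; apply/funext => z; rewrite /lproj big_seq1 (Bop_rodr m (F1_Aop m Lu)).
Qed.

Lemma rodrigues m g z : holo g ->
  (m`!%:R)^-1 * (expR (normc z ^+ 2))%:C *
    iter m d_z (fun w => (expR (- normc w ^+ 2))%:C * g w) z = fc m * rodr m g z.
Proof.
move=> hg; rewrite (iter_dz_gauss m hg) -fcE mulrA -(mulrA (fc m)) /gauss -rmorphM.
by rewrite -expRD subrr expR0 mulr1.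
Qed.

(** Both a function of this space and its projection are [rodr k.-1] of an entire
   function, up to the same factor. The two entire functions agree since they are, up to
   sign, leading coefficients. *)
Theorem true_polyFock_levels k : true_polyFock k = levels [:: k.-1] :> set (R[i] -> R[i]).
Proof.
set m := k.-1; apply/seteqP; split=> F.
  move=> [/L2P LF [g eg FE]]; split => // z.
  have hg : holo g by move=> w; eexists; exact: entire_cder eg w.
  have hA := holo_Aop m LF.
  have {}FE w : F w = fc m * rodr m g w by rewrite FE rodrigues.
  pose h w := g w + -1 * Aop m F w.
  have hh : holo h by apply: holoD => //; exact: holoZ.
  have [q [hq E qm]] := rodr_polyform m hh.
  have GE : (fun w => F w + -1 * lproj [:: m] F w) = fun w => fc m * rodr m h w.
    apply/funext => w; rewrite rodr_lin // FE (lproj1 m LF); ring.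
  pose q' j z := fc m * q j z.
  have GE' : (fun w => F w + -1 * lproj [:: m] F w) = polyform m.+1 q'.
    rewrite GE E; apply/funext => w; rewrite /polyform mulr_sumr.
    by apply: eq_bigr => j _; rewrite /q'; ring.
  have LG := L2_sublproj [:: m] LF; rewrite GE' in LG.
  have hq' j : holo (q' j) by exact: holoZ.
  have top w : q' m w = 0.
    by apply: (lead_polyform_eq0 hq' LG) => x; rewrite -GE' Aop_sublproj // mem_seq1.
  have gA w : g w = Aop m F w.
    have /eqP := top w; rewrite /q' qm !mulf_eq0 signr_eq0 fcE invr_eq0 (negPf (natfact_neq0 m)) /=.
    by rewrite /h mulN1r subr_eq0 => /eqP.
  by rewrite FE (lproj1 m LF); congr (_ * rodr m _ z); apply/funext.
move=> FF; have [LF FE] := FF; split; first exact/L2P.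
have hA := holo_Aop m LF; exists (Aop m F).
  by move=> z; have [l /cder_derivable[]] := hA z.
by move=> z; rewrite rodrigues // FE (lproj1 m LF).
Qed.

End Identification.

Theorem theorem23 (R : realType) (k n : nat) (hk : (0 < k)%N) (hn : (0 < n)%N)
    (f : R[i] -> R[i]) (hf : Lp +oo%E f) :
  (compact_op (polyFock 1) (toeplitz f (polyFock 1)) <->
   compact_op (polyFock n) (toeplitz f (polyFock n))) /\
  (compact_op (true_polyFock 1) (toeplitz f (true_polyFock 1)) ->
   compact_op (true_polyFock k) (toeplitz f (true_polyFock k))).
Proof.
have [Mf Mf0 Hf] := Linfty_mul hf.
rewrite !polyFock_levels !true_polyFock_levels; split; last exact: (compact_up Mf0 Hf).
split; first by apply: (compact_up Mf0 Hf); exact: iota_uniq.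
by apply: (compact_down Hf); rewrite ?iota_uniq // mem_iota.
Qed.
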